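(* For every constant $0<c\le 1$, there is a polynomial-time $\frac{1-e^{-c}}{\lceil 8c\rceil+4}$-approximation algorithm for the Budgeted Connected Dominating Set problem.
   Context: Graphs are simple, connected and undirected. For $v\in V$, $N[v]$ is the closed neighbourhood; for $S\subseteq V$, $N[S]=\bigcup_{v\in S}N[v]$. Budgeted Connected Dominating Set: given $G=(V,E)$ and an integer $k\ge1$, find $S\subseteq V$ with $|S|\le k$ inducing a connected subgraph and maximizing $|N[S]|$. An $\alpha$-approximation algorithm outputs a feasible $S$ with $|N[S]|\ge\alpha\cdot\mathrm{OPT}$, where $\mathrm{OPT}$ is the optimum value. *)

(* Defs.v *)
From HB Require Import structures.
From mathcomp Require Import all_boot all_order all_algebra.
From mathcomp Require Import reals.

Set Implicit Arguments.
Unset Strict Implicit.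
Unset Printing Implicit Defensive.

Import Order.TTheory GRing.Theory Num.Theory.

(* Model of computation: the WHILE language over binary trees of N. D. Jones
   ("Computability and Complexity from a Programming Perspective", MIT Press
   1997), with his unit-cost time measure.  Trees can only be tested for being
   a leaf, there is no tree comparison, so values may be shared as DAGs and the
   measure is polynomially equivalent to Turing machine time. *)
Inductive tree : Type := Leaf | Node of tree & tree.

Fixpoint tree_size (d : tree) : nat :=
  if d is Node l r then (tree_size l + tree_size r).+1 else 1.

Inductive expr : Type :=
  | EVar of nat
  | ELeaf
  | ENode of expr & expr
  | EHd of expr
  | ETl of expr.

Inductive cmd : Type :=
  | CSkip
  | CAssign of nat & expr
  | CSeq of cmd & cmd
  | CIf of expr & cmd & cmd
  | CWhile of expr & cmd.

Definition store := nat -> tree.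

Definition update (s : store) (x : nat) (d : tree) : store :=
  fun y => if y == x then d else s y.

Definition head_tree (d : tree) : tree := if d is Node l _ then l else Leaf.
Definition tail_tree (d : tree) : tree := if d is Node _ r then r else Leaf.
Definition is_node (d : tree) : bool := if d is Node _ _ then true else false.

Fixpoint eval (a : expr) (s : store) : tree :=
  match a with
  | EVar x => s x
  | ELeaf => Leaf
  | ENode a1 a2 => Node (eval a1 s) (eval a2 s)
  | EHd a1 => head_tree (eval a1 s)
  | ETl a1 => tail_tree (eval a1 s)
  end.

Fixpoint expr_cost (a : expr) : nat :=
  match a with
  | EVar _ | ELeaf => 1
  | ENode a1 a2 => (expr_cost a1 + expr_cost a2).+1
  | EHd a1 | ETl a1 => (expr_cost a1).+1
  end.

(* [exec p s t s']: started in store s, the command p halts in store s' after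
   t time units. *)
Inductive exec : cmd -> store -> nat -> store -> Prop :=
  | ExecSkip s : exec CSkip s 1 s
  | ExecAssign x a s :
      exec (CAssign x a) s (expr_cost a).+1 (update s x (eval a s))
  | ExecSeq p q s1 t1 s2 t2 s3 :
      exec p s1 t1 s2 -> exec q s2 t2 s3 -> exec (CSeq p q) s1 (t1 + t2).+1 s3
  | ExecIfTrue a p q s t s' :
      is_node (eval a s) -> exec p s t s' ->
      exec (CIf a p q) s (expr_cost a + t).+1 s'
  | ExecIfFalse a p q s t s' :
      ~~ is_node (eval a s) -> exec q s t s' ->
      exec (CIf a p q) s (expr_cost a + t).+1 s'
  | ExecWhileDone a p s :
      ~~ is_node (eval a s) -> exec (CWhile a p) s (expr_cost a).+1 s
  | ExecWhileStep a p s1 t1 s2 t2 s3 :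
      is_node (eval a s1) -> exec p s1 t1 s2 -> exec (CWhile a p) s2 t2 s3 ->
      exec (CWhile a p) s1 (expr_cost a + t1 + t2).+1 s3.

Lemma exec_det p s t1 s1 t2 s2 :
  exec p s t1 s1 -> exec p s t2 s2 -> t1 = t2 /\ s1 = s2.
Proof.
move=> H; elim: H t2 s2 => {p s t1 s1};
  by intros; match goal with H : exec _ _ ?t ?s |- _ = ?t /\ _ = ?s =>
       inversion H; subst; clear H end;
     repeat match goal with
     | IH : (forall t s, exec ?p ?s1 t s -> _), H : exec ?p ?s1 _ _ |- _ =>
         case: (IH _ _ H) => ? ?; subst; clear H
     | H : is_true ?b, H' : is_true (~~ ?b) |- _ => by rewrite H in H'
     end.
Qed.

(* Input and output are both passed in variable 0. *)
Definition run (p : cmd) (input : tree) (t : nat) (output : tree) : Prop :=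
  exists s', exec p (update (fun=> Leaf) 0 input) t s' /\ s' 0 = output.

Record graph : Type := Graph {
  nv : nat;
  adj : rel 'I_nv;
  adj_sym : symmetric adj;
  adj_irr : irreflexive adj }.

Section GraphNotions.
Variable G : graph.
Implicit Types (v : 'I_(nv G)) (S : {set 'I_(nv G)}).

Definition cl_nbhd v : {set 'I_(nv G)} := [set u | (u == v) || adj v u].

Definition cl_nbhd_set S : {set 'I_(nv G)} := \bigcup_(v in S) cl_nbhd v.

(* A connected graph has at least one vertex. *)
Definition induces_connected S : bool :=
  (S != set0) &&
  [forall u in S, forall v in S,
     connect [rel x y | [&& x \in S, y \in S & adj x y]] u v].

End GraphNotions.

Record bcds_instance : Type := BCDSInstance {
  bgraph : graph;
  budget : nat;
  bgraph_connected : induces_connected [set: 'I_(nv bgraph)];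
  budget_gt0 : 0 < budget }.

Section BCDS.
Variable I : bcds_instance.
Let G := bgraph I.

Definition feasible (S : {set 'I_(nv G)}) : bool :=
  (#|S| <= budget I) && induces_connected S.

Definition bcds_opt : nat :=
  \max_(S : {set 'I_(nv G)} | feasible S) #|cl_nbhd_set S|.

End BCDS.

Definition enc_seq (s : seq tree) : tree := foldr Node Leaf s.

Definition enc_bool (b : bool) : tree := if b then Node Leaf Leaf else Leaf.

Definition enc_bits (s : seq bool) : tree := enc_seq (map enc_bool s).

(* Binary digits of a positive integer, least significant first. *)
Definition binary (k : nat) : seq bool :=
  mkseq (fun i => odd (k %/ 2 ^ i)) (trunc_log 2 k).+1.

Definition enc_graph (G : graph) : tree :=
  enc_seq [seq enc_bits [seq adj u v | v <- enum 'I_(nv G)]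
          | u <- enum 'I_(nv G)].

Definition enc_instance (I : bcds_instance) : tree :=
  Node (enc_graph (bgraph I)) (enc_bits (binary (budget I))).

Definition enc_set (n : nat) (S : {set 'I_n}) : tree :=
  enc_bits [seq v \in S | v <- enum 'I_n].

Definition bcds_polynomial_time (p : cmd) : Prop :=
  exists C d : nat, forall I : bcds_instance, exists t y,
    run p (enc_instance I) t y /\ t <= C * tree_size (enc_instance I) ^ d.

Definition bcds_approximation (R : realType) (alpha : R) (p : cmd) : Prop :=
  forall I : bcds_instance, exists t (S : {set 'I_(nv (bgraph I))}),
    [/\ run p (enc_instance I) t (enc_set S),
        feasible S
      & (alpha * (bcds_opt I)%:R <= #|cl_nbhd_set S|%:R)%R].

(* Main.v *)
Require Import Defs.
From mathcomp Require Import all_boot all_order all_algebra.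
From mathcomp Require Import reals sequences exp.
From mathcomp Require Import zify lra.

Set Implicit Arguments.
Unset Strict Implicit.
Unset Printing Implicit Defensive.

Import Order.TTheory GRing.Theory Num.Theory.

(** One algorithm reaches the ratio 1/18, and 1/18 is at least every ratio of the
    statement.  Let k be the budget, capped by the number of vertices, and guess
    the optimum o.

    A single scan with threshold tau about o/2k selects vertices that cover at
    least tau vertices not covered before; the numbers p(v) of newly covered
    vertices are additive lower bounds for coverage.  The selected vertices that
    meet the neighbourhood of an optimal set S are at distance at most 2 from S,
    so there is a tree W on at most k + 2m vertices, m the number of these
    vertices, with p(W) >= o/2 and p(W) >= m tau.

    To find a good tree, grow moats as in the Goemans-Williamson algorithm, in
    integral time steps, with edges of length o and potential 9(k-1) p(v) at v.
    Clusters that ran out of potential and are leaves of the tree are pruned.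
    Duality shows that some cluster swallows W and that its pruned tree keeps
    profit at least o/18, the moats crossing W being paid for by the edges of W.
    If the pruned tree has more than k vertices, the idea is not to split it but
    to enumerate it in an order in which every prefix satisfies (length) <= 2
    (potential) too; then the prefix of k vertices has profit at least
    o (k-1) / (2 * 9 (k-1)) = o/18. *)

(** * Polynomial-time functions on encoded data *)

(** A pruned tree may have far more than [k] vertices, and the usual analysis bounds only its total
    length, so the order of enumeration has to be part of the induction. No single order per cluster
    survives: a later merge attaches at an arbitrary vertex, and whether a dead part stays depends
    on the vertices that must be kept. Hence one list for each pair of vertices, and a length bound
    for every list of terminals, in which a terminal [y] counts as a pendant edge of length
    [radius s y]. A merge along [ab] makes [a] and [b] terminals of their sides, and the tight edge
    replaces their two pendants. On the constant: with potential factor r(k-1) a prefix earns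
    o/(2r). If the core earned less, then for large k and o the potential rkP of W, where P >= o/2
    is its profit, would have to be covered by kP for the core and (k + 2m) o <= 2kP + 4kP for the
    edges of W; so any r >= 7 works in the limit. The value 9 leaves room for rounding, and 2 * 9 =
    18 still suffices: c = 7/8 makes the ratio of the statement about 1/18.86. *)

Definition poly_bounded (b : nat -> nat) : Prop :=
  {homo b : x y / x <= y} /\ exists c, forall x, b x <= (x + 2) ^ c.

Lemma poly_bounded_id : poly_bounded id.
Proof. by split=> //; exists 1 => x; rewrite expn1 leq_addr. Qed.

Lemma poly_bounded_const m : poly_bounded (fun=> m).
Proof.
split=> //; exists m => x; apply: ltnW; apply: leq_trans (ltn_expl m (isT : 1 < 2)) _.
by case: m => // m; rewrite leq_exp2r // leq_addl.
Qed.

Lemma poly_bounded_add b1 b2 :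
  poly_bounded b1 -> poly_bounded b2 -> poly_bounded (fun x => b1 x + b2 x).
Proof.
move=> [h1 [c1 H1]] [h2 [c2 H2]]; split=> [x y xy|].
  by apply: leq_add; [apply: h1|apply: h2].
exists (c1 + c2).+1 => x; apply: leq_trans (leq_add (H1 x) (H2 x)) _.
have x2 : 1 < x + 2 by lia.
rewrite expnS (leq_trans _ (leq_mul x2 (leqnn _))) // mul2n -addnn.
by apply: leq_add; rewrite leq_exp2l // ?leq_addl ?leq_addr.
Qed.

Lemma poly_bounded_mul b1 b2 :
  poly_bounded b1 -> poly_bounded b2 -> poly_bounded (fun x => b1 x * b2 x).
Proof.
move=> [h1 [c1 H1]] [h2 [c2 H2]]; split=> [x y xy|].
  by apply: leq_mul; [apply: h1|apply: h2].
by exists (c1 + c2) => x; rewrite expnD leq_mul.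
Qed.

Lemma poly_bounded_comp b1 b2 :
  poly_bounded b1 -> poly_bounded b2 -> poly_bounded (fun x => b2 (b1 x)).
Proof.
move=> [h1 [c1 H1]] [h2 [c2 H2]]; split=> [x y xy|]; first exact/h2/h1.
exists (c1.+2 * c2) => x; apply: leq_trans (h2 _ _ (H1 x)) _.
apply: leq_trans (H2 _) _; rewrite expnM.
case: c2 {H2} => // c2; rewrite leq_exp2r // !expnS.
have : 0 < (x + 2) ^ c1 by rewrite expn_gt0 addn2.
by move: ((x + 2) ^ c1) => y; nia.
Qed.

Ltac poly := repeat first
  [ assumption | exact: poly_bounded_id | exact: poly_bounded_const
  | apply: poly_bounded_add | apply: poly_bounded_mul
  | match goal with
    | H : poly_bounded ?b |- poly_bounded (fun x => ?b (@?f x)) =>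
        apply: (@poly_bounded_comp f b) end ].

Class codable (A : Type) := code : A -> tree.
#[global] Instance codable_tree : codable tree := id.
#[global] Instance codable_bool : codable bool := enc_bool.
(** Numbers are unary, so arithmetic is list processing; every number the algorithm computes with is
    polynomially bounded. *)
#[global] Instance codable_nat : codable nat := fun n => enc_seq (nseq n Leaf).
#[global] Instance codable_seq A {cA : codable A} : codable (seq A) :=
  fun s => enc_seq (map code s).
#[global] Instance codable_pair A B {cA : codable A} {cB : codable B} :
  codable (A * B) := fun x => Node (code x.1) (code x.2).

Definition csize A {cA : codable A} (a : A) : nat := tree_size (code a).

(** The initial store is arbitrary outside variable 0, and variables from [N] on are preserved, so
    that larger programs can keep values there. The output size needs its own bound: trees are
    shared, and pairing a variable with itself repeatedly yields a tree of size exponential in the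
    time. *)
Definition ptime A B {cA : codable A} {cB : codable B} (f : A -> B) : Prop :=
  exists p N b, poly_bounded b /\ forall (a : A) (s : store), s 0 = code a ->
    exists t s', [/\ exec p s t s', s' 0 = code (f a),
      (forall i, N <= i -> s' i = s i), t <= b (csize a) & csize (f a) <= b (csize a)].

Lemma csize_gt0 A {cA : codable A} (a : A) : 0 < csize a.
Proof. by rewrite /csize; case: (code a). Qed.

Lemma csize_pair A B {cA : codable A} {cB : codable B} (a : A) (b : B) :
  csize (a, b) = (csize a + csize b).+1.
Proof. by []. Qed.

Lemma csize_cons A {cA : codable A} (a : A) (s : seq A) :
  csize (a :: s) = (csize a + csize s).+1.
Proof. by []. Qed.

Lemma csize_nat n : csize n = n.*2.+1.
Proof. by rewrite /csize /code /codable_nat; elim: n => //= n ->; lia. Qed.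

Lemma ptime_ext A B {cA : codable A} {cB : codable B} (f g : A -> B) :
  f =1 g -> ptime f -> ptime g.
Proof.
move=> fg [p [N [b [pb H]]]]; exists p, N, b; split=> // a s /H [t [s' []]].
by rewrite fg => *; exists t, s'.
Qed.

Section Closure.
Context {A B C : Type} {cA : codable A} {cB : codable B} {cC : codable C}.

Lemma ptime_comp (f : A -> B) (g : B -> C) :
  ptime f -> ptime g -> ptime (fun a => g (f a)).
Proof.
move=> [p [N [b [pb H]]]] [q [M [d [pd K]]]].
exists (CSeq p q), (maxn N M), (fun x => b x + d (b x) + 1); split; first by poly.
move=> a s /H [t [s' [e1 e2 e3 e4 e5]]]; case: (K _ _ e2) => u [s2 [k1 k2 k3 k4 k5]].
have hd : d (csize (f a)) <= d (b (csize a)) by apply: (proj1 pd).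
exists (t + u).+1, s2; split=> //; [exact: ExecSeq e1 k1| |lia|lia].
by move=> i; rewrite geq_max => /andP[h1 h2]; rewrite k3 // e3.
Qed.

Lemma ptime_pair (f : A -> B) (g : A -> C) :
  ptime f -> ptime g -> ptime (fun a => (f a, g a)).
Proof.
move=> [p [N [b [pb H]]]] [q [N' [d [pd K]]]].
(* Register [M] keeps the input and [M.+1] the first result, out of reach of [p] and [q]; the
   successor makes [M] differ from 0 even if [N] and [N'] vanish. *)
pose M := (maxn N N').+1.
exists (CSeq (CAssign M (EVar 0)) (CSeq p (CSeq (CAssign M.+1 (EVar 0))
  (CSeq (CAssign 0 (EVar M)) (CSeq q (CAssign 0 (ENode (EVar M.+1) (EVar 0)))))))).
exists M.+2, (fun x => b x + d x + 20); split; first by poly.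
move=> a s s0; set s1 := update s M (s 0).
case: (H a s1 _) => [|t [s2 [e1 e2 e3 e4 e5]]]; first by rewrite /s1 /update.
set s3 := update s2 M.+1 (s2 0); set s4 := update s3 0 (s3 M).
have s4M : s4 M.+1 = code (f a).
  by rewrite /s4 /s3 /update /= eqxx.
case: (K a s4 _) => [|u [s5 [k1 k2 k3 k4 k5]]].
  rewrite /s4 /update /= /s3 /update [_ == _]negbTE; last lia.
  by rewrite e3 ?/s1 ?/update ?eqxx // /M; lia.
eexists; eexists; split.
- apply: ExecSeq; first exact: ExecAssign.
  apply: ExecSeq; first exact: e1.
  apply: ExecSeq; first exact: ExecAssign.
  apply: ExecSeq; first exact: ExecAssign.
  apply: ExecSeq; first exact: k1.
  exact: ExecAssign.
- by rewrite /update /= k2 k3 ?s4M // /M; lia.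
- move=> i hi; rewrite /update [_ == 0]negbTE; last by lia.
  rewrite k3; last by rewrite /M in hi; lia.
  rewrite /s4 /update [_ == 0]negbTE; last by lia.
  rewrite /s3 /update [_ == _.+1]negbTE; last by lia.
  rewrite e3; last by rewrite /M in hi; lia.
  by rewrite /s1 /update [_ == M]negbTE //; lia.
- rewrite /=; lia.
- rewrite csize_pair; lia.
Qed.

Lemma ptime_if (c : A -> bool) (f g : A -> B) :
  ptime c -> ptime f -> ptime g -> ptime (fun a => if c a then f a else g a).
Proof.
move=> [r [N0 [b0 [pb0 H0]]]] [p [N [b [pb H]]]] [q [N' [d [pd K]]]].
pose M := (maxn N0 (maxn N N')).+1.
exists (CSeq (CAssign M (EVar 0)) (CSeq r (CSeq (CAssign M.+1 (EVar 0))
  (CSeq (CAssign 0 (EVar M)) (CIf (EVar M.+1) p q))))).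
exists M.+2, (fun x => b0 x + b x + d x + 20); split; first by poly.
move=> a s s0; set s1 := update s M (s 0).
case: (H0 a s1 _) => [|t [s2 [e1 e2 e3 e4 e5]]]; first by rewrite /s1 /update.
set s3 := update s2 M.+1 (s2 0); set s4 := update s3 0 (s3 M).
have s4M : s4 M.+1 = code (c a) by rewrite /s4 /s3 /update /= eqxx.
have s40 : s4 0 = code a.
  rewrite /s4 /update /= /s3 /update [_ == _]negbTE; last lia.
  by rewrite e3 ?/s1 ?/update ?eqxx // /M; lia.
have s4i i : M.+2 <= i -> s4 i = s i.
  move=> hi; rewrite /s4 /update [_ == 0]negbTE; last by lia.
  rewrite /s3 /update [_ == _.+1]negbTE; last by lia.
  rewrite e3; last by rewrite /M in hi; lia.
  by rewrite /s1 /update [_ == M]negbTE //; lia.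
have pre t' s' : exec (CIf (EVar M.+1) p q) s4 t' s' ->
   exists2 T, T <= t' + t + 15 & exec (CSeq (CAssign M (EVar 0)) (CSeq r (CSeq (CAssign M.+1 (EVar 0))
     (CSeq (CAssign 0 (EVar M)) (CIf (EVar M.+1) p q))))) s T s'.
  move=> h; eexists; last first.
    apply: ExecSeq; first exact: ExecAssign.
    apply: ExecSeq; first exact: e1.
    apply: ExecSeq; first exact: ExecAssign.
    apply: ExecSeq; first exact: ExecAssign.
    exact: h.
  rewrite /=; lia.
case: ifP => ca.
  case: (H _ _ s40) => u [s5 [k1 k2 k3 k4 k5]].
  have [|T hT hx] := pre (expr_cost (EVar M.+1) + u).+1 s5.
    by apply: ExecIfTrue k1; rewrite /= s4M ca.
  rewrite /= in hT; exists T, s5; split=> //; [|lia|lia].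
  by move=> i hi; rewrite k3 ?s4i //; move: hi; rewrite /M; lia.
case: (K _ _ s40) => u [s5 [k1 k2 k3 k4 k5]].
have [|T hT hx] := pre (expr_cost (EVar M.+1) + u).+1 s5.
  by apply: ExecIfFalse k1; rewrite /= s4M ca.
rewrite /= in hT; exists T, s5; split=> //; [|lia|lia].
by move=> i hi; rewrite k3 ?s4i //; move: hi; rewrite /M; lia.
Qed.

End Closure.

Fixpoint expr_over0 (e : expr) : bool :=
  match e with
  | EVar x => x == 0 | ELeaf => true
  | ENode a b => expr_over0 a && expr_over0 b
  | EHd a | ETl a => expr_over0 a
  end.

Lemma eval_over0 e s s' : expr_over0 e -> s 0 = s' 0 -> eval e s = eval e s'.
Proof.
by move=> + h; elim: e => //= [x /eqP ->|a IHa b IHb /andP[/IHa -> /IHb ->]|a IHa /IHa ->|a IHa /IHa ->].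
Qed.

Lemma tree_size_eval e s : expr_over0 e ->
  tree_size (eval e s) <= expr_cost e * tree_size (s 0).
Proof.
have z : 0 < tree_size (s 0) by case: (s 0).
elim: e => /= [x /eqP ->|_|a IHa b IHb /andP[/IHa ha /IHb hb]|a IHa /IHa ha|a IHa /IHa ha].
- by rewrite mul1n.
- by rewrite mul1n.
- nia.
- by case: (eval a s) ha => [|l r] /=; nia.
- by case: (eval a s) ha => [|l r] /=; nia.
Qed.

(** For functions that rearrange a bounded part of the code without a loop; on codes, consing a pair
    is the identity and the successor adds one node. *)
Lemma ptime_expr A B {cA : codable A} {cB : codable B} (f : A -> B) (e : expr) :
  expr_over0 e -> (forall a, code (f a) = eval e (fun=> code a)) -> ptime f.
Proof.
move=> he H; exists (CAssign 0 e), 1, (fun x => expr_cost e * x + (expr_cost e).+1).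
split; first by poly.
move=> a s s0; exists (expr_cost e).+1, (update s 0 (eval e s)); split.
- exact: ExecAssign.
- by rewrite /update /= H; apply: eval_over0.
- by move=> [].
- by rewrite leq_addl.
- by rewrite /csize H; apply: leq_trans (tree_size_eval _ he) _; rewrite leq_addr.
Qed.

Fixpoint expr_of_tree (d : tree) : expr :=
  if d is Node l r then ENode (expr_of_tree l) (expr_of_tree r) else ELeaf.

Lemma ptime_const A B {cA : codable A} {cB : codable B} (y : B) :
  ptime (fun _ : A => y).
Proof.
apply: (@ptime_expr _ _ _ _ _ (expr_of_tree (code y))).
  by elim: (code y) => //= l -> r ->.
by move=> a; elim: (code y) => //= l <- r <-.
Qed.

Lemma ptime_id A {cA : codable A} : ptime (fun a : A => a).
Proof. exact: (@ptime_expr _ _ _ _ _ (EVar 0)). Qed.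

Section Fold.
Context {A X S : Type} {cA : codable A} {cX : codable X} {cS : codable S}.
Variables (l : A -> seq X) (i : A -> S) (step : A -> X -> S -> S).

(** A loop over a polynomial-time step can square the size of its state each time, hence the
    hypothesis on all intermediate states. The program keeps the parameter, the remaining list and
    the state in registers [M], [M.+1] and [M.+2]. *)
Lemma ptime_foldl :
  ptime l -> ptime i -> ptime (fun q : A * X * S => step q.1.1 q.1.2 q.2) ->
  (exists2 b, poly_bounded b &
    forall a j, csize (foldl (fun s x => step a x s) (i a) (take j (l a))) <= b (csize a)) ->
  ptime (fun a => foldl (fun s x => step a x s) (i a) (l a)).
Proof.
move=> [p1 [N1 [b1 [pb1 H1]]]] [p2 [N2 [b2 [pb2 H2]]]] [p3 [N3 [b3 [pb3 H3]]]].
case=> b pb Hb; pose M := (maxn N1 (maxn N2 N3)).+1.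
pose body := CSeq (CAssign 0 (ENode (ENode (EVar M) (EHd (EVar M.+1))) (EVar M.+2)))
  (CSeq (CAssign M.+1 (ETl (EVar M.+1))) (CSeq p3 (CAssign M.+2 (EVar 0)))).
exists (CSeq (CAssign M (EVar 0)) (CSeq p1 (CSeq (CAssign M.+1 (EVar 0))
  (CSeq (CAssign 0 (EVar M)) (CSeq p2 (CSeq (CAssign M.+2 (EVar 0))
  (CSeq (CWhile (EVar M.+1) body) (CAssign 0 (EVar M.+2))))))))).
pose B x := b3 (x + b1 x + b x + 2) + 30.
exists M.+3, (fun x => b1 x + b2 x + b1 x * B x + b x + 60).
split; first by rewrite /B; poly.
move=> a s s0.
have loop r st acc : st M = code a -> st M.+1 = code r -> st M.+2 = code acc ->
    (forall j, csize (foldl (fun s x => step a x s) acc (take j r)) <= b (csize a)) ->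
    csize r <= b1 (csize a) ->
    exists t st', [/\ exec (CWhile (EVar M.+1) body) st t st',
      st' M.+2 = code (foldl (fun s x => step a x s) acc r),
      forall k, M.+3 <= k -> st' k = st k & t <= size r * B (csize a) + 2].
  elim: r st acc => [|x r IH] st acc hM hM1 hM2 hb hr.
    exists 2, st; split=> //.
    by apply: (@ExecWhileDone (EVar M.+1)); rewrite /= hM1.
  set st1 := update st 0 (eval (ENode (ENode (EVar M) (EHd (EVar M.+1))) (EVar M.+2)) st).
  set st2 := update st1 M.+1 (eval (ETl (EVar M.+1)) st1).
  have e20 : st2 0 = code (a, x, acc).
    by rewrite /st2 /update /= /st1 /update /= hM hM1 hM2.
  have [t [st3 [e1 e2 e3 e4 e5]]] := H3 (a, x, acc) st2 e20.
  rewrite /= in e2.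
  set st4 := update st3 M.+2 (st3 0).
  have st3E k : M < k.+1 -> st3 k = st2 k by move=> hk; apply: e3; rewrite /M in hk; lia.
  have h4M : st4 M = code a.
    rewrite /st4 /update [_ == _]negbTE; last lia.
    rewrite st3E // /st2 /update [_ == _]negbTE; last lia.
    by rewrite /st1 /update [_ == _]negbTE //; lia.
  have h4M1 : st4 M.+1 = code r.
    rewrite /st4 /update [_ == _]negbTE; last lia.
    rewrite st3E // /st2 /update eqxx /= /st1 /update /=.
    by rewrite hM1.
  have h4M2 : st4 M.+2 = code (step a x acc) by rewrite /st4 /update eqxx e2.
  have [||t' [st5 [w1 w2 w3 w4]]] := IH st4 _ h4M h4M1 h4M2.
    by move=> j; have := hb j.+1.
    by rewrite csize_cons in hr; lia.
  have he : csize (a, x, acc) <= csize a + b1 (csize a) + b (csize a) + 2.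
    have := hb 0; rewrite take0 /= !csize_pair.
    by rewrite csize_cons in hr; lia.
  have hB : t + 30 <= B (csize a).
    by rewrite /B leq_add2r (leq_trans e4) //; apply: (proj1 pb3).
  eexists; exists st5; split.
  - apply: ExecWhileStep w1; first by rewrite /= hM1.
    apply: ExecSeq; first exact: ExecAssign.
    apply: ExecSeq; first exact: ExecAssign.
    apply: ExecSeq; first exact: e1.
    exact: ExecAssign.
  - exact: w2.
  - move=> k hk; rewrite w3 // /st4 /update [_ == _]negbTE; last lia.
    rewrite st3E; last lia.
    rewrite /st2 /update [_ == _]negbTE; last lia.
    by rewrite /st1 /update [_ == _]negbTE //; lia.
  - rewrite /= mulSn; lia.
set s1 := update s M (s 0).
case: (H1 a s1 _) => [|t [s2 [e1 e2 e3 e4 e5]]]; first by rewrite /s1 /update.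
set s3 := update s2 M.+1 (s2 0); set s4 := update s3 0 (s3 M).
have s2M : s2 M = code a by rewrite e3 ?/s1 ?/update ?eqxx // /M; lia.
have s40 : s4 0 = code a.
  by rewrite /s4 /update /= /s3 /update [_ == _]negbTE //; lia.
have [u [s5 [k1 k2 k3 k4 k5]]] := H2 a s4 s40.
set s6 := update s5 M.+2 (s5 0).
have s5E k : M < k.+1 -> s5 k = s4 k by move=> hk; apply: k3; rewrite /M in hk; lia.
have h6M : s6 M = code a.
  rewrite /s6 /update [_ == _]negbTE; last lia.
  rewrite s5E // /s4 /update /= /s3 /update [_ == _]negbTE //; lia.
have h6M1 : s6 M.+1 = code (l a).
  rewrite /s6 /update [_ == _]negbTE; last lia.
  by rewrite s5E // /s4 /update /= /s3 /update eqxx.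
have h6M2 : s6 M.+2 = code (i a) by rewrite /s6 /update eqxx.
have [v [s7 [w1 w2 w3 w4]]] := loop _ _ _ h6M h6M1 h6M2 (Hb a) e5.
have hsz : size (l a) <= b1 (csize a).
  apply: leq_trans e5; rewrite /csize /code /codable_seq.
  by elim: (l a) => //= y r IH; rewrite ltnS (leq_trans IH) // leq_addl.
have hm : size (l a) * B (csize a) <= b1 (csize a) * B (csize a) by rewrite leq_mul2r hsz orbT.
eexists; eexists; split.
- apply: ExecSeq; first exact: ExecAssign.
  apply: ExecSeq; first exact: e1.
  apply: ExecSeq; first exact: ExecAssign.
  apply: ExecSeq; first exact: ExecAssign.
  apply: ExecSeq; first exact: k1.
  apply: ExecSeq; first exact: ExecAssign.
  apply: ExecSeq; first exact: w1.
  exact: ExecAssign.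
- by rewrite /update /= w2.
- move=> k hk; rewrite /update [_ == 0]negbTE; last lia.
  rewrite w3 // /s6 /update [_ == _]negbTE; last lia.
  rewrite s5E; last lia.
  rewrite /s4 /update [_ == _]negbTE; last lia.
  rewrite /s3 /update [_ == _]negbTE; last lia.
  rewrite e3; last by rewrite /M in hk; lia.
  by rewrite /s1 /update [_ == _]negbTE //; lia.
- rewrite /=; lia.
- have := Hb a (size (l a)); rewrite take_size; lia.
Qed.

End Fold.

Lemma ptime_size A B {cA : codable A} {cB : codable B} (f : A -> B) :
  ptime f -> exists2 b, poly_bounded b & forall a, csize (f a) <= b (csize a).
Proof.
move=> [p [N [b [pb H]]]]; exists b => // a.
by have [t [s' []]] := H a (fun=> code a) erefl.
Qed.

Lemma csize_take A {cA : codable A} j (s : seq A) : csize (take j s) <= csize s.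
Proof.
elim: s j => [|x s IH] [|j] //=.
by rewrite !csize_cons; have := IH j; lia.
Qed.

Lemma size_csize A {cA : codable A} (s : seq A) : size s < csize s.
Proof. by elim: s => //= x s IH; rewrite csize_cons; lia. Qed.

Lemma csize_mem (A : eqType) {cA : codable A} (s : seq A) x : x \in s -> csize x < csize s.
Proof.
elim: s => //= y s IH; rewrite inE csize_cons => /orP[/eqP ->|/IH]; lia.
Qed.

Lemma csize_seq_le A {cA : codable A} m (s : seq A) :
  all (fun x => csize x <= m) s -> csize s <= size s * m.+1 + 1.
Proof.
by elim: s => //= x s IH /andP[hx /IH]; rewrite csize_cons mulSn; lia.
Qed.

Section FoldCorollaries.
Context {A X S : Type} {cA : codable A} {cX : codable X} {cS : codable S}.
Variables (l : A -> seq X) (i : A -> S) (step : A -> X -> S -> S).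

(** The index of the invariant serves quantities that grow by one per step, such as moat widths:
    they are polynomial only because the loop is short. *)
Lemma ptime_foldl_inv (I : A -> nat -> S -> Prop) :
  ptime l -> ptime i -> ptime (fun q : A * X * S => step q.1.1 q.1.2 q.2) ->
  (forall a, I a 0 (i a)) -> (forall a j x s, I a j s -> I a j.+1 (step a x s)) ->
  (exists2 b, poly_bounded b &
    forall a j s, j <= size (l a) -> I a j s -> csize s <= b (csize a)) ->
  ptime (fun a => foldl (fun s x => step a x s) (i a) (l a)).
Proof.
move=> pl pi ps I0 I1 [b pb Hb]; apply: ptime_foldl => //; exists b => // a j.
apply: (Hb a (size (take j (l a)))); first by rewrite size_take; case: ltnP; lia.
rewrite -[size _]add0n; elim: (take j (l a)) 0 (i a) (I0 a) => [|x r IH] m s /=.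
  by rewrite addn0.
by rewrite addnS -addSn => /(I1 _ _ x)/IH.
Qed.

Lemma ptime_foldl_add :
  ptime l -> ptime i -> ptime (fun q : A * X * S => step q.1.1 q.1.2 q.2) ->
  (exists2 b, poly_bounded b &
     forall a x s, csize (step a x s) <= csize s + b (csize a + csize x)) ->
  ptime (fun a => foldl (fun s x => step a x s) (i a) (l a)).
Proof.
move=> pl pi ps [b pb Hb]; apply: ptime_foldl => //.
have [bl pbl Hl] := ptime_size pl; have [bi pbi Hi] := ptime_size pi.
exists (fun x => bi x + bl x * b (x + bl x)); first by poly.
move=> a j.
have gen r s : csize r <= bl (csize a) ->
    csize (foldl (fun s x => step a x s) s r) <=
    csize s + size r * b (csize a + bl (csize a)).
  elim: r s => [|x r IH] s /=; first by lia.
  rewrite csize_cons => hr; apply: leq_trans (IH _ _) _; first lia.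
  have := Hb a x s.
  have : b (csize a + csize x) <= b (csize a + bl (csize a)) by apply: (proj1 pb); lia.
  by lia.
apply: leq_trans (gen _ _ (leq_trans (csize_take _ _) (Hl a))) _.
apply: leq_add => //; rewrite leq_mul2r; apply/orP; right.
by apply: leq_trans (Hl a); rewrite (leq_trans (ltnW (size_csize _)) (csize_take _ _)).
Qed.

End FoldCorollaries.

Section Compose.
Context {Z A B C D E : Type} {cZ : codable Z} {cA : codable A} {cB : codable B}
  {cC : codable C} {cD : codable D} {cE : codable E}.

Lemma ptime_comp2 (F : A -> B -> C) (f : Z -> A) (g : Z -> B) :
  ptime (fun q : A * B => F q.1 q.2) -> ptime f -> ptime g ->
  ptime (fun z => F (f z) (g z)).
Proof.
by move=> pF pf pg; apply: (ptime_comp (f := fun z => (f z, g z)) _ pF); apply: ptime_pair.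
Qed.

Lemma ptime_comp3 (F : A -> B -> C -> D) (f : Z -> A) (g : Z -> B) (h : Z -> C) :
  ptime (fun q : A * B * C => F q.1.1 q.1.2 q.2) -> ptime f -> ptime g -> ptime h ->
  ptime (fun z => F (f z) (g z) (h z)).
Proof.
move=> pF pf pg ph; apply: (ptime_comp (f := fun z => (f z, g z, h z)) _ pF).
by apply: ptime_pair => //; apply: ptime_pair.
Qed.

Lemma ptime_comp4 (F : A -> B -> C -> D -> E)
    (f : Z -> A) (g : Z -> B) (h : Z -> C) (k : Z -> D) :
  ptime (fun q : A * B * C * D => F q.1.1.1 q.1.1.2 q.1.2 q.2) ->
  ptime f -> ptime g -> ptime h -> ptime k ->
  ptime (fun z => F (f z) (g z) (h z) (k z)).
Proof.
move=> pF pf pg ph pk; apply: (ptime_comp (f := fun z => (f z, g z, h z, k z)) _ pF).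
by apply: ptime_pair => //; apply: ptime_pair => //; apply: ptime_pair.
Qed.

End Compose.

Section Projections.
Context {Z A B : Type} {cZ : codable Z} {cA : codable A} {cB : codable B}.

Lemma ptime_fst (f : Z -> A * B) : ptime f -> ptime (fun z => (f z).1).
Proof.
move=> pf; apply: (ptime_comp (g := fst) pf).
exact: (@ptime_expr _ _ _ _ _ (EHd (EVar 0))).
Qed.

Lemma ptime_snd (f : Z -> A * B) : ptime f -> ptime (fun z => (f z).2).
Proof.
move=> pf; apply: (ptime_comp (g := snd) pf).
exact: (@ptime_expr _ _ _ _ _ (ETl (EVar 0))).
Qed.

Lemma ptime_cons (f : Z -> A) (g : Z -> seq A) :
  ptime f -> ptime g -> ptime (fun z => f z :: g z).
Proof.
move=> pf pg; apply: ptime_comp2 pf pg.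
exact: (@ptime_expr _ _ _ _ _ (EVar 0)).
Qed.

Lemma ptime_behead (f : Z -> seq A) : ptime f -> ptime (fun z => behead (f z)).
Proof.
move=> pf; apply: (ptime_comp (g := behead) pf).
by apply: (@ptime_expr _ _ _ _ _ (ETl (EVar 0))) => // -[|x s].
Qed.

Lemma ptime_head (x0 : A) (f : Z -> seq A) : code x0 = Leaf ->
  ptime f -> ptime (fun z => head x0 (f z)).
Proof.
move=> h0 pf; apply: (ptime_comp (g := head x0) pf).
by apply: (@ptime_expr _ _ _ _ _ (EHd (EVar 0))) => // -[|x s].
Qed.

Lemma ptime_nilp (f : Z -> seq A) : ptime f -> ptime (fun z => nilp (f z)).
Proof.
move=> [p [N [b [pb H]]]].
pose M := N.+1.
exists (CSeq p (CIf (EVar 0) (CAssign 0 ELeaf) (CAssign 0 (ENode ELeaf ELeaf)))), M.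
exists (fun x => b x + 10); split; first by poly.
move=> z s /H [t [s' [e1 e2 e3 e4 e5]]].
case fz: (f z) e2 => [|x r] /= e2.
  eexists; eexists; split.
  - apply: ExecSeq e1 _; apply: ExecIfFalse; first by rewrite /= e2.
    exact: ExecAssign.
  - by [].
  - by move=> [|i] // hi; rewrite /update /= e3 //; lia.
  - rewrite /=; lia.
  - rewrite /csize /=; lia.
eexists; eexists; split.
- apply: ExecSeq e1 _; apply: ExecIfTrue; first by rewrite /= e2.
  exact: ExecAssign.
- by [].
- by move=> [|i] // hi; rewrite /update /= e3 //; lia.
- rewrite /=; lia.
- rewrite /csize /=; lia.
Qed.

End Projections.

Section Booleans.
Context {Z : Type} {cZ : codable Z}.
Variables f g : Z -> bool.
Hypotheses (pf : ptime f) (pg : ptime g).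

Lemma ptime_negb : ptime (fun z => ~~ f z).
Proof. by apply: (ptime_if (f := fun=> false) (g := fun=> true)) => //; apply: ptime_const. Qed.

Lemma ptime_andb : ptime (fun z => f z && g z).
Proof. by apply: (ptime_if (f := g) (g := fun=> false)) => //; apply: ptime_const. Qed.

Lemma ptime_orb : ptime (fun z => f z || g z).
Proof. by apply: (ptime_if (f := fun=> true) (g := g)) => //; apply: ptime_const. Qed.

End Booleans.


Lemma ptime_rev Z A {cZ : codable Z} {cA : codable A} (f : Z -> seq A) : ptime f -> ptime (fun z => rev (f z)).
Proof.
move=> pf; apply: (ptime_ext (f := fun z => foldl (fun s x => x :: s) [::] (f z))).
  move=> z; rewrite /rev; elim: (f z) [::] => //= x r IH s; exact: IH.
apply: (ptime_foldl_add (i := fun=> [::]) (step := fun _ x s => x :: s)) => //.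
- exact: ptime_const.
- by apply: ptime_cons; [apply/ptime_snd/ptime_fst/ptime_id|apply/ptime_snd/ptime_id].
- exists (fun x => x + 1); first by poly.
  by move=> a x s; rewrite csize_cons; lia.
Qed.

Lemma ptime_map Z A B {cZ : codable Z} {cA : codable A} {cB : codable B} (l : Z -> seq A) (F : Z -> A -> B) :
  ptime l -> ptime (fun q : Z * A => F q.1 q.2) ->
  ptime (fun z => map (F z) (l z)).
Proof.
move=> pl pF; apply: (ptime_ext (f := fun z => rev (foldl (fun s x => F z x :: s) [::] (l z)))).
  move=> z; rewrite -[RHS]revK; congr rev; rewrite /rev.
  by elim: (l z) [::] => //= x r IH s; rewrite IH.
apply: ptime_rev.
apply: (ptime_foldl_add (i := fun=> [::]) (step := fun z x s => F z x :: s)) => //.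
- exact: ptime_const.
- apply: ptime_cons; last exact/ptime_snd/ptime_id.
  by apply: (ptime_comp (g := fun q : Z * A => F q.1 q.2)) pF; apply/ptime_fst/ptime_id.
- have [b pb Hb] := ptime_size pF.
  exists (fun x => b (x + 1) + 1); first by poly.
  by move=> a x s; rewrite csize_cons; have := Hb (a, x); rewrite csize_pair -addn1 /=; lia.
Qed.

Lemma ptime_cat Z A {cZ : codable Z} {cA : codable A} (f g : Z -> seq A) : ptime f -> ptime g -> ptime (fun z => f z ++ g z).
Proof.
move=> pf pg; apply: (ptime_ext (f := fun z => foldl (fun s x => x :: s) (g z) (rev (f z)))).
  move=> z; rewrite -[in RHS](revK (f z)).
  by elim: (rev (f z)) (g z) => //= x r IH s; rewrite IH rev_cons cat_rcons.
apply: (ptime_foldl_add (step := fun _ x s => x :: s)) => //.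
- exact: ptime_rev.
- by apply: ptime_cons; [apply/ptime_snd/ptime_fst/ptime_id|apply/ptime_snd/ptime_id].
- exists (fun x => x + 1); first by poly.
  by move=> a x s; rewrite csize_cons; lia.
Qed.

Lemma ptime_filter Z A {cZ : codable Z} {cA : codable A} (l : Z -> seq A) (P : Z -> A -> bool) :
  ptime l -> ptime (fun q : Z * A => P q.1 q.2) ->
  ptime (fun z => filter (P z) (l z)).
Proof.
move=> pl pP.
apply: (ptime_ext (f := fun z => rev (foldl (fun s x => if P z x then x :: s else s) [::] (l z)))).
  move=> z; rewrite -[RHS]revK; congr rev; rewrite /rev.
  by elim: (l z) [::] => //= x r IH s; rewrite IH; case: ifP.
apply: ptime_rev.
apply: (ptime_foldl_add (i := fun=> [::]) (step := fun z x s => if P z x then x :: s else s)) => //.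
- exact: ptime_const.
- apply: ptime_if.
  + by apply: (ptime_comp (g := fun q : Z * A => P q.1 q.2)) pP; apply/ptime_fst/ptime_id.
  + by apply: ptime_cons; [apply/ptime_snd/ptime_fst/ptime_id|apply/ptime_snd/ptime_id].
  + exact/ptime_snd/ptime_id.
- exists (fun x => x + 1); first by poly.
  by move=> a x s; case: ifP => _; rewrite ?csize_cons; lia.
Qed.

Lemma ptime_flatten Z A {cZ : codable Z} {cA : codable A} (l : Z -> seq (seq A)) : ptime l -> ptime (fun z => flatten (l z)).
Proof.
move=> pl; apply: (ptime_ext (f := fun z => foldl (fun s x => s ++ x) [::] (l z))).
  move=> z; rewrite -[RHS]cat0s.
  by elim: (l z) [::] => [|x r IH] s /=; rewrite ?cats0 // IH catA.
apply: (ptime_foldl_add (i := fun=> [::]) (step := fun _ x s => s ++ x)) => //.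
- exact: ptime_const.
- by apply: ptime_cat; [apply/ptime_snd/ptime_id|apply/ptime_snd/ptime_fst/ptime_id].
- exists (fun x => x); first by poly.
  move=> a x s; elim: s => [|y s IH] /=; first lia.
  by rewrite !csize_cons; lia.
Qed.

Lemma ptime_succn Z {cZ : codable Z} (f : Z -> nat) : ptime f -> ptime (fun z => (f z).+1).
Proof.
move=> pf; apply: (ptime_comp (g := succn) pf).
exact: (@ptime_expr _ _ _ _ _ (ENode ELeaf (EVar 0))).
Qed.

Lemma ptime_predn Z {cZ : codable Z} (f : Z -> nat) : ptime f -> ptime (fun z => (f z).-1).
Proof.
move=> pf; apply: (ptime_comp (g := predn) pf).
by apply: (@ptime_expr _ _ _ _ _ (ETl (EVar 0))) => // -[].
Qed.

Lemma ptime_size_seq Z A {cZ : codable Z} {cA : codable A} (l : Z -> seq A) : ptime l -> ptime (fun z => size (l z)).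
Proof.
move=> pl; apply: (ptime_ext (f := fun z => foldl (fun s _ => s.+1) 0 (l z))).
  by move=> z; rewrite -[RHS]add0n; elim: (l z) 0 => [|x r IH] s //=; rewrite ?addn0 // IH addnS.
apply: (ptime_foldl_add (i := fun=> 0) (step := fun _ _ s => s.+1)) => //.
- exact: ptime_const.
- exact/ptime_succn/ptime_snd/ptime_id.
- exists (fun x => 2); first by poly.
  by move=> a x s; rewrite !csize_nat; lia.
Qed.


Lemma ptime_nseq_Leaf Z {cZ : codable Z} (f : Z -> nat) : ptime f -> ptime (fun z => nseq (f z) Leaf).
Proof.
move=> pf; apply: (ptime_comp (g := fun n => nseq n Leaf) pf).
apply: (@ptime_expr _ _ _ _ _ (EVar 0)) => // n /=.
by rewrite /code /codable_seq /codable_nat map_nseq.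
Qed.

Lemma ptime_iter Z A {cZ : codable Z} {cA : codable A} (f : Z -> nat) (i : Z -> A) (step : Z -> A -> A) :
  ptime f -> ptime i -> ptime (fun q : Z * A => step q.1 q.2) ->
  (exists2 b, poly_bounded b & forall z s, csize (step z s) <= csize s + b (csize z)) ->
  ptime (fun z => iter (f z) (step z) (i z)).
Proof.
move=> pf pi ps [b pb Hb].
apply: (ptime_ext (f := fun z => foldl (fun s _ => step z s) (i z) (nseq (f z) Leaf))).
  by move=> z; elim: (f z) (i z) => //= m IH s; rewrite IH -iterSr.
apply: (ptime_foldl_add (step := fun z _ s => step z s)) => //; first exact: ptime_nseq_Leaf.
  apply: (ptime_comp2 ps); [exact/ptime_fst/ptime_fst/ptime_id|exact/ptime_snd/ptime_id].
exists b => // a x s; apply: leq_trans (Hb a s) _.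
by rewrite leq_add2l; apply: (proj1 pb); lia.
Qed.

Section Arithmetic.
Context {Z : Type} {cZ : codable Z}.
Variables f g : Z -> nat.
Hypotheses (pf : ptime f) (pg : ptime g).

Lemma ptime_addn : ptime (fun z => f z + g z).
Proof.
apply: (ptime_ext (f := fun z => iter (f z) succn (g z))).
  by move=> z; elim: (f z) => //= m ->.
apply: (ptime_iter (step := fun _ => succn)) => //; first exact/ptime_succn/ptime_snd/ptime_id.
by exists (fun=> 2); [poly|move=> z s; rewrite !csize_nat; lia].
Qed.

Lemma ptime_subn : ptime (fun z => f z - g z).
Proof.
apply: (ptime_ext (f := fun z => iter (g z) predn (f z))).
  by move=> z; elim: (g z) => [|m /= ->]; rewrite ?subn0 // subnS.
apply: (ptime_iter (step := fun _ => predn)) => //; first exact/ptime_predn/ptime_snd/ptime_id.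
by exists (fun=> 2); [poly|move=> z s; rewrite !csize_nat; lia].
Qed.

Lemma ptime_eq0 : ptime (fun z => f z == 0).
Proof.
apply: (ptime_ext (f := fun z => nilp (nseq (f z) Leaf))); first by move=> z; case: (f z).
exact/ptime_nilp/ptime_nseq_Leaf.
Qed.

End Arithmetic.

Section MoreArithmetic.
Context {Z : Type} {cZ : codable Z}.
Variables f g : Z -> nat.
Hypotheses (pf : ptime f) (pg : ptime g).

Lemma ptime_leq : ptime (fun z => f z <= g z).
Proof. exact/ptime_eq0/ptime_subn. Qed.

Lemma ptime_eqn : ptime (fun z => f z == g z).
Proof.
apply: (ptime_ext (f := fun z => (f z - g z) + (g z - f z) == 0)); first by move=> z; lia.
by apply/ptime_eq0/ptime_addn; apply: ptime_subn.
Qed.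

Lemma ptime_minn : ptime (fun z => minn (f z) (g z)).
Proof.
apply: (ptime_ext (f := fun z => f z - (f z - g z))); first by move=> z; lia.
by apply: ptime_subn => //; apply: ptime_subn.
Qed.

Lemma ptime_maxn : ptime (fun z => maxn (f z) (g z)).
Proof.
apply: (ptime_ext (f := fun z => f z + (g z - f z))); first by move=> z; lia.
by apply: ptime_addn => //; apply: ptime_subn.
Qed.

Lemma ptime_muln : ptime (fun z => f z * g z).
Proof.
apply: (ptime_ext (f := fun z => iter (f z) (addn (g z)) 0)).
  by move=> z; elim: (f z) => //= m ->.
have [b pb Hb] := ptime_size pg.
apply: (ptime_iter (i := fun=> 0) (step := fun z => addn (g z))) => //.
- exact: ptime_const.
- apply: ptime_addn; last exact/ptime_snd/ptime_id.
  by apply: (ptime_comp (g := g)) pg; apply/ptime_fst/ptime_id.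
- by exists b => // z s; have := Hb z; rewrite !csize_nat; lia.
Qed.

Lemma ptime_iota : ptime (fun z => iota 0 (f z)).
Proof.
apply: (ptime_ext (f := fun z => rev (iter (f z) (fun s => size s :: s) [::]))).
  move=> z; rewrite -[RHS]revK; congr rev.
  by elim: (f z) => // m IH; rewrite iterS IH size_rev size_iota -[in RHS]addn1 iotaD rev_cat.
apply: ptime_rev.
apply: (ptime_ext (f := fun z => (iter (f z) (fun s => (s.1.+1, s.1 :: s.2)) (0, [::])).2)).
  move=> z; have -> : iter (f z) (fun s => (s.1.+1, s.1 :: s.2)) (0, [::]) =
    (f z, iter (f z) (fun s => size s :: s) [::]) => //.
  have szE m : size (iter m (fun s : seq nat => size s :: s) [::]) = m by elim: m => //= m ->.
  by elim: (f z) => //= m -> /=; rewrite szE.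
have p1 : ptime (fun q : Z * (nat * seq nat) => (q.2.1.+1, q.2.1 :: q.2.2)).
  apply: ptime_pair; first exact/ptime_succn/ptime_fst/ptime_snd/ptime_id.
  by apply: ptime_cons; [apply/ptime_fst/ptime_snd/ptime_id|apply/ptime_snd/ptime_snd/ptime_id].
apply: ptime_snd.
apply: (ptime_ext (f := fun z => foldl (fun s _ => (s.1.+1, s.1 :: s.2)) (0, [::])
   (nseq (f z) Leaf))).
  move=> z; move: (0, _) => s; elim: (f z) s => //= m IH s; rewrite IH -iterSr //.
have [b pb Hb] := ptime_size pf.
apply: (ptime_foldl (i := fun=> (0, [::])) (step := fun _ _ s => (s.1.+1, s.1 :: s.2))).
- exact: ptime_nseq_Leaf.
- exact: ptime_const.
- by apply: (ptime_comp (f := fun q : Z * tree * (nat * seq nat) => (q.1.1, q.2)) _ p1);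
    apply: ptime_pair; [apply/ptime_fst/ptime_fst/ptime_id|apply/ptime_snd/ptime_id].
- exists (fun x => (b x) * (b x) * 4 + 10); first by poly.
  move=> a j; have := Hb a; rewrite csize_nat; move: (b (csize a)) => B hB.
  have : size (take j (nseq (f a) Leaf)) <= f a by rewrite size_take size_nseq; case: ltnP; lia.
  move: (take j _) => r hr.
  have H m (s : seq nat) : csize (foldl (fun (s : nat * seq nat) (_ : tree) => (s.1.+1, s.1 :: s.2)) (m, s) r)
     <= csize s + (size r) * (2 * (m + size r) + 2) + 2 * (m + size r) + 4.
    elim: r m s {hr} => [|x r IH] m s /=; first by rewrite csize_pair csize_nat; lia.
    by apply: leq_trans (IH _ _) _; rewrite csize_cons csize_nat; nia.
  apply: leq_trans (H _ _) _; have -> : csize ([::] : seq nat) = 1 by []; nia.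
Qed.

End MoreArithmetic.

Lemma ptime_drop Z A {cZ : codable Z} {cA : codable A} (f : Z -> nat) (l : Z -> seq A) :
  ptime f -> ptime l -> ptime (fun z => drop (f z) (l z)).
Proof.
move=> pf pl; apply: (ptime_ext (f := fun z => iter (f z) behead (l z))).
  by move=> z; elim: (f z) => [|m /= ->]; rewrite ?drop0 // -drop1 drop_drop.
apply: (ptime_iter (step := fun _ => behead)) => //; first exact/ptime_behead/ptime_snd/ptime_id.
exists (fun=> 2); first by poly.
by move=> z [|x s] //=; rewrite ?csize_cons; lia.
Qed.

Lemma ptime_nth Z A {cZ : codable Z} {cA : codable A} (x0 : A) (f : Z -> nat) (l : Z -> seq A) :
  code x0 = Leaf -> ptime f -> ptime l -> ptime (fun z => nth x0 (l z) (f z)).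
Proof.
move=> h0 pf pl; apply: (ptime_ext (f := fun z => head x0 (drop (f z) (l z)))).
  by move=> z; rewrite -nth0 nth_drop addn0.
by apply: ptime_head => //; apply: ptime_drop.
Qed.

Lemma ptime_mem Z {cZ : codable Z} (f : Z -> nat) (l : Z -> seq nat) :
  ptime f -> ptime l -> ptime (fun z => f z \in l z).
Proof.
move=> pf pl; apply: (ptime_ext (f := fun z => ~~ nilp (filter (fun y => f z == y) (l z)))).
  move=> z; rewrite -has_pred1 has_count -size_filter lt0n; congr (~~ (size _ == 0)).
  by apply: eq_filter => y; rewrite /= eq_sym.
apply/ptime_negb/ptime_nilp/(ptime_filter (P := fun z y => f z == y)) => //.
apply: ptime_eqn; last exact/ptime_snd/ptime_id.
by apply: (ptime_comp (g := f)) pf; apply/ptime_fst/ptime_id.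
Qed.

Lemma ptime_take Z A {cZ : codable Z} {cA : codable A} (f : Z -> nat) (l : Z -> seq A) :
  ptime f -> ptime l -> ptime (fun z => take (f z) (l z)).
Proof.
move=> pf pl; apply: (ptime_ext (f := fun z => rev (drop (size (l z) - f z) (rev (l z))))).
  move=> z; rewrite drop_rev revK; case: (leqP (f z) (size (l z))) => h; first by rewrite subKn.
  by rewrite (eqP (ltnW h)) subn0 take_size take_oversize // ltnW.
apply/ptime_rev/ptime_drop; last exact: ptime_rev.
by apply: ptime_subn => //; apply: ptime_size_seq.
Qed.

(** Recursion on the body of the function, directed by its outermost operation; conditionals have no
    head constant to match and come last. *)
Ltac ptime_step := cbv beta; first [assumption | lazymatch goal with
  | |- ptime (fun _ => ?c) => exact: ptime_const
  | |- ptime (fun z => z) => exact: ptime_id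
  | |- ptime fst => apply: (ptime_fst (f := fun z => z))
  | |- ptime snd => apply: (ptime_snd (f := fun z => z))
  | |- ptime (fun z => (@?f z, @?g z)) => apply: (ptime_pair (f := f) (g := g))
  | |- ptime (fun z => fst (@?f z)) => apply: (ptime_fst (f := f))
  | |- ptime (fun z => snd (@?f z)) => apply: (ptime_snd (f := f))
  | |- ptime (fun z => negb (@?f z)) => apply: (ptime_negb (f := f))
  | |- ptime (fun z => andb (@?f z) (@?g z)) => apply: (ptime_andb (f := f) (g := g))
  | |- ptime (fun z => orb (@?f z) (@?g z)) => apply: (ptime_orb (f := f) (g := g))
  | |- ptime (fun z => cons (@?f z) (@?g z)) => apply: (ptime_cons (f := f) (g := g))
  | |- ptime (fun z => cat (@?f z) (@?g z)) => apply: (ptime_cat (f := f) (g := g))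
  | |- ptime (fun z => nilp (@?f z)) => apply: (ptime_nilp (f := f))
  | |- ptime (fun z => size (@?f z)) => apply: (ptime_size_seq (l := f))
  | |- ptime (fun z => flatten (@?f z)) => apply: (ptime_flatten (l := f))
  | |- ptime (fun z => take (@?f z) (@?g z)) => apply: (ptime_take (f := f) (l := g))
  | |- ptime (fun z => nth _ (@?g z) (@?f z)) =>
      apply: (ptime_nth (f := f) (l := g)); [by []| |]
  | |- ptime (fun z => iota 0 (@?f z)) => apply: (ptime_iota (f := f))
  | |- ptime (fun z => S (@?f z)) => apply: (ptime_succn (f := f))
  | |- ptime (fun z => predn (@?f z)) => apply: (ptime_predn (f := f))
  | |- ptime (fun z => addn (@?f z) (@?g z)) => apply: (ptime_addn (f := f) (g := g))
  | |- ptime (fun z => muln (@?f z) (@?g z)) => apply: (ptime_muln (f := f) (g := g))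
  | |- ptime (fun z => minn (@?f z) (@?g z)) => apply: (ptime_minn (f := f) (g := g))
  | |- ptime (fun z => maxn (@?f z) (@?g z)) => apply: (ptime_maxn (f := f) (g := g))
  | |- ptime (fun z => leq (@?f z) (@?g z)) => apply: (ptime_leq (f := f) (g := g))
  | |- ptime (fun z => in_mem (@?f z) (mem (@?g z))) => apply: (ptime_mem (f := f) (l := g))
  | |- ptime (fun z => eq_op (@?f z) (@?g z)) => apply: (ptime_eqn (f := f) (g := g))
  | |- ptime (fun z => filter (fun x => @?P z x) (@?g z)) =>
      apply: (ptime_filter (l := g) (P := P))
  | |- ptime (fun z => map (fun x => @?P z x) (@?g z)) =>
      apply: (ptime_map (l := g) (F := P))
  end | apply: ptime_if ].

(** * The algorithm *)

(* The algorithm works on the adjacency matrix, with vertices [0, ..., n - 1]. *)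
Definition bmatrix := seq (seq bool).
Definition adjm (M : bmatrix) u v := nth false (nth [::] M u) v.
Definition catd (T : eqType) (l1 l2 : seq T) := l1 ++ [seq x <- l2 | x \notin l1].
Definition nbrs (M : bmatrix) u : seq nat :=
  [seq v <- iota 0 (size M) | (v == u) || adjm M u v].
Definition fresh (M : bmatrix) (cov : seq nat) v : seq nat := [seq u <- nbrs M v | u \notin cov].
Definition select (M : bmatrix) tau v (s : seq nat * seq nat) :=
  if tau <= size (fresh M s.1 v)
  then (s.1 ++ fresh M s.1 v, s.2 ++ [:: size (fresh M s.1 v)])
  else (s.1, s.2 ++ [:: 0]).
Definition profits (M : bmatrix) tau : seq nat :=
  (foldl (fun s v => select M tau v s) ([::], [::]) (iota 0 (size M))).2.
Definition coverage (M : bmatrix) (l : seq nat) :=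
  size [seq u <- iota 0 (size M) | ~~ nilp [seq v <- l | (u == v) || adjm M v u]].
Definition better (M : bmatrix) (c b : seq nat) := if coverage M b < coverage M c then c else b.

(* Moat-growing state: per vertex, the width of the moats around it, the time
   until which its cluster has been active and the unspent potential of its
   cluster; and for every pair [x, z] of vertices a list that starts at [x],
   enumerates the pruned tree of the cluster that keeps [x] and [z], and is empty
   if [x] and [z] are in different clusters. *)
Definition mstate := (seq nat * seq nat * seq nat * seq (seq (seq nat)))%type.
Definition dist (s : mstate) v := nth 0 s.1.1.1 v.
Definition time (s : mstate) v := nth 0 s.1.1.2 v.
Definition slack (s : mstate) v := nth 0 s.1.2 v.
Definition route (s : mstate) x z : seq nat := nth [::] (nth [::] s.2 x) z.
(* [join a b] updates the list of [x, z] for [x] in the cluster of [a] when the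
   clusters of [a] and [b] merge; if the one of [b] died earlier, it is pruned
   unless [z] lies in it. *)
Section Routes.
Variables (I : Type) (T : eqType) (t : I -> nat) (r : I -> I -> seq T).
Definition joined a x := ~~ nilp (r a x).
Definition join a b x z :=
  if joined a z then
    if t b < t a then r x z else catd (catd (r x a) (r b b)) (r x z)
  else if joined b z then catd (r x a) (r b z) else r x z.
Definition mroute a b x z :=
  if joined a x then join a b x z
  else if joined b x then join b a x z else r x z.
End Routes.

(** The cap keeps the potentials polynomial on matrices that encode no graph, where no invariant
    bounds their sums. On graphs the minimum is always the sum (see [merge_apart]). *)
Definition merge n cap s a b : mstate :=
  (s.1.1.1,
   mkseq (fun v => if joined (route s) a v || joined (route s) b v
                   then maxn (time s a) (time s b) else time s v) n,
   mkseq (fun v => if joined (route s) a v || joined (route s) b v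
                   then minn (slack s a + slack s b) cap else slack s v) n,
   mkseq (fun x => mkseq (fun z => mroute (time s) (route s) a b x z) n) n).
Definition grow n s : mstate :=
  (mkseq (fun v => if 0 < slack s v then (dist s v).+1 else dist s v) n,
   mkseq (fun v => if 0 < slack s v then (time s v).+1 else time s v) n,
   mkseq (fun v => (slack s v).-1) n, s.2).
Definition tight M ell s u v :=
  [&& adjm M u v, nilp (route s u v) & ell <= dist s u + dist s v].
(* Instruction [(true, (u, v))] tests the edge [uv], [(false, _)] lets the active
   clusters grow by one unit. *)
Definition act M ell cap s (i : bool * (nat * nat)) :=
  if i.1 then
    if tight M ell s i.2.1 i.2.2 then merge (size M) cap s i.2.1 i.2.2 else s
  else grow (size M) s.
(** The analysis yields a good cluster at an unknown moment and for an unknown root, so every root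
    is tried after every instruction. *)
Definition update_best (M : bmatrix) k s b :=
  foldl (fun b x => better M (take k (route s x x)) b) b (iota 0 (size M)).
Definition gstep (M : bmatrix) k ell cap i (sb : mstate * seq nat) :=
  (act M ell cap sb.1 i, update_best M k (act M ell cap sb.1 i) sb.2).
Definition init n mu (p : seq nat) : mstate :=
  (mkseq (fun _ => 0) n, mkseq (fun _ => 0) n, mkseq (fun v => mu * nth 0 p v) n,
   mkseq (fun x => mkseq (fun z => if x == z then [:: x] else [::]) n) n).
Definition round n : seq (bool * (nat * nat)) :=
  flatten [seq [seq (true, (u, v)) | v <- iota 0 n] | u <- iota 0 n]
  ++ [:: (false, (0, 0))].
Definition schedule n R := flatten [seq round n | _ <- iota 0 R].
(* [9 (k n)] bounds the total potential, and a cluster of age [2 * 9 (k n)] has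
   spent all of it, whence the number of rounds. *)
Definition trial (M : bmatrix) k o tau b :=
  (foldl (fun sb i => gstep M k o (9 * (k * size M)) i sb)
     (init (size M) (9 * k.-1) (profits M tau), b)
     (schedule (size M) (18 * (k * size M)).+1)).2.
Definition grid n : seq (nat * nat) :=
  flatten [seq [seq (u, v) | v <- iota 0 n] | u <- iota 0 n].
Definition best_single (M : bmatrix) :=
  foldl (fun b x => better M [:: x] b) [:: 0] (iota 0 (size M)).
(** The shifts make both guesses range over 1, ..., n. The best single vertex settles small budgets
    and accounts for the state before the first instruction. *)
Definition solve (M : bmatrix) k :=
  foldl (fun b ot => trial M k ot.1.+1 ot.2.+1 b) (best_single M) (grid (size M)).
(* The minimum of [n] and the number with binary digits [bits], least significant first. *)
Definition capped n (bits : seq bool) :=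
  (foldl (fun wa (b : bool) => (minn n (wa.1 + wa.1), if b then minn n (wa.2 + wa.1) else wa.2))
     (minn n 1, 0) bits).2.
Definition bcds_solver (I : bmatrix * seq bool) : seq bool :=
  [seq v \in solve I.1 (capped (size I.1) I.2) | v <- iota 0 (size I.1)].

(** * Polynomial running time of the solver *)

Lemma ptime_adjm : ptime (fun q : bmatrix * nat * nat => adjm q.1.1 q.1.2 q.2).
Proof. by rewrite /adjm; repeat ptime_step. Qed.

Lemma ptime_catd : ptime (fun q : seq nat * seq nat => catd q.1 q.2).
Proof. by rewrite /catd; repeat ptime_step. Qed.

Ltac ptime1 := first [ptime_step | cbv beta; lazymatch goal with
  | |- ptime (fun z => adjm (@?f z) (@?g z) (@?h z)) =>
      apply: (ptime_comp3 (f := f) (g := g) (h := h) ptime_adjm)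
  | |- ptime (fun z => @catd _ (@?f z) (@?g z)) =>
      apply: (ptime_comp2 (f := f) (g := g) ptime_catd)
  end].

Lemma ptime_nbrs : ptime (fun q : bmatrix * nat => nbrs q.1 q.2).
Proof. by rewrite /nbrs; repeat ptime1. Qed.

Lemma ptime_fresh : ptime (fun q : bmatrix * seq nat * nat => fresh q.1.1 q.1.2 q.2).
Proof.
rewrite /fresh; ptime1; last by repeat ptime1.
by apply: (ptime_comp2 (F := nbrs) ptime_nbrs); repeat ptime1.
Qed.

Lemma csize_cat A {cA : codable A} (s1 s2 : seq A) :
  csize (s1 ++ s2) + 1 = csize s1 + csize s2.
Proof. by elim: s1 => [|x s IH] /=; rewrite ?csize_cons; [rewrite addnC|lia]. Qed.

Lemma ptime_profits : ptime (fun q : bmatrix * nat => profits q.1 q.2).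
Proof.
rewrite /profits; apply: ptime_snd.
have pf : ptime (fun q : bmatrix * nat * nat * (seq nat * seq nat) =>
    fresh q.1.1.1 q.2.1 q.1.2).
  by apply: (ptime_comp3 (F := fresh) ptime_fresh); repeat ptime1.
apply: (ptime_foldl_add (l := fun q : bmatrix * nat => iota 0 (size q.1))
  (i := fun=> ([::], [::])) (step := fun q v s => select q.1 q.2 v s)).
- by repeat ptime1.
- by repeat ptime1.
- by rewrite /select; repeat ptime1.
have [b pb Hb] := ptime_size ptime_fresh.
exists (fun x => 3 * b (x + 3) + 10); first by poly.
move=> [M tau] v [s1 s2]; rewrite /select /=.
have hf : csize (fresh M s1 v) <= csize (nbrs M v).
  rewrite /fresh; elim: (nbrs M v) => //= x r IH; case: ifP => _; rewrite !csize_cons; lia.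
have hn : csize (nbrs M v) <= b (csize (M, tau) + csize v + 3).
  (* The bound for [fresh] also depends on the covered set, which grows during the scan; with the
     empty set this dependence disappears. *)
  have -> : nbrs M v = fresh M [::] v by rewrite /fresh; apply/esym/all_filterP/allP.
  apply: leq_trans (Hb (M, [::], v)) _; apply: (proj1 pb).
  by rewrite !csize_pair /=; have -> : csize ([::] : seq nat) = 1 by []; lia.
have hs : size (fresh M s1 v) < csize (fresh M s1 v) by apply: size_csize.
have hc (r : seq nat) (m : nat) : csize (r ++ [:: m]) + 1 = csize r + (2 * m + 3).
  by rewrite csize_cat csize_cons csize_nat; have -> : csize ([::] : seq nat) = 1 by []; lia.
have hcc : csize (s1 ++ fresh M s1 v) + 1 = csize s1 + csize (fresh M s1 v) by apply: csize_cat.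
move: (b _) hn => B hn.
case: ifP => _; rewrite !csize_pair.
  by have := hc s2 (size (fresh M s1 v)); lia.
by have := hc s2 0; lia.
Qed.

Lemma ptime_cover : ptime (fun q : bmatrix * seq nat => coverage q.1 q.2).
Proof. by rewrite /coverage; repeat ptime1. Qed.

Lemma ptime_better : ptime (fun q : bmatrix * seq nat * seq nat => better q.1.1 q.1.2 q.2).
Proof.
have h1 : ptime (fun q : bmatrix * seq nat * seq nat => coverage q.1.1 q.1.2).
  by apply: (ptime_comp2 (F := coverage) ptime_cover); repeat ptime1.
have h2 : ptime (fun q : bmatrix * seq nat * seq nat => coverage q.1.1 q.2).
  by apply: (ptime_comp2 (F := coverage) ptime_cover); repeat ptime1.
by rewrite /better; repeat ptime1.
Qed.

Lemma ptime_dist : ptime (fun q : mstate * nat => dist q.1 q.2).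
Proof. by rewrite /dist; repeat ptime1. Qed.
Lemma ptime_time : ptime (fun q : mstate * nat => time q.1 q.2).
Proof. by rewrite /time; repeat ptime1. Qed.
Lemma ptime_slack : ptime (fun q : mstate * nat => slack q.1 q.2).
Proof. by rewrite /slack; repeat ptime1. Qed.
Lemma ptime_route : ptime (fun q : mstate * nat * nat => route q.1.1 q.1.2 q.2).
Proof. by rewrite /route; repeat ptime1. Qed.

Ltac ptime2 := first [ptime1 | cbv beta; lazymatch goal with
  | |- ptime (fun z => dist (@?f z) (@?g z)) => apply: (ptime_comp2 (f := f) (g := g) ptime_dist)
  | |- ptime (fun z => time (@?f z) (@?g z)) => apply: (ptime_comp2 (f := f) (g := g) ptime_time)
  | |- ptime (fun z => slack (@?f z) (@?g z)) => apply: (ptime_comp2 (f := f) (g := g) ptime_slack)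
  | |- ptime (fun z => route (@?f z) (@?g z) (@?h z)) =>
      apply: (ptime_comp3 (f := f) (g := g) (h := h) ptime_route)
  end].

Lemma ptime_join : ptime (fun q : mstate * nat * nat * (nat * nat) =>
  join (time q.1.1.1) (route q.1.1.1) q.1.1.2 q.1.2 q.2.1 q.2.2).
Proof. by rewrite /join /joined; repeat ptime2. Qed.

Lemma ptime_mroute : ptime (fun q : mstate * nat * nat * (nat * nat) =>
  mroute (time q.1.1.1) (route q.1.1.1) q.1.1.2 q.1.2 q.2.1 q.2.2).
Proof.
rewrite /mroute /joined.
have h : ptime (fun q : mstate * nat * nat * (nat * nat) =>
    join (time q.1.1.1) (route q.1.1.1) q.1.2 q.1.1.2 q.2.1 q.2.2).
  by apply: (ptime_comp (f := fun q : mstate * nat * nat * (nat * nat) =>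
    (q.1.1.1, q.1.2, q.1.1.2, q.2)) _ ptime_join); repeat ptime2.
have h' := ptime_join.
by repeat ptime2.
Qed.

Lemma ptime_merge : ptime (fun q : nat * nat * mstate * (nat * nat) =>
  merge q.1.1.1 q.1.1.2 q.1.2 q.2.1 q.2.2).
Proof.
rewrite /merge /joined /mkseq; ptime2; last first.
  do 2 (ptime2; first by repeat ptime2).
  cbv beta; apply: (ptime_comp (f := fun q : nat * nat * mstate * (nat * nat) * nat * nat =>
    (q.1.1.1.2, q.1.1.2.1, q.1.1.2.2, (q.1.2, q.2))) _ ptime_mroute); repeat ptime2.
by repeat ptime2.
Qed.

Lemma ptime_grow : ptime (fun q : nat * mstate => grow q.1 q.2).
Proof. by rewrite /grow /mkseq; repeat ptime2. Qed.

Lemma ptime_act : ptime (fun q : bmatrix * nat * nat * mstate * (bool * (nat * nat)) =>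
  act q.1.1.1.1 q.1.1.1.2 q.1.1.2 q.1.2 q.2).
Proof.
rewrite /act /tight.
have h1 : ptime (fun q : bmatrix * nat * nat * mstate * (bool * (nat * nat)) =>
    grow (size q.1.1.1.1) q.1.2).
  by apply: (ptime_comp2 (F := grow) ptime_grow); repeat ptime2.
have h2 : ptime (fun q : bmatrix * nat * nat * mstate * (bool * (nat * nat)) =>
    merge (size q.1.1.1.1) q.1.1.2 q.1.2 q.2.2.1 q.2.2.2).
  by apply: (ptime_comp (f := fun q : bmatrix * nat * nat * mstate * (bool * (nat * nat)) =>
    (size q.1.1.1.1, q.1.1.2, q.1.2, q.2.2)) _ ptime_merge); repeat ptime2.
by repeat ptime2.
Qed.

Lemma csize_nth A {cA : codable A} (x0 : A) (l : seq A) i :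
  code x0 = Leaf -> csize (nth x0 l i) <= csize l.
Proof.
move=> h0; have h1 : csize x0 = 1 by rewrite /csize h0.
elim: l i => [|x l IH] [|i] //=; rewrite ?h1 ?csize_cons ?csize_gt0 //; first lia.
by have := IH i; lia.
Qed.

Lemma ptime_update_best : ptime (fun q : bmatrix * nat * mstate * seq nat =>
  update_best q.1.1.1 q.1.1.2 q.1.2 q.2).
Proof.
rewrite /update_best.
apply: (ptime_foldl_inv (l := fun q : bmatrix * nat * mstate * seq nat => iota 0 (size q.1.1.1))
  (i := fun q => q.2)
  (step := fun q x b => better q.1.1.1 (take q.1.1.2 (route q.1.2 x x)) b)
  (I := fun q _ b => csize b <= csize q)).
- by repeat ptime2.
- by repeat ptime2.
- by apply: (ptime_comp3 (F := better) ptime_better); repeat ptime2.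
- by move=> q; case: q => q b /=; rewrite csize_pair; lia.
- move=> q j x b hb; rewrite /better; case: ifP => // _.
  apply: leq_trans (csize_take _ _) _; rewrite /route.
  apply: leq_trans (csize_nth _ _ _) _ => //; apply: leq_trans (csize_nth _ _ _) _ => //.
  by case: q hb => [[[M k] [[[d T] L] K]] b0] _; rewrite !csize_pair /=; lia.
- by exists id => //; poly.
Qed.

Lemma ptime_gstep : ptime (fun q : bmatrix * nat * nat * nat * (bool * (nat * nat)) * (mstate * seq nat) =>
  gstep q.1.1.1.1.1 q.1.1.1.1.2 q.1.1.1.2 q.1.1.2 q.1.2 q.2).
Proof.
have h : ptime (fun q : bmatrix * nat * nat * nat * (bool * (nat * nat)) * (mstate * seq nat) =>
    act q.1.1.1.1.1 q.1.1.1.2 q.1.1.2 q.2.1 q.1.2).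
  by apply: (ptime_comp (f := fun q : bmatrix * nat * nat * nat * (bool * (nat * nat)) * (mstate * seq nat) =>
    (q.1.1.1.1.1, q.1.1.1.2, q.1.1.2, q.2.1, q.1.2)) _ ptime_act); repeat ptime2.
rewrite /gstep; ptime2; first by [].
by apply: (ptime_comp4 (F := update_best) ptime_update_best); repeat ptime2.
Qed.

Lemma ptime_init : ptime (fun q : nat * nat * seq nat => init q.1.1 q.1.2 q.2).
Proof. by rewrite /init /mkseq; repeat ptime2. Qed.

Lemma ptime_schedule : ptime (fun q : nat * nat => schedule q.1 q.2).
Proof. by rewrite /schedule /round; repeat ptime2. Qed.

Definition wf_list n (l : seq nat) := uniq l && all (fun x => x < n) l.

Lemma csize_wf_list n l : wf_list n l -> csize l <= n * (2 * n + 2) + 1.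
Proof.
case/andP=> ul al; have sl : size l <= n.
  rewrite -(size_iota 0 n); apply: uniq_leq_size => // x /(allP al).
  by rewrite mem_iota.
apply: leq_trans (@csize_seq_le _ _ (2 * n) _ _) _.
  by apply/allP => x /(allP al); rewrite csize_nat; lia.
by nia.
Qed.

Lemma wf_list_catd n l1 l2 : wf_list n l1 -> wf_list n l2 -> wf_list n (catd l1 l2).
Proof.
move=> /andP[u1 a1] /andP[u2 a2]; apply/andP; split.
  rewrite cat_uniq u1 filter_uniq // andbT /=; apply/hasPn => x.
  by rewrite mem_filter => /andP[].
rewrite all_cat a1; apply/allP => x; rewrite mem_filter => /andP[_]; exact: (allP a2).
Qed.

Lemma wf_list_take n k l : wf_list n l -> wf_list n (take k l).
Proof.
move=> /andP[u a]; rewrite /wf_list take_uniq //; apply/allP => x /mem_take.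
exact: (allP a).
Qed.

Lemma all_nth_default T (P : pred T) x0 s i : P x0 -> all P s -> P (nth x0 s i).
Proof.
move=> h0 hs; case: (ltnP i (size s)) => h; first exact: (all_nthP x0 hs).
by rewrite nth_default.
Qed.

Lemma all_mkseq T (P : pred T) (f : nat -> T) n :
  (forall i, i < n -> P (f i)) -> all P (mkseq f n).
Proof. by move=> h; rewrite all_map; apply/allP => i; rewrite mem_iota => /h. Qed.

(* Size control only: it holds for every matrix, symmetric or not. *)
Definition wf_state n j m (s : mstate) :=
  [/\ size s.1.1.1 <= n /\ all (fun x => x <= j) s.1.1.1,
      size s.1.1.2 <= n /\ all (fun x => x <= j) s.1.1.2,
      size s.1.2 <= n /\ all (fun x => x <= m) s.1.2 &
      size s.2 <= n /\ all (fun r => (size r <= n) && all (wf_list n) r) s.2].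

Lemma wf_route n j m s x z : wf_state n j m s -> wf_list n (route s x z).
Proof.
case=> _ _ _ [_ h]; apply: all_nth_default => //.
have := @all_nth_default _ _ [::] _ x _ h.
by case/(_ isT)/andP.
Qed.

Lemma wf_act M ell cap n j m s i : n = size M -> cap <= m ->
  wf_state n j m s -> wf_state n j.+1 m (act M ell cap s i).
Proof.
move=> -> cm ws; have [[d1 d2] [t1 t2] [l1 l2] [k1 k2]] := ws.
have le1 r : all (leq^~ j) r -> all (leq^~ j.+1) r.
  by move=> h; apply/allP => x /(allP h); lia.
have hT v : time s v <= j by apply: (@all_nth_default _ (leq^~ j)).
have hd v : dist s v <= j by apply: (@all_nth_default _ (leq^~ j)).
have hL v : slack s v <= m by apply: (@all_nth_default _ (leq^~ m)).
have hR x z := wf_route x z ws.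
rewrite /act; case: ifP => _.
  case: ifP => _; last by split; split=> //; apply: le1.
  split; split=> /=; rewrite ?size_mkseq //; [exact: le1| | |].
  - by apply: all_mkseq => v _; case: ifP => _; rewrite ?geq_max ?(leqW (hT _)).
  - by apply: all_mkseq => v _; case: ifP => _ //; rewrite geq_min cm orbT.
  - apply: all_mkseq => x _; rewrite size_mkseq leqnn; apply: all_mkseq => z _.
    rewrite /mroute /join.
    by repeat (case: ifP => _); do ?apply: wf_list_catd.
split; split=> //=; rewrite ?size_mkseq //.
- by apply: all_mkseq => v _; case: ifP => _; rewrite ?ltnS // (leqW (hd v)).
- by apply: all_mkseq => v _; case: ifP => _; rewrite ?ltnS // (leqW (hT v)).
- by apply: all_mkseq => v _; rewrite (leq_trans (leq_pred _)).
Qed.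

Lemma update_best_ind M k s b (P : seq nat -> Prop) :
  P b -> (forall x, P (take k (route s x x))) -> P (update_best M k s b).
Proof.
move=> Pb Pr; rewrite /update_best.
by elim: (iota 0 _) b Pb => //= x r IH b Pb; apply: IH; rewrite /better; case: ifP.
Qed.

(** Because numbers are unary, the code size of the initial state already bounds its entries, and
    [ptime_init] makes that size polynomial. *)
Lemma wf_init M mu tau : exists m, wf_state (size M) 0 m (init (size M) mu (profits M tau)) /\
  m <= csize (init (size M) mu (profits M tau)).
Proof.
set s := init _ _ _; exists (csize s); split=> //.
split; split=> /=; rewrite ?size_mkseq //; try by apply: all_mkseq.
- apply/allP => x hx; have : csize x < csize s.1.2 by apply: csize_mem.
  rewrite csize_nat; case: s {hx} => [[[d T] L] K] /=; rewrite !csize_pair; lia.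
- apply: all_mkseq => x hx; rewrite size_mkseq leqnn; apply: all_mkseq => z _.
  by case: ifP => _ //=; rewrite /wf_list /= hx.
Qed.

Lemma csize_wf_state n j m s : wf_state n j m s ->
  csize s <= n * (2 * j + 2) * 2 + n * (2 * m + 2) + n * (n * (n * (2 * n + 2) + 2) + 2) + 10.
Proof.
case: s => [[[d T] L] K] [/= [d1 d2] [t1 t2] [l1 l2] [k1 k2]].
have vec c (v : seq nat) : size v <= n -> all (leq^~ c) v -> csize v <= n * (2 * c + 2) + 1.
  move=> sv av; apply: leq_trans (@csize_seq_le _ _ (2 * c).+1 _ _) _.
    by apply/allP => x /(allP av); rewrite csize_nat; lia.
  by rewrite leq_add2r leq_mul //; lia.
have hK : csize K <= n * (n * (n * (2 * n + 2) + 2) + 2) + 1.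
  apply: leq_trans (@csize_seq_le _ _ (n * (n * (2 * n + 2) + 2) + 1) _ _) _.
    apply/allP => r /(allP k2) /andP[sr ar].
    apply: leq_trans (@csize_seq_le _ _ (n * (2 * n + 2) + 1) _ _) _.
      by apply/allP => l /(allP ar); apply: csize_wf_list.
    by rewrite leq_add2r leq_mul //; lia.
  by rewrite leq_add2r leq_mul //; lia.
have hd := vec _ _ d1 d2; have hT := vec _ _ t1 t2; have hL := vec _ _ l1 l2.
rewrite !csize_pair /=; lia.
Qed.

Lemma trial_ind M k o tau b (P : seq nat -> Prop) :
  P b -> (forall l, wf_list (size M) l -> P l) -> P (trial M k o tau b).
Proof.
move=> Pb Pw; rewrite /trial; have [m [w0 _]] := wf_init M (9 * k.-1) tau.
pose m' := m + 9 * (k * size M).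
have : wf_state (size M) 0 m' (init (size M) (9 * k.-1) (profits M tau)).
  case: w0 => ? ? [? h] ?; split=> //; split=> //.
  by apply/allP => x /(allP h); rewrite /m'; lia.
have gen r s j c : P c -> wf_state (size M) j m' s ->
    P (foldl (fun sb i => gstep M k o (9 * (k * size M)) i sb) (s, c) r).2; last exact: gen.
elim: r s j c => //= i r IH s j c Pc ws.
have wa := wf_act o i erefl (leq_addl m (9 * (k * size M))) ws.
apply: (IH _ j.+1) => //; apply: update_best_ind => // x; apply: Pw.
by apply: wf_list_take; apply: (wf_route _ _ wa).
Qed.

Lemma ptime_trial : ptime (fun q : bmatrix * nat * nat * nat * seq nat =>
  trial q.1.1.1.1 q.1.1.1.2 q.1.1.2 q.1.2 q.2).
Proof.
pose E := (bmatrix * nat * nat * nat * seq nat)%type.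
rewrite /trial; apply: ptime_snd.
have pi : ptime (fun q : E => init (size q.1.1.1.1) (9 * q.1.1.1.2.-1) (profits q.1.1.1.1 q.1.2)).
  have pp : ptime (fun q : E => profits q.1.1.1.1 q.1.2).
    by apply: (ptime_comp2 (F := profits) ptime_profits); repeat ptime2.
  by apply: (ptime_comp3 (F := init) ptime_init); repeat ptime2.
have ps : ptime (fun q : E => schedule (size q.1.1.1.1) (18 * (q.1.1.1.2 * size q.1.1.1.1)).+1).
  by apply: (ptime_comp2 (F := schedule) ptime_schedule); repeat ptime2.
have [bi pbi Hbi] := ptime_size pi; have [bs pbs Hbs] := ptime_size ps.
(* The step counter bounds widths and ages; potentials stay below the size of the initial state plus
   the cap. The current best list is either the given one or a duplicate-free list of vertices. *)
apply: (ptime_foldl_inv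
  (l := fun q : E => schedule (size q.1.1.1.1) (18 * (q.1.1.1.2 * size q.1.1.1.1)).+1)
  (i := fun q : E => (init (size q.1.1.1.1) (9 * q.1.1.1.2.-1) (profits q.1.1.1.1 q.1.2), q.2))
  (step := fun (q : E) i sb =>
     gstep q.1.1.1.1 q.1.1.1.2 q.1.1.2 (9 * (q.1.1.1.2 * size q.1.1.1.1)) i sb)
  (I := fun (q : E) j sb =>
     wf_state (size q.1.1.1.1) j (bi (csize q) + 9 * (q.1.1.1.2 * size q.1.1.1.1)) sb.1 /\
     (sb.2 = q.2 \/ wf_list (size q.1.1.1.1) sb.2))).
- by [].
- by repeat ptime2.
- apply: (ptime_comp (f := fun q : E * (bool * (nat * nat)) * (mstate * seq nat) =>
    (q.1.1.1.1.1.1, q.1.1.1.1.1.2, q.1.1.1.1.2, 9 * (q.1.1.1.1.1.2 * size q.1.1.1.1.1.1), q.1.2, q.2))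
    _ ptime_gstep).
  by repeat ptime2.
- move=> q; split; last by left.
  have [m [w hm]] := wf_init q.1.1.1.1 (9 * q.1.1.1.2.-1) q.1.2.
  have hq := Hbi q; case: w => ? ? [? h] ?; split=> //; split=> //.
  by apply/allP => x /(allP h) /= hx; apply: leq_trans hx _; lia.
- move=> q j i [s b] [ws hb] /=.
  have wa := wf_act q.1.1.2 i erefl
    (leq_addl (bi (csize q)) (9 * (q.1.1.1.2 * size q.1.1.1.1))) ws.
  split=> //.
  apply: (@update_best_ind _ _ _ _ (fun c => c = q.2 \/ wf_list (size q.1.1.1.1) c)) => // x; right.
  by apply: wf_list_take; apply: (wf_route _ _ wa).
exists (fun x => (x * (2 * bs x + 2) * 2 + x * (2 * (bi x + 9 * (x * x)) + 2)
   + x * (x * (x * (2 * x + 2) + 2) + 2) + 10) + x + x * (2 * x + 2) + 10); first by poly.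
move=> q j [s b] hj [/csize_wf_state hs hb]; rewrite csize_pair.
have hn : size q.1.1.1.1 <= csize q.
  case: q {hj hs hb} => [[[[M k] o] tau] b0]; have h : size M < csize M by apply: size_csize.
  by rewrite !csize_pair /=; lia.
have hk : q.1.1.1.2 <= csize q.
  by case: q {hj hs hb hn} => [[[[M k] o] tau] b0]; rewrite !csize_pair !csize_nat /=; lia.
have hjs : j <= bs (csize q).
  apply: leq_trans hj _; apply: leq_trans (Hbs q); apply: ltnW; exact: size_csize.
have hb2 : csize b <= csize q + (csize q * (2 * csize q + 2) + 1).
  case: hb => [/= ->|/csize_wf_list h].
    by case: q {hj hs hn hk hjs} => [q b1]; rewrite csize_pair /=; lia.
  by apply: leq_trans h _; nia.
move: (size _) (q.1.1.1.2) hn hk hs => n k hn hk hs.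
rewrite /= in hs.
apply: (@leq_trans ((csize q * (2 * bs (csize q) + 2) * 2 + csize q * (2 * (bi (csize q) + 9 * (csize q * csize q)) + 2)
   + csize q * (csize q * (csize q * (2 * csize q + 2) + 2) + 2) + 10) + csize b).+1); last lia.
rewrite ltnS leq_add2r (leq_trans hs) //.
by rewrite leq_add2r; do ?[apply: leq_add | apply: leq_mul | rewrite leq_mul2r]; lia.
Qed.

Lemma ptime_solve : ptime (fun q : bmatrix * nat => solve q.1 q.2).
Proof.
have pg : ptime (fun q : bmatrix * nat => grid (size q.1)) by rewrite /grid; repeat ptime2.
have ps : ptime (fun q : bmatrix * nat => best_single q.1).
  rewrite /best_single.
  apply: (ptime_foldl_add (l := fun q : bmatrix * nat => iota 0 (size q.1)) (i := fun=> [:: 0])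
    (step := fun q x b => better q.1 [:: x] b)).
  - by repeat ptime2.
  - by repeat ptime2.
  - by apply: (ptime_comp3 (F := better) ptime_better); repeat ptime2.
  - exists (fun x => x + 3); first by poly.
    by move=> q x b; rewrite /better; case: ifP => _; rewrite ?csize_cons; [have : csize ([::] : seq nat) = 1 by []|]; lia.
have [b pb Hb] := ptime_size ps.
rewrite /solve.
apply: (ptime_foldl_inv (l := fun q : bmatrix * nat => grid (size q.1))
  (i := fun q => best_single q.1)
  (step := fun q ot b => trial q.1 q.2 ot.1.+1 ot.2.+1 b)
  (I := fun q _ c => c = best_single q.1 \/ wf_list (size q.1) c)).
- by [].
- by [].
- apply: (ptime_comp (f := fun q : bmatrix * nat * (nat * nat) * seq nat =>
    (q.1.1.1, q.1.1.2, q.1.2.1.+1, q.1.2.2.+1, q.2)) _ ptime_trial).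
  by repeat ptime2.
- by left.
- move=> q j ot c hc; apply: (@trial_ind _ _ _ _ _ (fun c => c = best_single q.1 \/ wf_list (size q.1) c)) => //.
  by right.
exists (fun x => b x + (x * (2 * x + 2) + 1)); first by poly.
move=> q j c _ [->|/csize_wf_list h]; first by apply: leq_trans (Hb q) _; rewrite leq_addr.
have hn : size q.1 <= csize q.
  by case: q {h} => M k; have h : size M < csize M by [apply: size_csize]; rewrite csize_pair /=; lia.
by apply: leq_trans h _; nia.
Qed.

Lemma ptime_capped : ptime (fun q : nat * seq bool => capped q.1 q.2).
Proof.
rewrite /capped; apply: ptime_snd.
apply: (ptime_foldl_inv (l := fun q : nat * seq bool => q.2)
  (i := fun q : nat * seq bool => (minn q.1 1, 0))
  (step := fun (q : nat * seq bool) (b : bool) wa =>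
     (minn q.1 (wa.1 + wa.1), if b then minn q.1 (wa.2 + wa.1) else wa.2))
  (I := fun (q : nat * seq bool) _ wa => wa.1 <= q.1 /\ wa.2 <= q.1)).
- by repeat ptime2.
- by repeat ptime2.
- by repeat ptime2.
- by move=> q /=; lia.
- by move=> q j b wa /=; case: b; lia.
exists (fun x => 4 * x + 4); first by poly.
by move=> [n bits] j [w a] _ /=; rewrite !csize_pair !csize_nat; lia.
Qed.

Lemma ptime_bcds_solver : ptime bcds_solver.
Proof.
apply: (ptime_map (l := fun I : bmatrix * seq bool => iota 0 (size I.1))
  (F := fun I v => v \in solve I.1 (capped (size I.1) I.2))); first by repeat ptime2.
have pc : ptime (fun q : bmatrix * seq bool * nat => capped (size q.1.1) q.1.2).
  by apply: (ptime_comp2 (F := capped) ptime_capped); repeat ptime2.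
have ps : ptime (fun q : bmatrix * seq bool * nat => solve q.1.1 (capped (size q.1.1) q.1.2)).
  by apply: (ptime_comp2 (F := solve) ptime_solve); repeat ptime2.
by repeat ptime2.
Qed.

(** * Moat growing: upper bounds *)

Section Chains.
Variables (V : finType) (adj : rel V).
Implicit Types (l seen : seq V).

(* Every prefix of a chain induces a connected subgraph. *)
Fixpoint grows seen l :=
  if l is v :: r then has (adj^~ v) seen && grows (v :: seen) r else true.

Definition chain l := if l is x :: r then grows [:: x] r else true.

Lemma grows_cat seen l1 l2 :
  grows seen (l1 ++ l2) = grows seen l1 && grows (catrev l1 seen) l2.
Proof. by elim: l1 seen => //= v r IH seen; rewrite IH andbA. Qed.

(** A dropped vertex lies in [l1], hence in [seen'], and can still be the earlier neighbour of the
    vertices that remain. *)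
Lemma grows_filter seen seen' l1 l : {subset seen <= seen'} -> {subset l1 <= seen'} ->
  grows seen l -> grows seen' [seq x <- l | x \notin l1].
Proof.
elim: l seen seen' => //= v r IH seen seen' s1 s2 /andP[/hasP[u us uv] gr].
case: ifP => /= vl.
  apply/andP; split; first by apply/hasP; exists u => //; apply: s1.
  apply: IH gr => w; rewrite !inE; first by move=> /orP[->//|/s1 ->]; rewrite orbT.
  by move=> /s2 ->; rewrite orbT.
apply: IH gr => // w; rewrite inE => /orP[/eqP ->|/s1 //]; apply: s2.
by move/negbFE: vl.
Qed.

Lemma chain_catd x y l1 l2 : chain (x :: l1) -> chain (y :: l2) ->
  (y \in x :: l1) || has (adj^~ y) (x :: l1) -> chain (catd (x :: l1) (y :: l2)).
Proof.
set m := x :: l1 => c1 c2 h.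
have sub : {subset m <= catrev l1 [:: x]}.
  by move=> w; rewrite catrevE mem_cat mem_rev !inE orbC.
rewrite /catd /= grows_cat [grows _ l1]c1 /=; case: ifP => ym.
  move: h; rewrite (negbTE ym) orFb => /hasP[u um uy]; apply/andP; split.
    by apply/hasP; exists u => //; apply: sub.
  apply: grows_filter c2 => w; first by rewrite !inE => ->.
  by move=> /sub wm; rewrite inE wm orbT.
apply: grows_filter c2 => // w; rewrite inE => /eqP ->; apply: sub.
by move/negbFE: ym.
Qed.

Lemma chain_take i l : chain l -> chain (take i l).
Proof.
case: l i => // x r [|i] //= h.
by move: h; rewrite -{1}(cat_take_drop i r) grows_cat => /andP[].
Qed.

Lemma chain_connect l (S : {set V}) : {subset l <= S} -> chain l ->
  forall u, u \in l -> connect [rel x y | [&& x \in S, y \in S & adj x y]] (head u l) u.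
Proof.
case: l => // x r sub c u; rewrite /=.
set e := [rel _ _ | _].
have gen l seen : {subset seen <= S} -> {subset l <= S} -> (forall v, v \in seen -> connect e x v) ->
    grows seen l -> forall v, v \in l -> connect e x v.
  elim: l seen => //= v l IH seen s1 s2 hs /andP[/hasP[w ws wv] gr] v'.
  have cv : connect e x v.
    apply: connect_trans (hs _ ws) (connect1 _).
    by rewrite /= s1 // s2 ?mem_head.
  rewrite inE => /orP[/eqP -> //|v'l].
  apply: IH gr _ v'l => [y|y yl|y]; last by rewrite inE => /orP[/eqP ->//|/hs].
    by rewrite inE => /orP[/eqP ->|/s1//]; apply: s2; rewrite mem_head.
  by apply: s2; rewrite inE yl orbT.
rewrite inE => /orP[/eqP -> //|ur]; apply: (gen r [:: x]) => //.
- by move=> y; rewrite inE => /eqP ->; apply: sub; rewrite mem_head.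
- by move=> y yr; apply: sub; rewrite inE yr orbT.
- by move=> y; rewrite inE => /eqP ->.
Qed.

(* [E] is the edge set of a spanning tree of [l]: it crosses every cut that separates [l]. *)
Lemma chain_edges l : chain l -> exists E : seq (V * V),
  [/\ size E = (size l).-1, all (fun e => adj e.1 e.2) E &
      forall C : {set V}, (exists2 u, u \in l & u \in C) -> (exists2 u, u \in l & u \notin C) ->
        has (fun e => (e.1 \in C) != (e.2 \in C)) E].
Proof.
case: l => [|x r]; first by exists [::]; split=> // C [].
move=> c.
have gen l seen : grows seen l -> exists E : seq (V * V),
  [/\ size E = size l, all (fun e => adj e.1 e.2) E &
      forall C : {set V}, ~~ has (fun e => (e.1 \in C) != (e.2 \in C)) E ->
       forall v, v \in l -> exists2 u, u \in seen & (v \in C) = (u \in C)].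
  elim: l seen => [|v l IH] seen /=; first by exists [::].
  move=> /andP[/hasP[w ws wv] /IH [E [sE aE hE]]].
  exists ((w, v) :: E); split=> //=; [by rewrite sE|by rewrite wv|].
  move=> C; rewrite negb_or => /andP[/negbNE/eqP wvC /hE {}hE] v'.
  rewrite inE => /orP[/eqP ->|/hE[u]]; first by exists w.
  rewrite inE => /orP[/eqP ->|us] h; last by exists u.
  by exists w => //; rewrite h.
have [E [sE aE hE]] := gen _ _ c; exists E; split=> // C [u ul uC] [v vl vC].
apply/negPn/negP => /hE {}hE.
have eqx w : w \in x :: r -> (w \in C) = (x \in C).
  rewrite inE => /orP[/eqP -> //|/hE[y]]; by rewrite inE => /eqP ->.
by move: vC; rewrite eqx // -(eqx u) // uC.
Qed.

End Chains.

(** * Length bounds for pruned trees and for their prefixes *)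

Section Moat.
Variables (V : finType) (adj : rel V) (p : V -> nat) (mu ell cap : nat).

Record moat := Moat
  { radius : V -> nat; age : V -> nat; left_over : V -> nat; walk : V -> V -> seq V }.
Implicit Types (s : moat) (x y z a b : V) (X : seq V) (Z : {set V}).

Definition moat_init : moat := Moat (fun=> 0) (fun=> 0) (fun v => mu * p v)
  (fun x z => if x == z then [:: x] else [::]).

Definition moat_merge s a b : moat :=
  Moat (radius s)
    (fun v => if joined (walk s) a v || joined (walk s) b v
              then maxn (age s a) (age s b) else age s v)
    (fun v => if joined (walk s) a v || joined (walk s) b v
              then minn (left_over s a + left_over s b) cap else left_over s v)
    (mroute (age s) (walk s) a b).

Definition moat_grow s : moat :=
  Moat (fun v => if 0 < left_over s v then (radius s v).+1 else radius s v)
    (fun v => if 0 < left_over s v then (age s v).+1 else age s v)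
    (fun v => (left_over s v).-1) (walk s).

Definition lset (l : seq V) : {set V} := [set v in l].
(** The pruned tree seen from [x]. It depends on [x] and not only on its cluster, because a dead
    part is kept when it contains [x]. *)
Definition core s x := lset (walk s x x).
Definition cores s X := \bigcup_(x <- X) core s x.
Definition cluster s x : {set V} := [set z | joined (walk s) x z].
Definition psum Z := \sum_(v in Z) p v.

(* [cores_cost] bounds the length of the pruned tree spanned by the terminals
   [X]; each terminal beyond the first two may be a dead leaf and costs one age.
   [prefix_cost] and [prefix_cores_cost] are its versions for the prefixes of a
   walk, whose last vertex may cut through a cluster. *)
Record moat_inv now s : Prop := MoatInv {
  joined_refl x : joined (walk s) x x;
  joined_sym x z : joined (walk s) x z = joined (walk s) z x;
  joined_trans x y z : joined (walk s) x y -> joined (walk s) y z -> joined (walk s) x z;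
  path_cores x z : joined (walk s) x z -> lset (walk s x z) = core s x :|: core s z;
  path_uniq x z : uniq (walk s x z);
  path_head x z : joined (walk s) x z -> exists r, walk s x z = x :: r;
  path_chain x z : chain adj (walk s x z);
  core_cluster x : core s x \subset cluster s x;
  age_joined x z : joined (walk s) x z -> age s x = age s z;
  left_joined x z : joined (walk s) x z -> left_over s x = left_over s z;
  age_now x : age s x <= now;
  left_now x : 0 < left_over s x -> age s x = now;
  eldest x : exists2 y, joined (walk s) x y & radius s y = age s y;
  cores_cost X x : all (joined (walk s) x) X -> X != [::] ->
    ell * #|cores s X| + \sum_(y <- X) radius s y + 2 * left_over s x + 2 * age s x
    <= 2 * mu * psum (cores s X) + size X * age s x + ell;
  prefix_cores_cost X x z i : all (joined (walk s) x) X -> x \in X -> joined (walk s) x z ->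
    ell * #|cores s X :|: lset (take i (walk s x z))| + \sum_(y <- X) radius s y
    <= 2 * mu * psum (cores s X :|: lset (take i (walk s x z))) + size X * age s x + ell;
  prefix_cost x z i : joined (walk s) x z -> 0 < i ->
    ell * #|lset (take i (walk s x z))| + radius s x
    <= 2 * mu * psum (lset (take i (walk s x z))) + age s x + ell }.

Lemma psumU Z1 Z2 : [disjoint Z1 & Z2] -> psum (Z1 :|: Z2) = psum Z1 + psum Z2.
Proof. by move=> h; rewrite /psum (eq_bigl (predU (mem Z1) (mem Z2))) ?bigU // => v; rewrite !inE. Qed.

Lemma cardsU_disjoint Z1 Z2 : [disjoint Z1 & Z2] -> #|Z1 :|: Z2| = #|Z1| + #|Z2|.
Proof. by move=> h; rewrite cardsU disjoint_setI0 // cards0 subn0. Qed.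

Lemma lset_catd (l1 l2 : seq V) : lset (catd l1 l2) = lset l1 :|: lset l2.
Proof.
apply/setP => v; rewrite !inE mem_cat mem_filter; by case: (v \in l1).
Qed.

(** A prefix of the filtered [l2] is the filtering of a prefix of [l2], and what was filtered out
    lies in [l1]. Positivity of [j] is recorded since [prefix_cost] concerns nonempty prefixes. *)
Lemma lset_take_catd i (l1 l2 : seq V) : 0 < i ->
  (exists2 j, 0 < j & lset (take i (catd l1 l2)) = lset (take j l1)) \/
  (exists2 j, 0 < j & lset (take i (catd l1 l2)) = lset l1 :|: lset (take j l2)).
Proof.
move=> i0; rewrite /catd take_cat; case: ltnP => hi; first by left; exists i.
set m := i - size l1.
have [j hj] : exists j, take m [seq x <- l2 | x \notin l1] = [seq x <- take j l2 | x \notin l1].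
  elim: l2 m => [|x l2 IH] m; first by exists 0.
  rewrite /=; case: ifP => hx.
    case: m => [|m]; first by exists 0.
    by have [j hj] := IH m; exists j.+1; rewrite /= hx hj.
  by have [j hj] := IH m; exists j.+1; rewrite /= hx hj.
case: j hj => [|j] hj.
  by left; exists i => //; rewrite hj take0 /= cats0 take_oversize.
right; exists j.+1 => //; rewrite hj; apply/setP => v.
rewrite !inE mem_cat mem_filter; by case: (v \in l1).
Qed.

Lemma moat_init_inv : moat_inv 0 moat_init.
Proof.
have J x z : joined (walk moat_init) x z = (x == z) by rewrite /joined /=; case: eqP.
have C x : core moat_init x = [set x].
  by rewrite /core /= eqxx; apply/setP => v; rewrite !inE.
have R x X : all (joined (walk moat_init) x) X -> X != [::] -> cores moat_init X = [set x].
  elim: X => // y X IH /= /andP[xy aX] _; move: xy; rewrite J => /eqP <-.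
  rewrite /cores big_cons C; case: X IH aX => [|y' X] IH aX; first by rewrite big_nil setU0.
  by move/IH: aX => /(_ isT); rewrite /cores => ->; rewrite setUid.
have S1 x : psum [set x] = p x by rewrite /psum big_set1.
have D X : \sum_(y <- X) radius moat_init y = 0 by rewrite big1.
split=> [x|x z|x y z|x z|x z|x z|x z|x|x z|x z|x|x|x|X x aX X0|X x z i aX xX|x z [|i] //].
- by rewrite J.
- by rewrite !J eq_sym.
- by rewrite !J => /eqP ->.
- by rewrite J => /eqP ->; rewrite setUid.
- by rewrite /=; case: ifP.
- by rewrite J /= => ->; exists [::].
- by rewrite /=; case: ifP.
- by rewrite C; apply/subsetP => z; rewrite !inE J eq_sym.
- by [].
- by rewrite J => /eqP ->.
- by [].
- by [].
- by exists x; rewrite ?J.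
- rewrite (R x) // D cards1 S1 /=; lia.
- rewrite J => /eqP <-; rewrite /= eqxx.
  have X0 : X != [::] by case: X xX {aX}.
  have -> : cores moat_init X :|: lset (take i [:: x]) = [set x].
    rewrite (R x) //; apply/setUidPl/subsetP => v; rewrite !inE => /mem_take.
    by rewrite inE.
  rewrite D cards1 S1; lia.
- rewrite J => /eqP <- _; rewrite /= eqxx.
  have -> : lset [:: x] = [set x] by apply/setP => v; rewrite !inE.
  rewrite cards1 S1; lia.
Qed.

(** In an active cluster each terminal gains one unit of radius, the lost unit of potential offsets
    the unit of age, and so both sides of each length bound grow by the number of terminals. *)
Lemma moat_grow_inv now s : moat_inv now s -> moat_inv now.+1 (moat_grow s).
Proof.
move=> I; have LJ := left_joined I.
have R X x : all (joined (walk s) x) X -> \sum_(y <- X) radius (moat_grow s) y =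
    \sum_(y <- X) radius s y + (if 0 < left_over s x then size X else 0).
  elim: X => [|y X IH] /=; first by rewrite !big_nil if_same.
  move=> /andP[xy /IH {}IH]; rewrite !big_cons IH /= -(LJ x) //.
  by case: ifP => _; lia.
have A x : age (moat_grow s) x = age s x + (if 0 < left_over s x then 1 else 0).
  by rewrite /=; case: ifP; lia.
split=> [x|x z|x y z|x z|x z|x z|x z|x|x z xz|x z /LJ /= ->//|x|x|x|X x aX X0|X x z i aX xX xz|x z i xz i0].
- exact: joined_refl I x.
- exact: joined_sym I x z.
- exact: (@joined_trans _ _ I x y z).
- exact: path_cores I x z.
- exact: path_uniq I x z.
- exact: path_head I x z.
- exact: path_chain I x z.
- exact: core_cluster I x.
- by rewrite /= (LJ x z) // (age_joined I xz).
- by rewrite /=; have := age_now I x; case: ifP; lia.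
- by rewrite /= => h; rewrite ifT; [rewrite (left_now I) //|]; lia.
- by have [y xy h] := eldest I x; exists y; rewrite //= h -(LJ x y).
- have := cores_cost I aX X0; rewrite (R X x) // A.
  change (cores (moat_grow s) X) with (cores s X).
  by rewrite /= mulnDr; case: ifP => hl; lia.
- have := prefix_cores_cost I i aX xX xz; rewrite (R X x) // A.
  change (cores (moat_grow s) X) with (cores s X).
  by rewrite /= mulnDr; case: ifP => hl; lia.
- have := prefix_cost I xz i0; rewrite A /=.
  by case: ifP => hl; lia.
Qed.


Lemma catd_uniq (l1 l2 : seq V) : uniq l1 -> uniq l2 -> uniq (catd l1 l2).
Proof.
move=> u1 u2; rewrite cat_uniq u1 filter_uniq // andbT; apply/hasPn => x.
by rewrite mem_filter => /andP[].
Qed.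

Lemma in_cores s X v : (v \in cores s X) = has (fun x => v \in core s x) X.
Proof.
elim: X => [|x X IH]; first by rewrite /cores big_nil in_set0.
by rewrite /cores big_cons in_setU /= -IH.
Qed.

Lemma cores_cons s x X : cores s (x :: X) = core s x :|: cores s X.
Proof. by rewrite /cores big_cons. Qed.

(** Each side has an end of the new edge as additional terminal. The two radii pay for the edge, and
    the reserves [2 * tA] and [2 * tB] turn the age terms into (mA - 1) tA + (mB - 1) tB. This is at
    most (mA + mB - 2) times the larger age unless a side without terminals died earlier, which is
    exactly the side that gets pruned. *)
Lemma merge_arith L eA eB dA dB SA SB lA lB tA tB PA PB mA mB :
  ell <= dA + dB -> L <= lA + lB ->
  eA + (dA + SA) + 2 * lA + 2 * tA <= PA + mA.+1 * tA + ell ->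
  eB + (dB + SB) + 2 * lB + 2 * tB <= PB + mB.+1 * tB + ell ->
  0 < mA + mB -> (mA = 0 -> tB <= tA) -> (mB = 0 -> tA <= tB) ->
  eA + eB + (SA + SB) + 2 * L + 2 * maxn tA tB <= PA + PB + (mA + mB) * maxn tA tB + ell.
Proof.
move=> h1 hL hA hB hs; set T := maxn tA tB.
have TA : tA <= T by lia.
have TB : tB <= T by lia.
case: mA hA hs => [|mA] hA hs; case: mB hB hs => [|mB] hB hs // h2 h3.
- by have := leq_mul (leqnn mB) TB; lia.
- by have := leq_mul (leqnn mA) TA; lia.
- by have := leq_mul (leqnn mA) TA; have := leq_mul (leqnn mB) TB; lia.
Qed.

(** The prefix ends in side A, which therefore has no reserve [2 * tA]; the reserve of B is enough
    because the conclusion asks for none. *)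
Lemma merge_arith_l eA eB dA dB SA SB lB tA tB PA PB mA mB :
  ell <= dA + dB ->
  eA + (dA + SA) <= PA + mA.+1 * tA + ell ->
  eB + (dB + SB) + 2 * lB + 2 * tB <= PB + mB.+1 * tB + ell ->
  (mB = 0 -> tA <= tB) ->
  eA + eB + (SA + SB) <= PA + PB + (mA + mB) * maxn tA tB + ell.
Proof.
move=> h1 hA hB h2; set T := maxn tA tB.
have TA : tA <= T by lia.
have TB : tB <= T by lia.
have := leq_mul (leqnn mA) TA.
case: mB hB h2 => [|mB] hB h2; first by move/(_ erefl): h2; lia.
by have := leq_mul (leqnn mB) TB; lia.
Qed.

Lemma merge_arith_r eA eB dA dB SA SB lA tA tB PA PB mA mB :
  ell <= dA + dB -> 0 < mA ->
  eA + (dA + SA) + 2 * lA + 2 * tA <= PA + mA.+1 * tA + ell ->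
  eB + (dB + SB) <= PB + mB.+1 * tB + ell ->
  eA + eB + (SA + SB) <= PA + PB + (mA + mB) * maxn tA tB + ell.
Proof.
move=> h1 + hA hB; set T := maxn tA tB.
have TA : tA <= T by lia.
have TB : tB <= T by lia.
case: mA hA => // mA hA _.
by have := leq_mul (leqnn mA) TA; have := leq_mul (leqnn mB) TB; lia.
Qed.

(** The walk from [x] has crossed into B: the age terms of the two terminals [x] and [a] cancel
    against the reserve of A. *)
Lemma merge_arith_2 eA eB dA dB dx lA tA tB PA PB :
  ell <= dA + dB ->
  eA + (dx + (dA + 0)) + 2 * lA + 2 * tA <= PA + 2 * tA + ell ->
  eB + dB <= PB + tB + ell ->
  eA + eB + dx <= PA + PB + maxn tA tB + ell.
Proof. lia. Qed.

(** The walk has traversed the core of B and is back in A: what remains is 2 tA - tB, at most tA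
    because B did not die earlier. *)
Lemma merge_arith_3 eA eB dA dB dx lB tA tB PA PB :
  ell <= dA + dB ->
  eA + (dx + (dA + 0)) <= PA + 2 * tA + ell ->
  eB + (dB + 0) + 2 * lB + 2 * tB <= PB + 1 * tB + ell ->
  tA <= tB ->
  eA + eB + dx <= PA + PB + maxn tA tB + ell.
Proof. lia. Qed.

(** * Merging two clusters along a tight edge *)

Section Merge.
Variables (now : nat) (s : moat).
Hypothesis I : moat_inv now s.
Local Notation J := (joined (walk s)).
Local Notation t := (age s).
Local Notation r := (walk s).
Local Notation JI a b := (join t r a b).

Definition mergeable a b :=
  [&& ~~ J a b, adj a b, adj b a & ell <= radius s a + radius s b].

Lemma mergeable_sym a b : mergeable a b -> mergeable b a.
Proof.
by rewrite /mergeable => /and4P[h1 -> -> h4]; rewrite (joined_sym I) h1 addnC.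
Qed.

Lemma merge_excl a b x : mergeable a b -> J a x -> J b x = false.
Proof.
move=> /andP[nab _] ax; apply: contraNF nab => bx.
by apply: (joined_trans I ax); rewrite (joined_sym I).
Qed.

Lemma joined_eq a x y : J a x -> J a y = J x y.
Proof.
move=> ax; apply/idP/idP => h; last exact: (joined_trans I ax).
by apply: (joined_trans I) h; rewrite (joined_sym I).
Qed.

Lemma nilp_catd (l1 l2 : seq V) : ~~ nilp l1 -> ~~ nilp (catd l1 l2).
Proof. by case: l1. Qed.

Lemma joined_join a b x z : mergeable a b -> J a x -> ~~ nilp (JI a b x z) = J a z || J b z.
Proof.
move=> m ax; have xa : J x a by rewrite (joined_sym I).
rewrite /join; case az: (J a z) => /=.
  case: ifP => _; last by rewrite !nilp_catd.
  by rewrite -/(J x z) -(joined_eq _ ax) az.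
case bz: (J b z); first by rewrite nilp_catd.
by rewrite -/(J x z) -(joined_eq _ ax) az.
Qed.

Definition mcore a b x :=
  if t b < t a then core s x else core s x :|: core s a :|: core s b.

Lemma lset_join a b x z : mergeable a b -> J a x -> J a z || J b z ->
  lset (JI a b x z) = if J a z then mcore a b x :|: mcore a b z
    else core s x :|: core s a :|: core s b :|: core s z.
Proof.
move=> m ax; have xa : J x a by rewrite (joined_sym I).
have PC := path_cores I; have bb := joined_refl I b.
case: (boolP (J a z)) => [az _|/negbTE az /= bz]; rewrite /join /mcore az.
  have xz : J x z by rewrite -(joined_eq _ ax).
  case: ifP => _; first by rewrite PC.
  rewrite !lset_catd !PC // setUid.
  by move: (core s x) (core s a) (core s b) (core s z) => c1 c2 c3 c4;
     apply/setP => v; rewrite !inE; do !case: (_ \in _).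
rewrite bz lset_catd !PC //.
by move: (core s x) (core s a) (core s b) (core s z) => c1 c2 c3 c4;
   apply/setP => v; rewrite !inE; do !case: (_ \in _).
Qed.

Lemma core_join a b x : mergeable a b -> J a x -> lset (JI a b x x) = mcore a b x.
Proof. by move=> m ax; rewrite lset_join ?ax // setUid. Qed.

Lemma join_uniq a b x z : uniq (JI a b x z).
Proof.
have U := path_uniq I; rewrite /join.
by do !case: ifP => _; do ?apply: catd_uniq.
Qed.

Lemma join_head a b x z : mergeable a b -> J a x -> J a z || J b z ->
  exists q, JI a b x z = x :: q.
Proof.
move=> m ax; have xa : J x a by rewrite (joined_sym I).
have [q1 e1] := path_head I xa.
case: (boolP (J a z)) => [az _|/negbTE az /= bz]; rewrite /join az.
  have xz : J x z by rewrite -(joined_eq _ ax).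
  case: ifP => _; first exact: (path_head I xz).
  by rewrite e1; eexists.
by rewrite bz e1; eexists.
Qed.

Lemma join_chain a b x z : mergeable a b -> J a x -> chain adj (JI a b x z).
Proof.
move=> m ax; have xa : J x a by rewrite (joined_sym I).
have [q1 e1] := path_head I xa; have [q2 e2] := path_head I (joined_refl I b).
have ain : a \in r x a.
  have : a \in lset (r x a).
    rewrite (path_cores I) // inE; apply/orP; right.
    by have [q3 e3] := path_head I (joined_refl I a); rewrite inE e3 mem_head.
  by rewrite inE.
have [_ adjab _ _] := and4P m.
have hab z' q : r b z' = b :: q -> chain adj (catd (r x a) (r b z')).
  move=> e; rewrite e1 e; apply: chain_catd; rewrite -?e1 -?e; do ?exact: (path_chain I).
  by apply/orP; right; apply/hasP; exists a.
rewrite /join; case az: (J a z) => /=.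
  have xz : J x z by rewrite -(joined_eq _ ax).
  case: ifP => _; first exact: (path_chain I).
  have [q3 e3] := path_head I xz.
  have := hab b q2 e2; rewrite e1 /catd cat_cons -/(catd (x :: q1) _) => h.
  rewrite e3; apply: chain_catd => //; last by rewrite mem_head.
  by rewrite -e3; apply: (path_chain I).
case: ifP => [bz|_]; last exact: (path_chain I).
by have [q3 e3] := path_head I bz; apply: hab e3.
Qed.


Lemma mroute_l a b x z : J a x -> mroute t r a b x z = JI a b x z.
Proof. by rewrite /mroute => ->. Qed.

Lemma mroute_r a b x z : mergeable a b -> J b x -> mroute t r a b x z = JI b a x z.
Proof. by move=> /mergeable_sym m bx; rewrite /mroute (merge_excl m bx) bx. Qed.

(** The union of the pruned trees of [X] after the merge, written through trees before it. Unless
    one side is pruned, the ends of the new edge become terminals; for this reason the invariant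
    treats arbitrary terminal lists. *)
Definition mcores a b X :=
  if ~~ has (J b) X && (t b < t a) || ~~ has (J a) X && (t a < t b) then cores s X
  else cores s (a :: filter (J a) X) :|: cores s (b :: filter (J b) X).

Lemma mcoresC a b X : mcores a b X = mcores b a X.
Proof. by rewrite /mcores orbC setUC. Qed.

Lemma core_merge a b x : mergeable a b -> J a x || J b x ->
  core (moat_merge s a b) x = if J a x then mcore a b x else mcore b a x.
Proof.
move=> m /=; rewrite /core /=.
case: (boolP (J a x)) => [ax _|_ /= bx]; first by rewrite mroute_l // core_join.
by rewrite mroute_r // core_join //; apply: mergeable_sym.
Qed.

Lemma cores_merge a b X : mergeable a b -> all (fun y => J a y || J b y) X -> X != [::] ->
  cores (moat_merge s a b) X = mcores a b X.
Proof.
move=> m aX X0; have inX y : y \in X -> J a y || J b y by move/(allP aX).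
have sub y v : y \in X -> v \in core s y -> v \in core (moat_merge s a b) y.
  move=> /inX h vy; rewrite core_merge // /mcore.
  by case: ifP => _; case: ifP => _ //; rewrite !in_setU vy.
apply/setP => v; rewrite /mcores in_cores; case: ifP => h.
  rewrite in_cores; apply: eq_in_has => y yX; have hy := inX _ yX.
  rewrite core_merge // /mcore; case/orP: h => /andP[/hasPn nb lt].
    by move: hy; rewrite (negbTE (nb _ yX)) orbF => ->; rewrite lt.
  by rewrite (negbTE (nb _ yX)) lt.
rewrite in_setU !in_cores /=.
have hasF c : has (fun y => v \in core s y) (filter (J c) X) =
    has (fun y => J c y && (v \in core s y)) X.
  by elim: (X) => //= y X' IH; case: ifP => /= h'; rewrite IH.
rewrite !hasF.
have full y : y \in X -> v \in core s a \/ v \in core s b ->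
    (if J a y then ~~ (t b < t a) else ~~ (t a < t b)) -> v \in core (moat_merge s a b) y.
  move=> yX hv; rewrite core_merge ?inX // /mcore; case: ifP => _ /negbTE ->;
  by rewrite !in_setU; case: hv => ->; rewrite ?orbT.
(* If nothing is pruned, there is a terminal whose opposite side did not die earlier; its core alone
   contains those of [a] and [b]. *)
have ex : exists2 y, y \in X & (if J a y then ~~ (t b < t a) else ~~ (t a < t b)).
  have [|/hasPn nb] := boolP (has (J b) X).
    case/hasP=> y yX bY; case: (boolP (t a < t b)) => lt; last first.
      by exists y; rewrite // (merge_excl (mergeable_sym m) bY).
    move: h; rewrite lt andbT orbC; case: (boolP (has (J a) X)) => // /hasP[y' y'X ay'] _.
    by exists y'; rewrite // ay' -leqNgt ltnW.
  case: X X0 aX nb h {inX sub hasF full} => // y X' _ /= /andP[hy _] nb h.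
  have hb := nb y (mem_head _ _); rewrite (negbTE hb) orbF in hy.
  exists y; rewrite ?mem_head // hy; move: h; rewrite (negbTE hb) /=.
  have -> : has (J b) X' = false by apply/negbTE/hasPn => w wX; apply: nb; rewrite inE wX orbT.
  by rewrite hy /= orbF => ->.
apply/hasP/idP => [[y yX]|].
  rewrite core_merge ?inX // /mcore => hv.
  have hA : J a y -> v \in core s y -> has (fun y => J a y && (v \in core s y)) X.
    by move=> h1 h2; apply/hasP; exists y => //; apply/andP.
  have hB : J b y -> v \in core s y -> has (fun y => J b y && (v \in core s y)) X.
    by move=> h1 h2; apply/hasP; exists y => //; apply/andP.
  have := inX _ yX; move: hv; case: (boolP (J a y)) => ay /=.
    by case: ifP => _; rewrite ?in_setU; [move=> /(hA ay) -> | case/orP => [/orP[/(hA ay) ->|->]|->]]; rewrite ?orbT.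
  by move=> hv bY; move: hv; case: ifP => _; rewrite ?in_setU;
     [move=> /(hB bY) -> | case/orP => [/orP[/(hB bY) ->|->]|->]]; rewrite ?orbT.
case: ex => w wX hw.
case/orP => /orP[hv|/hasP[y yX /andP[_ hv]]]; try by exists y => //; apply: sub.
  by exists w => //; apply: full => //; left.
by exists w => //; apply: full => //; right.
Qed.

Lemma cores_sub a X : all (J a) X -> cores s X \subset cluster s a.
Proof.
move=> aX; apply/subsetP => v; rewrite in_cores => /hasP[y yX vy].
have ay := allP aX _ yX; have := subsetP (core_cluster I y) _ vy.
by rewrite !inE -(joined_eq _ ay).
Qed.

Lemma path_sub a x z : J a x -> J a z -> lset (r x z) \subset cluster s a.
Proof.
move=> ax az; rewrite (path_cores I) -?(joined_eq _ ax) //.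
apply/subUsetP; split; apply/subsetP => v /(subsetP (core_cluster I _));
  by rewrite !inE -?(joined_eq _ ax) -?(joined_eq _ az).
Qed.

Lemma take_sub a i (l : seq V) : lset l \subset cluster s a -> lset (take i l) \subset cluster s a.
Proof.
move=> h; apply: subset_trans h; apply/subsetP => v; rewrite !inE; exact: mem_take.
Qed.

Lemma clusters_disjoint a b Z1 Z2 : mergeable a b ->
  Z1 \subset cluster s a -> Z2 \subset cluster s b -> [disjoint Z1 & Z2].
Proof.
move=> m h1 h2; rewrite -setI_eq0; apply/eqP/setP => v; rewrite in_setI in_set0.
apply/negP => /andP[/(subsetP h1) + /(subsetP h2)]; rewrite !inE => av.
by rewrite (merge_excl m av).
Qed.

Lemma cardU a b Z1 Z2 : mergeable a b ->
  Z1 \subset cluster s a -> Z2 \subset cluster s b -> #|Z1 :|: Z2| = #|Z1| + #|Z2|.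
Proof. by move=> m h1 h2; rewrite cardsU_disjoint // (clusters_disjoint m). Qed.

Lemma sumU a b Z1 Z2 : mergeable a b ->
  Z1 \subset cluster s a -> Z2 \subset cluster s b -> psum (Z1 :|: Z2) = psum Z1 + psum Z2.
Proof. by move=> m h1 h2; rewrite psumU // (clusters_disjoint m). Qed.

Lemma sum_split a b X (F : V -> nat) : mergeable a b -> all (fun y => J a y || J b y) X ->
  \sum_(y <- X) F y = \sum_(y <- filter (J a) X) F y + \sum_(y <- filter (J b) X) F y.
Proof.
move=> m; elim: X => [|y X IH] /=; first by rewrite !big_nil.
case/andP=> hy /IH {}IH; rewrite big_cons IH.
case: (boolP (J a y)) hy => [ay _|_ /= ->]; first by rewrite (merge_excl m ay) big_cons addnA.
by rewrite [in RHS]big_cons; lia.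
Qed.

Lemma size_split a b X : mergeable a b -> all (fun y => J a y || J b y) X ->
  size X = size (filter (J a) X) + size (filter (J b) X).
Proof. by move=> m aX; have := sum_split (fun=> 1) m aX; rewrite !sum1_size. Qed.

Lemma size_filter_has a X : (0 < size (filter (J a) X)) = has (J a) X.
Proof. by rewrite size_filter has_count. Qed.

Lemma mcores_cost a b X L : mergeable a b -> all (fun y => J a y || J b y) X -> X != [::] ->
  L <= left_over s a + left_over s b ->
  ell * #|mcores a b X| + \sum_(y <- X) radius s y + 2 * L + 2 * maxn (t a) (t b)
  <= 2 * mu * psum (mcores a b X) + size X * maxn (t a) (t b) + ell.
Proof.
move=> m aX X0 hL.
have pruned c d : mergeable c d -> all (fun y => J c y || J d y) X ->
    ~~ has (J d) X && (t d < t c) -> L <= left_over s c + left_over s d ->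
    ell * #|cores s X| + \sum_(y <- X) radius s y + 2 * L + 2 * maxn (t c) (t d)
    <= 2 * mu * psum (cores s X) + size X * maxn (t c) (t d) + ell.
  move=> _ aX' /andP[/hasPn nd lt] hL'; have ac : all (J c) X.
    by apply/allP => y yX; have := allP aX' _ yX; rewrite (negbTE (nd _ yX)) orbF.
  (* An active cluster has age [now], but the age of [d] is below that of [c], so [d] has run out of
     potential. *)
  have ld : left_over s d = 0.
    by apply/eqP; rewrite eqn0Ngt; apply/negP => /(left_now I) h; have := age_now I c; lia.
  have -> : maxn (t c) (t d) = t c by lia.
  by have := cores_cost I ac X0; lia.
rewrite /mcores; case: ifP => [/orP[h|h]|h]; first exact: pruned h hL.
  rewrite maxnC; apply: pruned h _; first exact: mergeable_sym.
    by apply: sub_all aX => y; rewrite orbC.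
  by rewrite addnC.
have [_ _ _ tg] := and4P m.
have aA : all (J a) (a :: filter (J a) X) by rewrite /= (joined_refl I) filter_all.
have aB : all (J b) (b :: filter (J b) X) by rewrite /= (joined_refl I) filter_all.
have := cores_cost I aA isT; have := cores_cost I aB isT.
rewrite (cardU m (cores_sub aA) (cores_sub aB)) (sumU m (cores_sub aA) (cores_sub aB)).
rewrite (sum_split _ m aX) (size_split m aX) !big_cons /=.
have hs : 0 < size X by case: (X) X0.
rewrite (size_split m aX) in hs.
move: h; rewrite -!size_filter_has.
move: (size (filter (J a) X)) (size (filter (J b) X)) hs => mA mB hs h.
rewrite !mulnDr => hB hA; apply: (merge_arith tg hL hA hB); lia.
Qed.

(** The side in which the prefix ends contributes its own prefix bound, the other side the bound for
    whole cores with its reserve. *)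
Lemma mcores_prefix_cost a b X x z i :
  mergeable a b -> all (fun y => J a y || J b y) X -> x \in X -> J a x -> J a z || J b z ->
  let Z := mcores a b X :|: lset (take i (JI a b x z)) in
  ell * #|Z| + \sum_(y <- X) radius s y
  <= 2 * mu * psum Z + size X * maxn (t a) (t b) + ell.
Proof.
move=> m aX xX ax hz; have [_ _ _ tg] := and4P m.
have aA : all (J a) (a :: filter (J a) X) by rewrite /= (joined_refl I) filter_all.
have aB : all (J b) (b :: filter (J b) X) by rewrite /= (joined_refl I) filter_all.
have xa : J x a by rewrite (joined_sym I).
have xA : x \in a :: filter (J a) X by rewrite inE mem_filter ax xX orbT.
have mA : 0 < size (filter (J a) X) by rewrite size_filter_has; apply/hasP; exists x.
have aAx : all (J x) (a :: filter (J a) X).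
  by apply: sub_all aA => y; rewrite (joined_eq _ ax).
have tx : t x = t a by rewrite (age_joined I ax).
have cA := cores_cost I aA isT; have cB := cores_cost I aB isT.
have sA := cores_sub aA; have sB := cores_sub aB.
have caseA j : J a z -> (~~ has (J b) X -> t a <= t b) ->
    let Z := (cores s (a :: filter (J a) X) :|: cores s (b :: filter (J b) X)) :|: lset (take j (r x z)) in
    ell * #|Z| + \sum_(y <- X) radius s y
    <= 2 * mu * psum Z + size X * maxn (t a) (t b) + ell.
  move=> az hb; have xz : J x z by rewrite -(joined_eq _ ax).
  have := prefix_cores_cost I j aAx xA xz; rewrite tx setUAC /=.
  set Z1 := _ :|: lset _; have sZ1 : Z1 \subset cluster s a.
    by rewrite subUset sA take_sub // path_sub.
  rewrite (cardU m sZ1 sB) (sumU m sZ1 sB) (sum_split _ m aX) (size_split m aX).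
  move: cB; rewrite !big_cons /= !mulnDr => cB hZ; apply: (merge_arith_l tg hZ cB) => h0.
  by apply: hb; rewrite -size_filter_has h0.
have caseB j : J b z ->
    let Z := (cores s (a :: filter (J a) X) :|: cores s (b :: filter (J b) X)) :|: lset (take j (r b z)) in
    ell * #|Z| + \sum_(y <- X) radius s y
    <= 2 * mu * psum Z + size X * maxn (t a) (t b) + ell.
  move=> bz; have := prefix_cores_cost I j aB (mem_head _ _) bz; rewrite -setUA /=.
  set Z1 := _ :|: lset _; have sZ1 : Z1 \subset cluster s b.
    by rewrite subUset sB take_sub // path_sub // (joined_refl I).
  rewrite (cardU m sA sZ1) (sumU m sA sZ1) (sum_split _ m aX) (size_split m aX).
  by move: cA; rewrite !big_cons /= !mulnDr => cA hZ; apply: (merge_arith_r tg mA cA hZ).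
have inx c Y : c \in Y -> core s c \subset cores s Y.
  by move=> cY; apply/subsetP => v vc; rewrite in_cores; apply/hasP; exists c.
rewrite /mcores; case: ifP => [/orP[/andP[nb lt]|/andP[/hasPn/(_ x xX)]]|h]; last 2 first.
- by rewrite ax.
- have hb : ~~ has (J b) X -> t a <= t b.
    by move=> nb; move/negbT: h; rewrite nb /= => /norP[]; rewrite -leqNgt.
  (* All that the walk meets before its last segment lies in [U], so only the prefix of that segment
     matters. *)
  set U := cores s (a :: _) :|: cores s (b :: _).
  have U0 (Y : {set V}) : Y \subset U -> U :|: Y = U.
    by move=> /setUidPl.
  have Ux : core s x \subset U by rewrite subsetU // inx.
  have Ua : core s a \subset U by rewrite subsetU // inx ?inE ?eqxx.
  have Ub : core s b \subset U by rewrite subsetU // [core s b \subset cores s (b :: _)]inx ?orbT // inE eqxx.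
  have tk j l : lset (take j l) \subset lset l.
    by apply/subsetP => v; rewrite !inE; apply: mem_take.
  case: (posnP i) => [->|i0].
    have -> : lset (take 0 (JI a b x z)) = lset (take 0 (r x z)) by rewrite !take0.
    have [az|] := boolP (J a z); first exact: caseA.
    move=> naz; rewrite (negbTE naz) /= in hz.
    have -> : lset (take 0 (r x z)) = lset (take 0 (r b z)) by rewrite !take0.
    exact: caseB.
  rewrite /join; case: (boolP (J a z)) hz => [az _|_ /= bz].
    case: ifP => lt; first exact: caseA.
    have [[j j0 ->]|[j j0 ->]] := lset_take_catd (catd (r x a) (r b b)) (r x z) i0.
      rewrite [U :|: _]U0; last first.
        apply: subset_trans (tk _ _) _; rewrite lset_catd !(path_cores I) ?(joined_refl I) //.
        by rewrite !subUset Ux Ua Ub.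
      by have := caseA 0 az hb; rewrite take0 U0 //; apply/subsetP => v; rewrite inE.
    rewrite lset_catd !(path_cores I) ?(joined_refl I) // setUA [U :|: _]U0; last first.
      by rewrite !subUset Ux Ua Ub.
    exact: caseA.
  rewrite bz; have [[j j0 ->]|[j j0 ->]] := lset_take_catd (r x a) (r b z) i0.
    rewrite [U :|: _]U0; last first.
      by apply: subset_trans (tk _ _) _; rewrite (path_cores I) // subUset Ux Ua.
    by have := caseB 0 bz; rewrite take0 U0 //; apply/subsetP => v; rewrite inE.
  rewrite (path_cores I) // setUA [U :|: (_ :|: _)]U0; last by rewrite subUset Ux Ua.
  exact: caseB.
have aXa : all (J a) X.
  by apply/allP => y yX; have := allP aX _ yX; rewrite (negbTE (hasPn nb _ yX)) orbF.
have aXx : all (J x) X by apply: sub_all aXa => y; rewrite (joined_eq _ ax).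
have TE : maxn (t a) (t b) = t a by apply/maxn_idPl/ltnW.
have inA j w : J a w -> ell * #|cores s X :|: lset (take j (r x w))| + \sum_(y <- X) radius s y
   <= 2 * mu * psum (cores s X :|: lset (take j (r x w))) + size X * maxn (t a) (t b) + ell.
  move=> aw; rewrite TE -tx; apply: (prefix_cores_cost I) => //.
  by rewrite -(joined_eq _ ax).
case: (posnP i) => [->|i0].
  have -> : lset (take 0 (JI a b x z)) = lset (take 0 (r x a)) by rewrite !take0.
  by apply: inA; rewrite (joined_refl I).
rewrite /join; case: (boolP (J a z)) hz => [az _|_ /= bz]; first by rewrite lt; apply: inA.
rewrite bz; have [[j j0 ->]|[j j0 ->]] := lset_take_catd (r x a) (r b z) i0.
  by apply: inA; rewrite (joined_refl I).
(* Side [b] is pruned for [X], yet the walk enters it: [a], where the walk leaves, becomes one more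
   terminal, and [b] contributes only a nonempty prefix. *)
have fX : filter (J a) X = X by apply/all_filterP.
have -> : cores s X :|: (lset (r x a) :|: lset (take j (r b z))) =
    cores s (a :: X) :|: lset (take j (r b z)).
  rewrite setUA; congr (_ :|: _); rewrite (path_cores I) // cores_cons setUA.
  by rewrite (setUidPl (inx x X xX)) setUC.
rewrite fX in cA sA; have sB' : lset (take j (r b z)) \subset cluster s b.
  by rewrite take_sub // path_sub // (joined_refl I).
rewrite (cardU m sA sB') (sumU m sA sB') TE.
have X0 : 0 < size X by case: (X) xX.
have hP := prefix_cost I bz j0; move: cA; rewrite big_cons /= !mulnDr => cA.
rewrite -[radius s b]addn0 -[X in _ + X + _]mul1n in hP.
by have := merge_arith_r tg X0 cA hP; rewrite !addn0 TE.
Qed.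

(** Three cases by the end of the prefix: before the new edge, in the cluster of [b], or back in the
    cluster of [a] after the whole core of [b]. *)
Lemma join_prefix_cost a b x z i :
  mergeable a b -> J a x -> J a z || J b z -> 0 < i ->
  let Z := lset (take i (JI a b x z)) in
  ell * #|Z| + radius s x <= 2 * mu * psum Z + maxn (t a) (t b) + ell.
Proof.
move=> m ax hz i0; have [_ _ _ tg] := and4P m.
have xa : J x a by rewrite (joined_sym I).
have tx : t x = t a by rewrite (age_joined I ax).
have inA j w : J a w -> 0 < j -> ell * #|lset (take j (r x w))| + radius s x
   <= 2 * mu * psum (lset (take j (r x w))) + maxn (t a) (t b) + ell.
  move=> aw j0; have xw : J x w by rewrite -(joined_eq _ ax).
  apply: leq_trans (prefix_cost I xw j0) _.
  by rewrite leq_add2r leq_add2l tx leq_maxl.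
have aXA : all (J a) [:: x; a] by rewrite /= ax (joined_refl I).
have cE : lset (r x a) = cores s [:: x; a].
  by rewrite (path_cores I) // !cores_cons /cores big_nil setU0.
have inB j w : J b w -> 0 < j -> let Z := lset (r x a) :|: lset (take j (r b w)) in
   ell * #|Z| + radius s x <= 2 * mu * psum Z + maxn (t a) (t b) + ell.
  move=> bw j0; have sB : lset (take j (r b w)) \subset cluster s b.
    by rewrite take_sub // path_sub // (joined_refl I).
  have sA := cores_sub aXA.
  rewrite cE /= (cardU m sA sB) (sumU m sA sB).
  have := prefix_cost I bw j0; have := cores_cost I aXA isT.
  rewrite !big_cons big_nil /= !mulnDr => hA hB; exact: (merge_arith_2 tg hA hB).
rewrite /join; case: (boolP (J a z)) hz => [az _|_ /= bz]; last first.
  rewrite bz; have [[j j0 ->]|[j j0 ->]] := lset_take_catd (r x a) (r b z) i0; last exact: inB.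
  by apply: inA; rewrite ?(joined_refl I).
case: ifP => lt; first exact: inA.
have [[j j0 ->]|[j j0 ->]] := lset_take_catd (catd (r x a) (r b b)) (r x z) i0.
  have [[j' j0' ->]|[j' j0' ->]] := lset_take_catd (r x a) (r b b) j0.
    by apply: inA; rewrite ?(joined_refl I).
  by apply: inB; rewrite ?(joined_refl I).
have xz : J x z by rewrite -(joined_eq _ ax).
(* The walk has returned from [b], so the part in the first cluster is the union of the cores of [x]
   and [a] with a prefix. *)
have aXx : all (J x) [:: x; a] by rewrite /= (joined_refl I) xa.
rewrite lset_catd cE setUAC /=; set Z1 := _ :|: lset (take _ _).
have sZ1 : Z1 \subset cluster s a by rewrite subUset cores_sub // take_sub // path_sub.
have aB : all (J b) [:: b] by rewrite /= (joined_refl I).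
have cB : lset (r b b) = cores s [:: b] by rewrite cores_cons /cores big_nil setU0.
have sB := cores_sub aB; rewrite cB (cardU m sZ1 sB) (sumU m sZ1 sB).
have := prefix_cores_cost I j aXx (mem_head _ _) xz; have := cores_cost I aB isT.
rewrite tx -/Z1 !big_cons !big_nil /= !mulnDr => hB hA.
by apply: (merge_arith_3 tg hA hB); rewrite leqNgt lt.
Qed.


Lemma joined_merge a b x z : mergeable a b ->
  joined (walk (moat_merge s a b)) x z =
  if J a x || J b x then J a z || J b z else J x z.
Proof.
move=> m; rewrite {1}/joined /=; case: (boolP (J a x)) => [ax|nax] /=.
  by rewrite mroute_l // joined_join.
case: (boolP (J b x)) => bx; last by rewrite /mroute (negbTE nax) (negbTE bx).
by rewrite mroute_r // joined_join // 1?orbC //; apply: mergeable_sym.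
Qed.

Lemma path_merge_out a b x z : ~~ (J a x || J b x) -> mroute t r a b x z = r x z.
Proof. by rewrite /mroute negb_or => /andP[/negbTE -> /negbTE ->]. Qed.

Lemma moat_merge_inv a b : mergeable a b -> moat_inv now (moat_merge s a b).
Proof.
move=> m; have m' := mergeable_sym m; set s' := moat_merge s a b.
pose M x := J a x || J b x.
have JE x z : joined (walk s') x z = if M x then M z else J x z by apply: joined_merge.
have Mout x z : ~~ M x -> J x z -> ~~ M z.
  rewrite /M !negb_or => /andP[h1 h2] xz; apply/andP; split.
    by apply: contra h1 => az; apply: (joined_trans I az); rewrite (joined_sym I).
  by apply: contra h2 => az; apply: (joined_trans I az); rewrite (joined_sym I).
have Msym x z : ~~ M x -> M z -> ~~ J x z by move=> h; apply: contraTN => /(Mout _ _ h).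
have PO x z : ~~ M x -> walk s' x z = r x z by move=> h; apply: path_merge_out.
have CO x : ~~ M x -> core s' x = core s x by move=> h; rewrite /core PO.
have COs X x : ~~ M x -> all (J x) X -> cores s' X = cores s X.
  move=> h aX; apply/setP => v; rewrite !in_cores; apply: eq_in_has => y yX.
  by rewrite CO //; apply: (Mout x) => //; apply: (allP aX).
have PA x z : J a x -> walk s' x z = JI a b x z by apply: mroute_l.
have PB x z : J b x -> walk s' x z = JI b a x z by apply: mroute_r.
have AO x : ~~ M x -> age s' x = t x by rewrite /M /= => /negbTE ->.
have LO x : ~~ M x -> left_over s' x = left_over s x by rewrite /M /= => /negbTE ->.
have AI x : M x -> age s' x = maxn (t a) (t b) by rewrite /M /= => ->.
have LI x : M x -> left_over s' x = minn (left_over s a + left_over s b) cap.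
  by rewrite /M /= => ->.
have aM X x : all (joined (walk s') x) X -> M x -> all M X.
  by move=> aX mx; apply: sub_all aX => y; rewrite JE mx.
have aO X x : all (joined (walk s') x) X -> ~~ M x -> all (J x) X.
  by move=> aX /negbTE mx; apply: sub_all aX => y; rewrite JE mx.
split=> [x|x z|x y z|x z|x z|x z|x z|x|x z|x z|x|x|x|X x aX X0|X x z i aX xX|x z i].
- by rewrite JE; case: ifP => // _; apply: (joined_refl I).
- rewrite !JE; case: (boolP (M x)) => mx; case: (boolP (M z)) => mz //.
  + by rewrite (negbTE (Msym _ _ mz mx)).
  + by rewrite (negbTE (Msym _ _ mx mz)).
  + exact: (joined_sym I).
- rewrite !JE; case: (boolP (M x)) => mx; case: (boolP (M y)) => my //.
  + by move=> xy; rewrite (negbTE (Msym _ _ mx my)) in xy.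
  + exact: (joined_trans I).
- rewrite JE; case: (boolP (M x)) => mx; last first.
    by move=> xz; rewrite PO // !CO //; [apply: (path_cores I)|apply: Mout xz].
  move=> mz; rewrite /s' !core_merge // -/s'; move: mx; rewrite /M.
  case: (boolP (J a x)) => [ax _|nax bx]; last rewrite orFb in bx.
    rewrite PA // lset_join //; case: ifP => // naz.
    rewrite /mcore; case: ifP => h1; case: ifP => h2; rewrite ?[_ :|: core s a :|: core s b]setUAC;
    try (by exfalso; move: h1 h2; clear; lia);
    by move: (core s x) (core s a) (core s b) (core s z) => c1 c2 c3 c4;
       apply/setP => v; rewrite !inE; do !case: (_ \in _).
  rewrite PB // lset_join // 1?orbC //; case: (boolP (J b z)) => bz.
    by rewrite (merge_excl m' bz).
  rewrite /M (negbTE bz) orbF in mz; rewrite mz.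
  rewrite /mcore; case: ifP => h1; case: ifP => h2;
  try (by exfalso; move: h1 h2; clear; lia);
  by move: (core s x) (core s a) (core s b) (core s z) => c1 c2 c3 c4;
     apply/setP => v; rewrite !inE; do !case: (_ \in _).
- case: (boolP (M x)) => mx; last by rewrite PO //; apply: (path_uniq I).
  case: (boolP (J a x)) => ax; first by rewrite PA //; apply: join_uniq.
  by rewrite /M (negbTE ax) /= in mx; rewrite PB //; apply: join_uniq.
- rewrite JE; case: (boolP (M x)) => mx; last by rewrite PO //; apply: (path_head I).
  move=> mz; case: (boolP (J a x)) => ax; first by rewrite PA //; apply: join_head.
  by rewrite /M (negbTE ax) /= in mx; rewrite PB //; apply: join_head => //; rewrite orbC.
- case: (boolP (M x)) => mx; last by rewrite PO //; apply: (path_chain I).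
  case: (boolP (J a x)) => ax; first by rewrite PA //; apply: join_chain.
  by rewrite /M (negbTE ax) /= in mx; rewrite PB //; apply: join_chain.
- case: (boolP (M x)) => mx; last first.
    rewrite CO //; apply/subsetP => v /(subsetP (core_cluster I x)).
    by rewrite !inE JE (negbTE mx).
  have sub c y : M c -> J c y \/ M y -> M y.
    move=> mc [cy|//]; apply: contraTT mc => my; apply: (Mout y) => //.
    by rewrite (joined_sym I).
  have subc y v : M y -> v \in core s y -> M v.
    by move=> my /(subsetP (core_cluster I y)); rewrite inE => h; apply: (sub y) => //; left.
  have Ma : M a by rewrite /M (joined_refl I).
  have Mb : M b by rewrite /M (joined_refl I) orbT.
  apply/subsetP => v; rewrite core_merge // inE JE mx /mcore.
  by case: ifP => _; case: ifP => _; rewrite ?in_setU; do ?case/orP; move/subc; apply.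
- rewrite JE; case: (boolP (M x)) => mx; first by move=> mz; rewrite !AI.
  by move=> xz; rewrite !AO ?(age_joined I xz) //; apply: Mout xz.
- rewrite JE; case: (boolP (M x)) => mx; first by move=> mz; rewrite !LI.
  by move=> xz; rewrite !LO ?(left_joined I xz) //; apply: Mout xz.
- case: (boolP (M x)) => mx; last by rewrite AO //; apply: (age_now I).
  by rewrite AI // geq_max !(age_now I).
- case: (boolP (M x)) => mx; last by rewrite AO // LO //; apply: (left_now I).
  rewrite AI // LI // => h.
  have {h}: (0 < left_over s a) || (0 < left_over s b) by move: h; clear; lia.
  by case/orP => /(left_now I) ->; [apply/maxn_idPl|apply/maxn_idPr]; apply: (age_now I).
- case: (boolP (M x)) => mx; last first.
    have [y xy h] := eldest I x; exists y; rewrite ?JE ?(negbTE mx) // AO //.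
    exact: Mout xy.
  case: (leqP (t b) (t a)) => lt.
    have [y ay h] := eldest I a; exists y; first by rewrite JE mx /M ay.
    by rewrite AI ?/M ?ay //= h -(age_joined I ay); apply/esym/maxn_idPl.
  have [y ay h] := eldest I b; exists y; first by rewrite JE mx /M ay orbT.
  by rewrite AI ?/M ?ay ?orbT //= h -(age_joined I ay); apply/esym/maxn_idPr/ltnW.
- case: (boolP (M x)) => mx; last first.
    rewrite (COs X x) ?LO ?AO //; last exact: aO aX _.
    exact: (cores_cost I (aO _ _ aX mx)).
  have aX' := aM _ _ aX mx.
  rewrite /s' cores_merge // -/s' LI // AI //; apply: mcores_cost => //; exact: geq_minl.
- rewrite JE; case: (boolP (M x)) => mx; last first.
    move=> xz; rewrite (COs X x) ?AO ?PO //; last exact: aO aX _.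
    exact: (prefix_cores_cost I _ (aO _ _ aX mx)).
  have aX' := aM _ _ aX mx; have X0 : X != [::] by case: (X) xX.
  move=> mz; rewrite /s' cores_merge // -/s' AI //.
  case: (boolP (J a x)) => ax; first by rewrite PA //; apply: mcores_prefix_cost.
  rewrite /M (negbTE ax) /= in mx; rewrite PB // mcoresC maxnC.
  apply: mcores_prefix_cost => //; last by rewrite orbC.
  by apply: sub_all aX' => y; rewrite /M orbC.
- rewrite JE; case: (boolP (M x)) => mx; last first.
    by move=> xz i0; rewrite AO ?PO //; apply: (prefix_cost I).
  move=> mz i0; rewrite AI //.
  case: (boolP (J a x)) => ax; first by rewrite PA //; apply: join_prefix_cost.
  rewrite /M (negbTE ax) /= in mx; rewrite PB // maxnC.
  by apply: join_prefix_cost => //; rewrite orbC.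
Qed.

End Merge.

End Moat.

(** * Moat growing: lower bound *)

Lemma sum_seq_lt (T : eqType) (l : seq T) (f g : T -> nat) e :
  (forall x, x \in l -> f x <= g x) -> e \in l -> f e < g e ->
  \sum_(x <- l) f x < \sum_(x <- l) g x.
Proof.
elim: l => // y l IH le; rewrite inE !big_cons => /orP[/eqP <- lt|el lt].
  rewrite -addSn leq_add // big_seq [X in _ <= X]big_seq leq_sum // => x xl.
  by apply: le; rewrite inE xl orbT.
rewrite -addnS leq_add ?le ?mem_head // IH // => x xl.
by apply: le; rewrite inE xl orbT.
Qed.

Lemma sum_seq_le (T : eqType) (l : seq T) (f g : T -> nat) :
  (forall x, x \in l -> f x <= g x) -> \sum_(x <- l) f x <= \sum_(x <- l) g x.
Proof. by move=> le; rewrite big_seq [X in _ <= X]big_seq leq_sum. Qed.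

Section Lower.
Variables (V : finType) (adj : rel V) (p : V -> nat) (mu ell cap : nat).
Hypotheses (adj_sym : symmetric adj) (capP : mu * \sum_v p v <= cap).
Variables (W : {set V}) (E : seq (V * V)).
Hypothesis adjE : all (fun e => adj e.1 e.2) E.
Hypothesis crossE : forall C : {set V}, (exists2 u, u \in W & u \in C) ->
  (exists2 u, u \in W & u \notin C) -> has (fun e => (e.1 \in C) != (e.2 \in C)) E.
Local Notation moat := (moat V).
Local Notation moat_inv := (moat_inv adj p mu ell).
Local Notation moat_merge := (moat_merge cap).
Implicit Types (s : moat) (sg : V * V -> nat * nat).

Definition charge sg (C : {set V}) :=
  \sum_(e <- E) ((if e.1 \in C then (sg e).1 else 0) + (if e.2 \in C then (sg e).2 else 0)).

(* [sg e] records how much of each end of the edge [e] had been covered by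
   moats when its two ends came into one cluster. *)
Definition apart s := exists sg,
  [/\ forall e, e \in E -> ~~ joined (walk s) e.1 e.2 -> sg e = (radius s e.1, radius s e.2),
      forall e, e \in E -> (sg e).1 + (sg e).2 <= ell.+1,
      forall x, mu * psum p (cluster s x :&: W) <= left_over s x + charge sg (cluster s x),
      forall x, mu * psum p ((cluster s x :&: W) :\: core s x) <= charge sg (cluster s x) &
      forall x, ~~ (W \subset cluster s x)].

(** Equality of radius and age makes these terms cancel in [prefix_cost]. The second part says that
    only as much potential of W was pruned as the edges of W can pay for. *)
Definition caught s := exists x,
  radius s x = age s x /\ mu * psum p (W :\: core s x) <= size E * ell.+1.

Lemma charge_total sg C : (forall e, e \in E -> (sg e).1 + (sg e).2 <= ell.+1) ->
  charge sg C <= size E * ell.+1.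
Proof.
move=> h; rewrite -sum1_size big_distrl /=; apply: sum_seq_le => e /h he.
by rewrite mul1n; case: ifP => _; case: ifP => _; lia.
Qed.

Lemma psum_le (Z1 Z2 : {set V}) : Z1 \subset Z2 -> psum p Z1 <= psum p Z2.
Proof.
move=> sub; rewrite /psum [X in _ <= X](big_setID Z1) /= (setIidPr sub).
by rewrite leq_addr.
Qed.

Lemma psum_setU_le (Z1 Z2 : {set V}) : psum p (Z1 :|: Z2) <= psum p Z1 + psum p Z2.
Proof.
have -> : Z1 :|: Z2 = Z1 :|: (Z2 :\: Z1).
  by apply/setP => v; rewrite !inE; case: (v \in Z1).
rewrite psumU; last by rewrite disjoints_subset; apply/subsetP => v; rewrite !inE => ->.
by rewrite leq_add2l psum_le // subsetDl.
Qed.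

Lemma mem_core now s x : moat_inv now s -> x \in core s x.
Proof.
move=> I; have [q e] := path_head I (joined_refl I x).
by rewrite /core inE e mem_head.
Qed.

Lemma left_over_le now s x : moat_inv now s ->
  left_over s x + age s x <= 2 * mu * psum p (core s x) /\
  left_over s x <= mu * psum p (core s x).
Proof.
move=> I; have ax : all (joined (walk s) x) [:: x] by rewrite /= (joined_refl I).
have := cores_cost I ax isT; rewrite cores_cons /cores big_nil setU0 big_seq1 /=.
have : 0 < #|core s x| by apply/card_gt0P; exists x; apply: mem_core I.
move: #|_| (psum p _) (radius _ _) (left_over _ _) (age _ _) => c q d l a; nia.
Qed.

Lemma psumT_le (Z : {set V}) : mu * psum p Z <= cap.
Proof.
apply: leq_trans capP; rewrite leq_mul2l; apply/orP; right.
rewrite /psum; apply: leq_trans (_ : \sum_(v in setT) p v <= _).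
  exact/psum_le/subsetT.
by rewrite big_mkcond leq_sum // => v _; case: ifP.
Qed.

Lemma init_apart : apart (moat_init p mu) \/ caught (moat_init p mu).
Proof.
have J x z : joined (walk (moat_init p mu)) x z = (x == z).
  by rewrite /joined /=; case: eqP.
have C x : cluster (moat_init p mu) x = [set x].
  by apply/setP => v; rewrite !inE J eq_sym.
have K x : core (moat_init p mu) x = [set x].
  by rewrite /core /= eqxx; apply/setP => v; rewrite !inE.
have [/existsP[x sub]|/existsPn h] := boolP [exists x, W \subset cluster (moat_init p mu) x].
  right; exists x; split=> //; rewrite K; move: sub; rewrite C -setD_eq0 => /eqP ->.
  by rewrite /psum big_set0 muln0.
left; exists (fun=> (0, 0)); split=> // x.
  rewrite C /=; apply: leq_trans (leq_addr _ _); rewrite leq_mul2l; apply/orP; right.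
  by apply: leq_trans (psum_le (subsetIl _ _)) _; rewrite /psum big_set1.
rewrite C K setDIl setDv set0I /psum big_set0 muln0 //.
Qed.

(** An active cluster that meets W without containing it is crossed by an edge of [E], and the end
    inside grows; the lost unit of potential is charged there. Both ends of an edge may grow at
    once, so a sum below [ell] can reach [ell.+1]. *)
Lemma grow_apart now s : moat_inv now s ->
  (forall u v, adj u v -> ~~ joined (walk s) u v -> radius s u + radius s v < ell) ->
  apart s -> apart (moat_grow s).
Proof.
move=> I tf [sg [h1 h2 h3 h4 h5]].
pose sg' e := if joined (walk s) e.1 e.2 then sg e
  else (radius (moat_grow s) e.1, radius (moat_grow s) e.2).
have le e : e \in E -> (sg e).1 <= (sg' e).1 /\ (sg e).2 <= (sg' e).2.
  move=> eE; rewrite /sg'; case: (boolP (joined _ _ _)) => // nj; rewrite h1 //=.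
  by split; case: ifP.
have lec C : charge sg C <= charge sg' C.
  by apply: sum_seq_le => e /le [? ?]; apply: leq_add; case: ifP.
exists sg'; split.
- by move=> e eE nj; rewrite /sg' (negbTE nj).
- move=> e eE; rewrite /sg'; case: (boolP (joined _ _ _)) => nj; first exact: h2.
  by have := tf _ _ (allP adjE e eE) nj; rewrite /=; do 2!case: ifP => _; lia.
- move=> x; change (cluster (moat_grow s) x) with (cluster s x) => /=.
  case: (posnP (left_over s x)) => [l0|lp].
    by have := h3 x; have := lec (cluster s x); rewrite l0; lia.
  have [->|[u]] := set_0Vmem (cluster s x :&: W).
    by rewrite /psum big_set0 muln0.
  rewrite inE => /andP[ux uW].
  have [v vW vx] : exists2 v, v \in W & v \notin cluster s x.
    by have /subsetPn := h5 x.
  have /hasP[e eE ne] := crossE (ex_intro2 _ _ u uW ux) (ex_intro2 _ _ v vW vx).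
  suff : charge sg (cluster s x) < charge sg' (cluster s x) by have := h3 x; lia.
  apply: (sum_seq_lt (e := e)) => // [f /le [? ?]|]; first by apply: leq_add; case: ifP.
  have nj : ~~ joined (walk s) e.1 e.2.
    apply: contra ne => j; rewrite !inE; apply/eqP; apply/idP/idP => h.
      exact: (joined_trans I h).
    by apply: (joined_trans I h); rewrite (joined_sym I).
  rewrite /sg' (negbTE nj) h1 //=; move: ne; rewrite !inE.
  have act w : joined (walk s) x w -> 0 < left_over s w by move/(left_joined I) => <-.
  case j1: (joined _ x e.1); case j2: (joined _ x e.2) => // _; by rewrite act.
- move=> x; apply: leq_trans (lec _); exact: (h4 x).
- exact: h5.
Qed.

(** A pruned side has no potential left, so all its part of W is charged to edges already; a side
    that is kept loses only what lies outside its core. *)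
Lemma merge_apart now s a b : moat_inv now s -> mergeable adj ell s a b ->
  apart s -> apart (moat_merge s a b) \/ caught (moat_merge s a b).
Proof.
move=> I m [sg [h1 h2 h3 h4 h5]]; set s' := moat_merge s a b.
have I' : moat_inv now s' by apply: moat_merge_inv.
pose M x := joined (walk s) a x || joined (walk s) b x.
have JE x z : joined (walk s') x z = if M x then M z else joined (walk s) x z.
  exact: (joined_merge cap I).
have CI x : M x -> cluster s' x = cluster s a :|: cluster s b.
  by move=> mx; apply/setP => v; rewrite !inE JE mx.
have CO x : ~~ M x -> cluster s' x = cluster s x.
  by move=> /negbTE mx; apply/setP => v; rewrite !inE JE mx.
have dis : [disjoint cluster s a & cluster s b] by apply: (clusters_disjoint I m).
have notab v : v \in cluster s a -> v \in cluster s b = false.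
  by move=> va; apply: (disjointFr dis).
have chU : charge sg (cluster s a :|: cluster s b) =
    charge sg (cluster s a) + charge sg (cluster s b).
  rewrite /charge -big_split /=; apply: eq_bigr => e _; rewrite !in_setU.
  case: (boolP (e.1 \in cluster s a)) => [/notab ->|_];
  case: (boolP (e.2 \in cluster s a)) => [/notab ->|_] /=; lia.
(* The potentials left are bounded by those of two disjoint cores, so the cap does not cut off
   anything. *)
have lab : left_over s a + left_over s b <= cap.
  have [_ la] := left_over_le a I; have [_ lb] := left_over_le b I.
  apply: leq_trans (leq_add la lb) _; rewrite -mulnDr -psumU ?psumT_le //.
  by apply: (clusters_disjoint I m); apply: core_cluster I _.
have w3 x : mu * psum p (cluster s' x :&: W) <= left_over s' x + charge sg (cluster s' x).
  case: (boolP (M x)) => mx; last by rewrite CO //= -/(M x) (negbTE mx).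
  rewrite CI // chU /= -/(M x) mx (minn_idPl lab) setIUl.
  apply: leq_trans (leq_mul (leqnn mu) (psum_setU_le _ _)) _.
  by rewrite mulnDr addnACA; apply: leq_add (h3 a) (h3 b).
have prune c d x : mergeable adj ell s c d -> joined (walk s) c x ->
    mu * psum p (((cluster s c :|: cluster s d) :&: W) :\: mcore s c d x)
    <= charge sg (cluster s c) + charge sg (cluster s d).
  move=> mcd cx; have Cx : cluster s x = cluster s c.
    by apply/setP => v; rewrite !inE (joined_eq I _ cx).
  have hx := h4 x; rewrite Cx in hx.
  have fin (D : {set V}) : ((cluster s c :|: cluster s d) :&: W) :\: mcore s c d x
      \subset ((cluster s c :&: W) :\: core s x) :|: D -> mu * psum p D <= charge sg (cluster s d) ->
      mu * psum p (((cluster s c :|: cluster s d) :&: W) :\: mcore s c d x)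
      <= charge sg (cluster s c) + charge sg (cluster s d).
    move=> sub hD; apply: leq_trans (leq_add hx hD).
    rewrite -mulnDr leq_mul2l; apply/orP; right.
    exact: leq_trans (psum_le sub) (psum_setU_le _ _).
  rewrite /mcore in fin *; case: ifP fin => lt fin.
    apply: (fin (cluster s d :&: W)).
      by apply/subsetP => v; rewrite !in_setD !in_setI !in_setU !in_setD !in_setI;
        do !case: (_ \in _).
    have ld : left_over s d = 0.
      apply/eqP; rewrite eqn0Ngt; apply/negP => /(left_now I) h.
      by have := age_now I c; rewrite -h leqNgt lt.
    by have := h3 d; rewrite ld.
  apply: (fin ((cluster s d :&: W) :\: core s d)); last exact: h4.
  by apply/subsetP => v; rewrite !in_setD !in_setI !in_setU !in_setD !in_setI;
    do !case: (_ \in _).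
have w4 x : mu * psum p ((cluster s' x :&: W) :\: core s' x) <= charge sg (cluster s' x).
  case: (boolP (M x)) => mx; last first.
    by rewrite CO // (_ : core s' x = core s x) // /core /= path_merge_out.
  rewrite CI // chU (core_merge cap I) //; case: (boolP (joined (walk s) a x)) => ax; first exact: prune.
  rewrite /M (negbTE ax) /= in mx; rewrite setUC addnC; apply: prune => //.
  exact: (mergeable_sym I).
have [/existsP[x sub]|/existsPn nx] := boolP [exists x, W \subset cluster s' x].
  (* The core depends on the root, but [w4] holds for all roots, so one whose radius equals the age
     can be taken. *)
  right; have [y xy ry] := eldest I' x; exists y; split=> //.
  have Cy : cluster s' y = cluster s' x by apply/setP => v; rewrite !inE (joined_eq I' _ xy).
  apply: leq_trans (charge_total (cluster s' y) h2); apply: leq_trans (w4 y).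
  by rewrite Cy (setIidPr sub).
left; exists sg; split=> // e eE; rewrite JE => nj; apply: h1 => //.
move: nj; case: (boolP (M e.1)) => // m1; apply: contra => j; rewrite /M in m1 *.
by case/orP: m1 => h; rewrite (joined_trans I h j) ?orbT.
Qed.

(** The potential of W is charged cluster by cluster, and each end of an edge belongs to one
    cluster, so each edge is counted at most once per end. *)
Lemma apart_dead now s : moat_inv now s -> apart s -> (forall x, left_over s x = 0) ->
  mu * psum p W <= size E * ell.+1.
Proof.
move=> I [sg [_ h2 h3 _ _]] l0.
pose rep x := odflt x [pick z | joined (walk s) x z].
have repP x : joined (walk s) x (rep x).
  by rewrite /rep; case: pickP => // h; apply: joined_refl I x.
have repE x z : joined (walk s) x z -> rep x = rep z.
  move=> xz; rewrite /rep; have -> : [pick w | joined (walk s) x w] = [pick w | joined (walk s) z w].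
    by apply: eq_pick => w; rewrite (joined_eq I _ xz).
  by case: pickP => // /(_ z); rewrite (joined_refl I).
have -> : psum p W = \sum_c \sum_(v in W | rep v == c) p v.
  by rewrite /psum (partition_big rep predT).
rewrite big_distrr /=.
apply: leq_trans (_ : \sum_c \sum_(e <- E) ((if rep e.1 == c then (sg e).1 else 0) +
     (if rep e.2 == c then (sg e).2 else 0)) <= _).
  apply: leq_sum => c _.
  have [v vc|none] := pickP [pred v | (v \in W) && (rep v == c)]; last first.
    by rewrite big_pred0 ?muln0 // => v; have := none v.
  have [vW /eqP rv] := andP vc.
  have inC u : (rep u == c) = (u \in cluster s v).
    rewrite inE -rv; apply/eqP/idP => [h|/repE //].
    by apply: (joined_trans I (repP v)); rewrite -h (joined_sym I).
  have := h3 v; rewrite l0 add0n /psum => h.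
  rewrite (eq_bigl (fun u => u \in cluster s v :&: W)); last first.
    by move=> u; rewrite inC !inE andbC.
  apply: leq_trans h _; apply: sum_seq_le => e _.
  by rewrite !inC.
rewrite exchange_big /= -sum1_size big_distrl /=; apply: sum_seq_le => e /h2 he.
rewrite mul1n; apply: leq_trans he; rewrite big_split /=.
have one w m : \sum_c (if rep w == c then m else 0) = m.
  by rewrite -big_mkcond /= (eq_bigl (fun c => c == rep w)) ?big_pred1_eq.
by rewrite !one.
Qed.

Definition moat_act s (i : bool * (V * V)) : moat :=
  if i.1 then
    if [&& adj i.2.1 i.2.2, nilp (walk s i.2.1 i.2.2) & ell <= radius s i.2.1 + radius s i.2.2]
    then moat_merge s i.2.1 i.2.2 else s
  else moat_grow s.

Lemma act_pair_mergeable s u v :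
  [&& adj u v, nilp (walk s u v) & ell <= radius s u + radius s v] ->
  mergeable adj ell s u v.
Proof.
by rewrite /mergeable /joined negbK => /and3P[h1 -> ->]; rewrite -(adj_sym u v) h1.
Qed.

Definition reached s0 (l : seq (bool * (V * V))) :=
  exists l1 l2 now, [/\ l = l1 ++ l2, moat_inv now (foldl moat_act s0 l1)
    & caught (foldl moat_act s0 l1)].

Lemma reached_catl s l1 l2 : reached s l1 -> reached s (l1 ++ l2).
Proof. by move=> [m1 [m2 [now [-> I c]]]]; exists m1, (m2 ++ l2), now; rewrite catA. Qed.

Lemma reached_catr s l1 l2 : reached (foldl moat_act s l1) l2 -> reached s (l1 ++ l2).
Proof.
move=> [m1 [m2 [now [-> I c]]]]; exists (l1 ++ m1), m2, now.
by rewrite catA foldl_cat.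
Qed.

(** One pass over the pairs suffices: it leaves the radii alone and only enlarges clusters, so an
    edge that was not tight when tested is not tight at the end either. *)
Lemma run_pairs now s (ps : seq (V * V)) : moat_inv now s -> apart s ->
  let s' := foldl moat_act s [seq (true, e) | e <- ps] in
  reached s [seq (true, e) | e <- ps] \/
  [/\ moat_inv now s', apart s', radius s' =1 radius s,
      (forall u v, joined (walk s) u v -> joined (walk s') u v) &
      (forall e, e \in ps -> adj e.1 e.2 -> ~~ joined (walk s') e.1 e.2 ->
         radius s e.1 + radius s e.2 < ell)].
Proof.
elim: ps s => [|e ps IH] s I A /=; first by right.
set s1 := moat_act s (true, e).
have [m|nm] := boolP [&& adj e.1 e.2, nilp (walk s e.1 e.2) & ell <= radius s e.1 + radius s e.2].
  have s1E : s1 = moat_merge s e.1 e.2 by rewrite /s1 /moat_act /= m.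
  have mm := act_pair_mergeable m.
  have I1 : moat_inv now s1 by rewrite s1E; apply: moat_merge_inv.
  have J1 u v : joined (walk s) u v -> joined (walk s1) u v.
    move=> j; rewrite s1E (joined_merge cap I) //; case: ifP => // /orP[] h.
      by rewrite (joined_trans I h j).
    by rewrite (joined_trans I h j) orbT.
  have [A1|c1] := merge_apart I mm A; last first.
    left; exists [:: (true, e)], [seq (true, e) | e <- ps], now; split=> //=.
    by rewrite -/s1 s1E.
  rewrite -s1E in A1; have [r1|[I2 A2 R2 J2 T2]] := IH s1 I1 A1.
    by left; apply: (@reached_catr _ [:: (true, e)]).
  right; split=> // [u|u v /J1/J2 //|f]; first by rewrite R2 s1E.
  rewrite inE => /orP[/eqP -> _|fps a nj]; last by have := T2 f fps a nj; rewrite s1E.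
  case/negP; apply: J2; rewrite s1E (joined_merge cap I) // (joined_refl I) /=.
  by rewrite (joined_refl I) orbT.
have s1E : s1 = s by rewrite /s1 /moat_act /= (negbTE nm).
rewrite s1E; have [r1|[I2 A2 R2 J2 T2]] := IH s I A.
  by left; apply: (@reached_catr _ [:: (true, e)]); rewrite /= -/s1 s1E.
right; split=> // f; rewrite inE => /orP[/eqP -> a nj|fps a nj]; last exact: T2.
move: nm; rewrite a /= negb_and -ltnNge => /orP[|//].
by rewrite -/(joined (walk s) e.1 e.2) => /J2 j; rewrite j in nj.
Qed.

Lemma run_rounds (g : bool * (V * V)) (ps : seq (V * V)) now s R :
  ~~ g.1 -> (forall u v, (u, v) \in ps) -> moat_inv now s -> apart s ->
  let l := flatten (nseq R ([seq (true, e) | e <- ps] ++ [:: g])) in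
  reached s l \/ moat_inv (now + R) (foldl moat_act s l) /\ apart (foldl moat_act s l).
Proof.
move=> g1 all_ps; elim: R now s => [|R IH] now s I A /=; first by right; rewrite addn0.
have [r1|[I2 A2 R2 J2 T2]] := run_pairs ps I A; first by left; do 2!apply: reached_catl.
rewrite -catA /= foldl_cat /=; set s2 := foldl _ _ _ in I2 A2 R2 J2 T2 *.
have -> : moat_act s2 g = moat_grow s2 by rewrite /moat_act (negbTE g1).
have I3 : moat_inv now.+1 (moat_grow s2) by apply: moat_grow_inv.
have A3 : apart (moat_grow s2).
  apply: (grow_apart I2) A2 => u v a nj; rewrite !R2.
  exact: (T2 (u, v)).
have [r3|[I4 A4]] := IH _ _ I3 A3; last by right; rewrite addnS -addSn.
left; rewrite -cat1s; apply: reached_catr; rewrite -/s2; apply: reached_catr => /=.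
by have -> : moat_act s2 g = moat_grow s2 by rewrite /moat_act (negbTE g1).
Qed.

Lemma moat_run (g : bool * (V * V)) (ps : seq (V * V)) R :
  ~~ g.1 -> (forall u v, (u, v) \in ps) -> 2 * cap < R ->
  let l := flatten (nseq R ([seq (true, e) | e <- ps] ++ [:: g])) in
  reached (moat_init p mu) l \/ mu * psum p W <= size E * ell.+1.
Proof.
move=> g1 all_ps hR l; have I0 := moat_init_inv adj p mu ell.
have [A0|c0] := init_apart; last by left; exists [::], l, 0.
have [r|[I A]] := run_rounds R g1 all_ps I0 A0; [by left|right].
(* A cluster still active after [R] rounds would have age [R], more than [2 * cap], against
   [left_over_le]. *)
apply: (apart_dead I A) => x; apply/eqP; rewrite eqn0Ngt; apply/negP => lx.
have := left_now I lx; have [+ _] := left_over_le x I.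
have := psumT_le (core (foldl moat_act (moat_init p mu) l) x).
rewrite -/l; move: (age _ x) (left_over _ x) => a b; rewrite add0n -mulnA; lia.
Qed.

End Lower.

(** * From the program to the moats *)

Fixpoint bits_value (s : seq bool) : nat := if s is b :: r then b + 2 * bits_value r else 0.

Lemma bits_value_mkseq k L : k < 2 ^ L -> bits_value (mkseq (fun i => odd (k %/ 2 ^ i)) L) = k.
Proof.
elim: L k => [|L IH] k hk; first by case: k hk.
have -> : mkseq (fun i => odd (k %/ 2 ^ i)) L.+1 =
    odd k :: mkseq (fun i => odd (k./2 %/ 2 ^ i)) L.
  rewrite /mkseq /= divn1 -(addn0 1) iotaDl -map_comp; congr (_ :: _).
  by apply: eq_map => i; rewrite /= expnD expn1 divnMA divn2.
rewrite /= IH; first by rewrite mul2n odd_double_half.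
by rewrite expnS in hk; lia.
Qed.

(** The binary budget may be exponential in the input size and has no short unary form, so the
    program truncates after every addition; truncation commutes with sums. *)
Lemma cappedE n k : 0 < k -> capped n (binary k) = minn k n.
Proof.
move=> k0; rewrite /capped.
have gen bits w a : (foldl (fun wa (b : bool) =>
    (minn n (wa.1 + wa.1), if b then minn n (wa.2 + wa.1) else wa.2)) (minn n w, minn n a) bits).2
    = minn n (a + w * bits_value bits).
  elim: bits w a => [|b r IH] w a /=; first by rewrite muln0 addn0.
  have -> : minn n (minn n w + minn n w) = minn n (2 * w) by lia.
  case: b; last by rewrite IH; congr minn; nia.
  have -> : minn n (minn n a + minn n w) = minn n (a + w) by lia.
  by rewrite IH; congr minn; nia.
have := gen (binary k) 1 0; rewrite minn0 add0n mul1n bits_value_mkseq.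
  by move=> ->; rewrite minnC.
by apply: trunc_log_ltn.
Qed.

Section Graph.
Variable G : graph.
Local Notation n := (nv G).
Local Notation V := 'I_(nv G).
Definition adj_matrix : bmatrix :=
  [seq [seq adj u v | v <- enum 'I_(nv G)] | u <- enum 'I_(nv G)].
Local Notation M := adj_matrix.
Local Notation vals := (map (@nat_of_ord (nv G))).

Lemma size_adj_matrix : size M = n.
Proof. by rewrite size_map size_enum_ord. Qed.

Lemma adjmE (u v : V) : adjm M u v = adj u v.
Proof.
rewrite /adjm (nth_map u) ?size_enum_ord // (nth_map v) ?size_enum_ord //.
by rewrite !nth_ord_enum.
Qed.

Lemma iota_vals : iota 0 n = vals (enum V).
Proof. by rewrite val_enum_ord. Qed.

Definition nset (l : seq nat) : {set V} := [set u : V | (u : nat) \in l].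

Lemma size_filter_iota (P : pred nat) : size [seq u <- iota 0 n | P u] = #|[set u : V | P u]|.
Proof.
rewrite iota_vals filter_map size_map size_filter -sum1_card -sum1_count.
by rewrite [LHS]big_enum_cond /=; apply: eq_bigl => u; rewrite !inE.
Qed.

Lemma coverageE (l : seq V) : coverage M (vals l) = #|cl_nbhd_set (lset l)|.
Proof.
rewrite /coverage size_adj_matrix size_filter_iota; apply: eq_card => u; rewrite !inE.
rewrite /nilp size_filter -lt0n -has_count has_map.
apply/hasP/bigcupP => [[v vl /=]|[v]].
  by rewrite adjmE => h; exists v; rewrite inE.
by rewrite !inE => vl h; exists v; rewrite //= adjmE.
Qed.

Lemma vals_catd (l1 l2 : seq V) : catd (vals l1) (vals l2) = vals (catd l1 l2).
Proof.
rewrite /catd map_cat filter_map; congr (_ ++ map _ _); apply: eq_filter => x.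
by rewrite /= mem_map //; apply: val_inj.
Qed.

Definition represents (c : mstate) (s : moat V) :=
  [/\ forall v : V, dist c v = radius s v, forall v : V, time c v = age s v,
      forall v : V, slack c v = left_over s v &
      forall x z : V, route c x z = vals (walk s x z)].

Lemma joined_represents c s (a x : V) : represents c s -> joined (route c) a x = joined (walk s) a x.
Proof. by case=> _ _ _ h; rewrite /joined h /nilp size_map. Qed.

Lemma join_represents c s (a b x z : V) : represents c s ->
  join (time c) (route c) a b x z = vals (join (age s) (walk s) a b x z).
Proof.
move=> rp; have [_ ht _ hr] := rp; rewrite /join !(joined_represents _ _ rp) !ht !hr !vals_catd.
by do !case: ifP => _.
Qed.

Lemma merge_represents c s cap (a b : V) : represents c s ->
  represents (merge n cap c a b) (moat_merge cap s a b).
Proof.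
move=> rp; have [hd ht hl hr] := rp; split=> [v|v|v|x z].
- exact: hd.
- by rewrite /time /= nth_mkseq // !(joined_represents _ _ rp) !ht.
- by rewrite /slack /= nth_mkseq // !(joined_represents _ _ rp) !hl.
- rewrite /route /= nth_mkseq // nth_mkseq // /mroute !(joined_represents _ _ rp).
  by rewrite !(join_represents _ _ _ _ rp) hr; do !case: ifP => _.
Qed.

Lemma grow_represents c s : represents c s -> represents (grow n c) (moat_grow s).
Proof.
case=> hd ht hl hr; split=> [v|v|v|//].
- by rewrite /dist /= nth_mkseq // hl hd.
- by rewrite /time /= nth_mkseq // hl ht.
- by rewrite /slack /= nth_mkseq // hl.
Qed.

Definition vinstr (i : bool * (V * V)) : bool * (nat * nat) :=
  (i.1, (i.2.1 : nat, i.2.2 : nat)).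

Lemma act_represents c s ell cap i : represents c s ->
  represents (act M ell cap c (vinstr i)) (moat_act (@adj G) ell cap s i).
Proof.
move=> rp; have [hd _ _ hr] := rp; rewrite /act /moat_act /= size_adj_matrix.
case: ifP => _; last exact: grow_represents.
rewrite /tight adjmE hr !hd /nilp size_map.
by case: ifP => _ //; apply: merge_represents.
Qed.

Lemma init_represents mu (p : seq nat) :
  represents (init n mu p) (moat_init (fun v : V => nth 0 p v) mu).
Proof.
split=> [v|v|v|x z]; rewrite /dist /time /slack /route /= ?nth_mkseq //.
by rewrite -[(x : nat) == z]/(x == z); case: ifP.
Qed.

Definition all_pairs : seq (V * V) := flatten [seq [seq (u, v) | v <- enum V] | u <- enum V].

Lemma mem_all_pairs (u v : V) : (u, v) \in all_pairs.
Proof.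
apply/flattenP; exists [seq (u, v) | v <- enum V]; last by apply: map_f; rewrite mem_enum.
by apply/mapP; exists u; rewrite ?mem_enum.
Qed.

(** Growth instructions carry the dummy pair [(0, 0)]; on the side of the graph it has to be a
    vertex, namely [x0]. *)
Lemma schedule_vinstr (x0 : V) R : nat_of_ord x0 = 0 ->
  schedule n R =
  map vinstr (flatten (nseq R ([seq (true, e) | e <- all_pairs] ++ [:: (false, (x0, x0))]))).
Proof.
move=> h0; rewrite /schedule map_flatten map_nseq.
have -> : map vinstr ([seq (true, e) | e <- all_pairs] ++ [:: (false, (x0, x0))]) = round n.
  rewrite /round map_cat /= /vinstr /= h0; congr (_ ++ _).
  rewrite -map_comp /all_pairs map_flatten iota_vals -!map_comp; congr flatten.
  apply: eq_map => u /=; rewrite -!map_comp; exact: eq_map.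
by rewrite -[R in RHS](size_iota 0); elim: (iota 0 R) => //= i r ->.
Qed.


(** * The threshold scan *)

Lemma freshE cov (v : V) :
  size (fresh M cov v) = #|cl_nbhd v :\: nset cov| /\
  nset (fresh M cov v) = cl_nbhd v :\: nset cov.
Proof.
rewrite /fresh /nbrs size_adj_matrix -filter_predI; split.
  rewrite size_filter_iota; apply: eq_card => u; rewrite !inE /= adjmE.
  by rewrite -[(u : nat) == v]/(u == v).
apply/setP => u; rewrite !inE mem_filter /= adjmE mem_iota leq0n add0n ltn_ord !andbT.
by rewrite -[(u : nat) == v]/(u == v).
Qed.

Lemma sum_at (P : pred V) (v : V) m : \sum_(u | P u) (if u == v then m else 0) = if P v then m else 0.
Proof.
case: (boolP (P v)) => Pv; last first.
  by apply: big1 => u Pu; case: eqP => // uv; rewrite uv (negbTE Pv) in Pu.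
by rewrite (bigD1 v) //= eqxx big1 ?addn0 // => u /andP[_ /negbTE ->].
Qed.

(** In [prof_charge] a covered vertex of [U] is charged to the vertex that first covered it, whose
    neighbourhood then meets [U]. *)
Record profits_inv tau i (s : seq nat * seq nat) : Prop := ProfitsInv {
  prof_size : size s.2 = i;
  prof_cover (Z : {set V}) : \sum_(v in Z) nth 0 s.2 v <= #|cl_nbhd_set Z :&: nset s.1|;
  prof_charge (U : {set V}) :
    #|U :&: nset s.1| <= \sum_(v | ~~ [disjoint cl_nbhd v & U]) nth 0 s.2 v;
  prof_rest (v : V) : v < i -> #|cl_nbhd v :\: nset s.1| < tau;
  prof_large (v : V) : nth 0 s.2 v = 0 \/ tau <= nth 0 s.2 v }.

Lemma select_inv tau (v : V) s : 0 < tau -> profits_inv tau v s ->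
  profits_inv tau v.+1 (select M tau v s).
Proof.
move=> t0 [h1 h2 h3 h4 h5].
have [szF setF] := freshE s.1 v; set F := cl_nbhd v :\: nset s.1 in szF setF.
have pE m (u : V) : nth 0 (s.2 ++ [:: m]) u = nth 0 s.2 u + (if u == v then m else 0).
  rewrite nth_cat h1; case: ltnP => uv.
    by rewrite [u == v]negbTE ?addn0 // -val_eqE /= neq_ltn uv.
  rewrite [nth 0 s.2 u]nth_default ?h1 // add0n -val_eqE /=.
  case: eqP => [->|ne]; first by rewrite subnn.
  by rewrite nth_default //= subn_gt0 ltn_neqAle uv andbT eq_sym; apply/eqP.
have p0 : nth 0 s.2 v = 0 by rewrite nth_default ?h1.
have sumE (P : pred V) m : \sum_(u | P u) nth 0 (s.2 ++ [:: m]) u =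
    \sum_(u | P u) nth 0 s.2 u + (if P v then m else 0).
  by rewrite -sum_at -big_split /=; apply: eq_bigr => u _; rewrite pE.
rewrite /select szF; case: leqP => hF /=; split=> /=; rewrite ?size_cat /= ?h1 ?addn1 //.
- move=> Z; rewrite sumE; have -> : nset (s.1 ++ fresh M s.1 v) = nset s.1 :|: F.
    by rewrite -setF; apply/setP => u; rewrite !inE mem_cat.
  rewrite setIUr; case: ifP => vZ; last first.
    by rewrite addn0; apply: leq_trans (h2 Z) _; apply/subset_leq_card/subsetUl.
  have FZ : F \subset cl_nbhd_set Z.
    by apply/subsetP => u; rewrite in_setD => /andP[_ uv]; apply/bigcupP; exists v.
  rewrite (setIidPr FZ) cardsU_disjoint ?leq_add2r //.
  by rewrite disjoint_sym disjoints_subset; apply/subsetP => u; rewrite !inE negb_and => /andP[->]; rewrite orbT.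
- move=> U; rewrite sumE; have -> : nset (s.1 ++ fresh M s.1 v) = nset s.1 :|: F.
    by rewrite -setF; apply/setP => u; rewrite !inE mem_cat.
  rewrite setIUr; apply: leq_trans (leq_card_setU _ _) _; apply: leq_add => //.
  case: ifP => dv; first by apply/subset_leq_card/subsetIr.
  rewrite leqn0 cards_eq0 -subset0; apply/subsetP => u; rewrite in_setI => /andP[uU].
  rewrite in_setD => /andP[_ uv]; move/negbFE: dv => /disjointFr /(_ uv).
  by rewrite uU.
- move=> u; have -> : nset (s.1 ++ fresh M s.1 v) = nset s.1 :|: F.
    by rewrite -setF; apply/setP => w; rewrite !inE mem_cat.
  rewrite ltnS leq_eqVlt => /orP[/eqP uv|/h4 h]; last first.
    by apply: leq_ltn_trans h; apply: subset_leq_card; apply: setDS; apply: subsetUl.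
  have -> : u = v by apply: val_inj.
  by rewrite -setDDl -/F setDv cards0.
- move=> u; rewrite pE; case: eqP => [->|_]; last by rewrite addn0.
  by right; rewrite p0 add0n.
- by move=> Z; rewrite sumE if_same addn0.
- by move=> U; rewrite sumE if_same addn0.
- move=> u; rewrite ltnS leq_eqVlt => /orP[/eqP uv|/h4 //].
  by have -> : u = v by apply: val_inj.
- by move=> u; rewrite pE if_same addn0.
Qed.

Lemma profits_spec tau : 0 < tau -> exists cov : {set V},
  let p (v : V) := nth 0 (profits M tau) v in
  [/\ forall Z : {set V}, \sum_(v in Z) p v <= #|cl_nbhd_set Z|,
      forall U : {set V}, #|U :&: cov| <= \sum_(v | ~~ [disjoint cl_nbhd v & U]) p v,
      forall v, #|cl_nbhd v :\: cov| < tau & forall v, p v = 0 \/ tau <= p v].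
Proof.
move=> t0; pose st i := foldl (fun s v => select M tau v s) ([::], [::]) (iota 0 i).
have H i : i <= n -> profits_inv tau i (st i).
  elim: i => [|i IH] hi.
    split=> //=; rewrite /nset.
    - by move=> Z; rewrite big1 // => v _; rewrite nth_nil.
    - move=> U; have -> : [set u : V | (u : nat) \in [::]] = set0 by apply/setP => u; rewrite !inE.
      by rewrite setI0 cards0.
    - by move=> v; left; rewrite nth_nil.
  have -> : st i.+1 = select M tau i (st i) by rewrite /st -addn1 iotaD foldl_cat.
  exact: (select_inv (v := Ordinal hi) t0 (IH (ltnW hi))).
have [_ h2 h3 h4 h5] := H n (leqnn _).
exists (nset (st n).1) => p; rewrite /p /profits size_adj_matrix -/(st n); split=> //.
- by move=> Z; apply: leq_trans (h2 Z) _; apply/subset_leq_card/subsetIl.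
- by move=> v; apply: h4.
Qed.

Section Runs.
Variables (k : nat) (x0 : V).
Hypotheses (k0 : 0 < k) (x00 : nat_of_ord x0 = 0).

Definition legal (b : seq nat) := exists2 l : seq V, b = vals l &
  [&& l != [::], chain (@adj G) l & size l <= k].

Lemma betterP (c b : seq nat) :
  coverage M c <= coverage M (better M c b) /\ coverage M b <= coverage M (better M c b).
Proof. by rewrite /better; case: ifP; lia. Qed.

Lemma update_bestP c b : coverage M b <= coverage M (update_best M k c b) /\
  forall x : V, coverage M (take k (route c x x)) <= coverage M (update_best M k c b).
Proof.
rewrite /update_best size_adj_matrix.
have gen r b' : coverage M b' <= coverage M (foldl (fun b x => better M (take k (route c x x)) b) b' r) /\
    forall y, y \in r -> coverage M (take k (route c y y)) <=
      coverage M (foldl (fun b x => better M (take k (route c x x)) b) b' r).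
  elim: r b' => [|y r IH] b' //=.
  have [h1 h2] := IH (better M (take k (route c y y)) b').
  have [h3 h4] := betterP (take k (route c y y)) b'.
  split=> [|w]; first exact: leq_trans h4 h1.
  by rewrite inE => /orP[/eqP ->|/h2 //]; apply: leq_trans h3 h1.
have [h1 h2] := gen (iota 0 n) b; split=> // x; apply: h2.
by rewrite mem_iota /= ltn_ord.
Qed.

Lemma best_singleP : legal (best_single M) /\
  forall x : V, coverage M [:: nat_of_ord x] <= coverage M (best_single M).
Proof.
rewrite /best_single size_adj_matrix iota_vals.
have gen (r : seq V) b' : legal b' ->
    let b := foldl (fun b x => better M [:: x] b) b' (vals r) in
    [/\ legal b, coverage M b' <= coverage M b &
        forall y, y \in r -> coverage M [:: nat_of_ord y] <= coverage M b].
  elim: r b' => [|y r IH] b' L //=.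
  have [|h0 h1 h2] := IH (better M [:: nat_of_ord y] b').
    by rewrite /better; case: ifP => _ //; exists [:: y].
  have [h3 h4] := betterP [:: nat_of_ord y] b'.
  split=> // [|w]; first exact: leq_trans h4 h1.
  by rewrite inE => /orP[/eqP ->|/h2 //]; apply: leq_trans h3 h1.
have [|h0 _ h2] := gen (enum V) [:: 0]; last by split=> // x; apply: h2; rewrite mem_enum.
by exists [:: x0]; rewrite /= ?x00.
Qed.

(** Lists are compared only after an instruction has been executed, hence the restriction to
    nonempty [l1]. *)
Lemma trialP o tau b : legal b ->
  let p (v : V) := nth 0 (profits M tau) v in
  let mu := 9 * k.-1 in let cap := 9 * (k * n) in
  let s0 := moat_init p mu in
  let l := flatten (nseq (18 * (k * n)).+1
     ([seq (true, e) | e <- all_pairs] ++ [:: (false, (x0, x0))])) in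
  let c := trial M k o tau b in
  [/\ legal c, coverage M b <= coverage M c &
    forall l1 l2 x, l = l1 ++ l2 -> l1 != [::] ->
      coverage M (vals (take k (walk (foldl (moat_act (@adj G) o cap) s0 l1) x x))) <= coverage M c].
Proof.
move=> L p mu cap s0 l; rewrite /trial size_adj_matrix (schedule_vinstr _ x00) -/l -/cap -/mu.
have gen r c s b' now : represents c s -> moat_inv (@adj G) p mu o now s -> legal b' ->
   let b2 := (foldl (fun sb i => gstep M k o cap i sb) (c, b') (map vinstr r)).2 in
   [/\ legal b2, coverage M b' <= coverage M b2 &
    forall l1 l2 x, r = l1 ++ l2 -> l1 != [::] ->
      coverage M (vals (take k (walk (foldl (moat_act (@adj G) o cap) s l1) x x))) <= coverage M b2].
  elim: r c s b' now => [|i r IH] c s b' now rp I L' /=.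
    by split=> // -[].
  set c1 := act M o cap c (vinstr i); pose s1 := moat_act (@adj G) o cap s i.
  have rp1 : represents c1 s1 by apply: act_represents.
  have [now1 I1] : exists now1, moat_inv (@adj G) p mu o now1 s1.
    rewrite /s1 /moat_act; case: ifP => _; last by exists now.+1; apply: moat_grow_inv.
    case: ifP => m; last by exists now.
    exists now; apply: moat_merge_inv => //.
    by apply: act_pair_mergeable => //; apply: adj_sym.
  have [_ _ _ hr] := rp1.
  have L1 : legal (update_best M k c1 b').
    rewrite /update_best size_adj_matrix iota_vals.
    elim: (enum V) b' L' => //= y q IHq b' L'; apply: IHq; rewrite /better; case: ifP => _ //.
    exists (take k (walk s1 y y)); first by rewrite hr map_take.
    have [q' e] := path_head I1 (joined_refl I1 y).
    rewrite chain_take ?(path_chain I1) // size_take_min geq_minl andbT /=.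
    by rewrite e; case: (k) k0.
  have [h1 h2 h3] := IH c1 s1 _ now1 rp1 I1 L1; have [u1 u2] := update_bestP c1 b'.
  split=> //; first exact: leq_trans u1 h2.
  move=> [|j l1] l2 x //= [<- e] _; rewrite -/s1.
  case: l1 e => [_|j' l1 e]; last by apply: (h3 _ l2).
  by apply: leq_trans h2; have := u2 x; rewrite hr map_take.
have I0 := moat_init_inv (@adj G) p mu o.
exact: (gen l _ s0 b 0 (init_represents _ _) I0 L).
Qed.

End Runs.

End Graph.

(** * Approximation guarantee *)

Lemma chain_rcons (V : finType) (adj : rel V) l v : chain adj l -> l != [::] ->
  has (adj^~ v) l -> chain adj (rcons l v).
Proof.
case: l => // x l c _ /hasP[u ul uv]; rewrite /chain rcons_cons -cats1 grows_cat.
rewrite [grows _ _ l]c /= andbT; apply/hasP; exists u => //.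
by move: ul; rewrite catrevE mem_cat mem_rev !inE orbC.
Qed.

Lemma chain_extend (V : finType) (adj : rel V) l v : chain adj l -> l != [::] ->
  (v \in l) || has (adj^~ v) l ->
  exists l', [/\ chain adj l', {subset l <= l'}, v \in l' & size l' <= (size l).+1].
Proof.
move=> c l0; case: (boolP (v \in l)) => [vl _|_ /= h]; first by exists l; split.
exists (rcons l v); split; rewrite ?size_rcons ?mem_rcons ?mem_head //.
  exact: chain_rcons.
by move=> w wl; rewrite mem_rcons inE wl orbT.
Qed.

Section Analysis.
Variable G : graph.
Local Notation n := (nv G).
Local Notation V := 'I_(nv G).
Local Notation M := (adj_matrix G).
Local Notation adjG := (@adj G).
Implicit Types (S D : {set V}).

Lemma connected_chain S : induces_connected S ->
  exists l, [/\ chain adjG l, l != [::], lset l = S & size l = #|S|].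
Proof.
case/andP=> /set0Pn[s0 s0S] /forall_inP con.
have con0 v : v \in S -> connect [rel x y | [&& x \in S, y \in S & adj x y]] s0 v.
  by move=> vS; have /forall_inP := con _ s0S; apply.
have H m : 0 < m <= #|S| -> exists l, [/\ chain adjG l, uniq l, s0 \in l,
    {subset l <= S} & size l = m].
  elim: m => // -[|m] IH /andP[_ hm].
    exists [:: s0]; split=> //; first by rewrite mem_head.
    by move=> x; rewrite inE => /eqP ->.
  have [|l [c u sl sub sz]] := IH; first by rewrite /= ltnW.
  have [v vS vl] : exists2 v, v \in S & v \notin l.
    apply/subsetPn; apply/negP => /subset_leq_card.
    by rewrite (card_uniqP u) sz leqNgt hm.
  (* The first edge by which a path in [S] from [s0] to [v] leaves [l]. *)
  have [x [y [xl yS yl xy]]] : exists x y, [/\ x \in l, y \in S, y \notin l & adj x y].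
    have /connectP[q qp qv] := con0 v vS.
    elim: q s0 sl qp qv {s0S con0 IH} => [|z q IHq] x xl /=.
      by move=> _ vx; rewrite vx xl in vl.
    move=> /andP[/and3P[_ zS xz] qp] qv; case: (boolP (z \in l)) => zl.
      exact: IHq qp qv.
    by exists x, z.
  exists (rcons l y); split; rewrite ?rcons_uniq ?yl ?size_rcons ?sz //.
  - by apply: chain_rcons => //; [case: (l) xl|apply/hasP; exists x].
  - by rewrite mem_rcons inE sl orbT.
  - by move=> w; rewrite mem_rcons inE => /orP[/eqP ->|/sub].
have S0 : 0 < #|S| by apply/card_gt0P; exists s0.
have [|l [c u sl sub sz]] := H #|S|; first by rewrite S0 leqnn.
exists l; split=> //; first by case: (l) sl.
apply/eqP; rewrite eqEcard; apply/andP; split.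
  by apply/subsetP => x; rewrite inE => /sub.
by rewrite -sz -(card_uniqP u); apply/subset_leq_card/subsetP => x xl; rewrite inE.
Qed.

(** Each vertex of [D] costs two vertices: one common to its neighbourhood and that of [S], then the
    vertex itself. *)
Lemma chain_span S D : induces_connected S ->
  (forall v, v \in D -> ~~ [disjoint cl_nbhd v & cl_nbhd_set S]) ->
  exists l, [/\ chain adjG l, {subset S <= l}, {subset D <= l} & size l <= #|S| + 2 * #|D|].
Proof.
move=> conS hD; have [l0 [c0 l00 lS sz]] := connected_chain conS.
have H (r : seq V) : {subset r <= D} -> exists l, [/\ chain adjG l, {subset S <= l},
    {subset r <= l} & size l <= #|S| + 2 * size r].
  elim: r => [|v r IH] sub.
    by exists l0; split=> //; [move=> x; rewrite -lS inE|rewrite sz muln0 addn0].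
  have [|l [c hS hr szl]] := IH; first by move=> x xr; apply: sub; rewrite inE xr orbT.
  have ln : l != [::].
    have [s sS] : exists s, s \in S by apply/set0Pn; case/andP: conS.
    by have := hS s sS; case: (l).
  have /set0Pn[u] : cl_nbhd v :&: cl_nbhd_set S != set0.
    by rewrite setI_eq0; apply: hD; apply: sub; rewrite mem_head.
  rewrite in_setI => /andP[uv /bigcupP[s sS us]].
  have [|l1 [c1 s1 u1 z1]] := chain_extend (v := u) c ln.
    move: us; rewrite inE => /orP[/eqP ->|su]; first by rewrite hS.
    by apply/orP; right; apply/hasP; exists s; rewrite ?hS.
  have ln1 : l1 != [::] by case: (l1) u1.
  have [|l2 [c2 s2 v2 z2]] := chain_extend (v := v) c1 ln1.
    move: uv; rewrite inE => /orP[/eqP <-|vu]; first by rewrite u1.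
    by apply/orP; right; apply/hasP; exists u; rewrite // adj_sym.
  exists l2; split=> //; first by move=> x /hS/s1/s2.
    by move=> x; rewrite inE => /orP[/eqP ->//|/hr/s1/s2].
  rewrite /=; move: (size l2) (size l1) (size l) (size r) #|S| szl z1 z2 => ? ? ? ? ?.
  by clear; lia.
have [x|l [c hS hr szl]] := H (enum D); first by rewrite mem_enum.
exists l; split=> //; first by move=> x xD; apply: hr; rewrite mem_enum.
by rewrite [#|D|]cardE.
Qed.

(** Write k for k - 1 and ignore roundings. The choice of [tau] gives o < 2P and m o <= 2kP. If 18 c
    < o, then 9kc < kP and e o <= (k + 2m) o <= 6kP, so the right side stays below 7kP < 9kP. The
    gap of 2kP absorbs [o.+1] and [k.-1], which is where the bounds by 18 enter. *)
Lemma trial_arith k o tau P m e c :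
  18 < k -> 18 < o -> 2 * k * tau.-1 < o -> o <= 2 * k * tau ->
  o <= P + k * tau.-1 -> m * tau <= P -> e <= k.-1 + 2 * m ->
  9 * k.-1 * P <= 9 * k.-1 * c + e * o.+1 -> o <= 18 * c.
Proof.
move=> hk ho h1 h2 h3 h4 h5 h6; rewrite leqNgt; apply/negP => hc.
have hP : o < 2 * P by lia.
have hmo : m * o <= 2 * k * P.
  apply: leq_trans (leq_mul (leqnn m) h2) _.
  by rewrite mulnCA mulnA -[2 * k * m * tau]mulnA leq_mul2l h4 orbT.
case: k hk h1 h2 h3 h5 h6 hmo => // k hk h1 h2 h3 /= h5 h6 hmo.
have h7 : e * o.+1 <= (k + 2 * m) * o.+1 by rewrite leq_mul2r h5 orbT.
have h8 : 18 * k * P <= k * o + 2 * (k * o.+1) + 4 * (m * o.+1).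
  have h : 2 * (9 * (k * c)) <= k * o.
    by have := leq_mul (leqnn k) (ltnW hc); rewrite mulnCA; clear; lia.
  move: h h6 h7; rewrite mulnDl -!mulnA.
  move: (k * c) (k * o) (e * o.+1) (k * o.+1) (m * o.+1) (k * P) => x1 x2 x3 x4 x5 x6.
  by clear; lia.
have h9 : 19 * (m * o.+1) <= 20 * (m * o) by rewrite mulnCA [X in _ <= X]mulnCA leq_mul2l; lia.
have h10 : 18 * (k.+1 * P) <= 19 * (k * P) by rewrite !mulnA leq_mul2r; lia.
have h11 : k * o <= k * (2 * P) by rewrite leq_mul2l (ltnW hP) orbT.
have h12 : 2 * k <= k * P by rewrite mulnC leq_mul2l; lia.
have h13 : 0 < k * P by rewrite muln_gt0; lia.
have hmo' : m * o <= 2 * (k.+1 * P) by rewrite mulnA.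
have h8' : 18 * (k * P) <= 3 * (k * o) + 2 * k + 4 * (m * o.+1) by lia.
have h11' : k * o <= 2 * (k * P) by lia.
have h14 : 10 * k <= k * P by rewrite mulnC leq_mul2l; lia.
move: (k * P) (k * o) (m * o.+1) (m * o) (k.+1 * P) h8' h9 h10 h11' h13 h14 hmo' => a b d f g.
clear; lia.
Qed.

Lemma card_bigcup_le S (F : V -> {set V}) : #|\bigcup_(v in S) F v| <= \sum_(v in S) #|F v|.
Proof.
elim/big_rec2: _ => [|v a B _ h]; first by rewrite cards0.
by apply: leq_trans (leq_card_setU _ _) _; rewrite leq_add2l.
Qed.

Lemma sum_le_card S (F : V -> nat) m : (forall v, v \in S -> F v <= m) ->
  \sum_(v in S) F v <= #|S| * m.
Proof. by move=> h; rewrite -sum_nat_const leq_sum. Qed.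

(** With radius and age cancelled, [prefix_cost] for [k] distinct vertices reads (k - 1) o <= 18 (k
    - 1) p(prefix). A shorter walk is the whole core. *)
Lemma caught_prefix (p : V -> nat) mu o now (s : moat V) x k :
  moat_inv adjG p mu o now s -> radius s x = age s x -> 0 < k -> mu = 9 * k.-1 -> 1 < k ->
  o <= 18 * psum p (core s x) -> o <= 18 * psum p (lset (take k (walk s x x))).
Proof.
move=> I rx k0 muE k1 hc; have := prefix_cost I (joined_refl I x) k0; rewrite rx.
case: (leqP (size (walk s x x)) k) => hs; first by rewrite take_oversize.
have -> : #|lset (take k (walk s x x))| = k.
  have u : uniq (take k (walk s x x)) by rewrite take_uniq // (path_uniq I).
  by rewrite cardsE (card_uniqP u) size_takel // ltnW.
move: (psum _ _) (age _ _) => q a; rewrite muE.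
case: k k0 k1 {hs muE} => // k _ k1 /= h.
have {h}: k * o <= k * (18 * q) by rewrite mulnS in h; move: h; clear; lia.
by rewrite leq_pmul2l.
Qed.

Section Solver.
Variables (k : nat) (x0 : V).
Hypotheses (k0 : 0 < k) (x00 : nat_of_ord x0 = 0).

Lemma trial_good S : 18 < k -> induces_connected S -> #|S| <= k -> 18 < #|cl_nbhd_set S| ->
  exists tau, 0 < tau <= n /\ forall b, legal G k b ->
    (forall x : V, coverage M [:: nat_of_ord x] <= coverage M b) ->
    #|cl_nbhd_set S| <= 18 * coverage M (trial M k #|cl_nbhd_set S| tau b).
Proof.
move=> hk conS Sk; set o := #|cl_nbhd_set S| => ho.
have on : o <= n by rewrite -[n]card_ord max_card.
(* This is o / 2k rounded up, so [k] neighbourhoods, each with fewer than [tau] uncovered vertices,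
   miss less than half of [o]. *)
pose tau := (o.-1 %/ (2 * k)).+1; exists tau.
have tau0 : 0 < tau by [].
have k2 : 0 < 2 * k by rewrite muln_gt0.
have t1 : 2 * k * tau.-1 < o.
  by rewrite -[X in _ < X](ltn_predK ho) ltnS /= mulnC leq_trunc_div.
have t2 : o <= 2 * k * tau.
  by rewrite -[X in X <= _](ltn_predK ho) mulnC ltn_ceil.
split.
  by rewrite /= (leq_trans _ on) // -[X in _ <= X](ltn_predK ho) ltnS leq_div.
move=> b L single; have [cov [hA hB hC hD]] := profits_spec G tau0.
set p := fun v : V => nth 0 (profits M tau) v in hA hB hC hD.
pose D := [set v : V | ~~ [disjoint cl_nbhd v & cl_nbhd_set S] & 0 < p v].
pose P := \sum_(v in D) p v.
have hP : o <= P + k * tau.-1.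
  rewrite /o -(cardsID cov); apply: leq_add.
    apply: leq_trans (hB _) _; rewrite /P [X in X <= _](bigID (fun v => 0 < p v)) /=.
    rewrite [X in _ + X]big1 ?addn0; last first.
      by move=> v /andP[_]; rewrite -eqn0Ngt => /eqP.
    by rewrite leq_eqVlt; apply/orP; left; apply/eqP/eq_bigl => v; rewrite inE.
  have sub : cl_nbhd_set S :\: cov \subset \bigcup_(v in S) (cl_nbhd v :\: cov).
    apply/subsetP => u; rewrite in_setD => /andP[uc /bigcupP[v vS uv]].
    by apply/bigcupP; exists v; rewrite // in_setD uc.
  apply: leq_trans (subset_leq_card sub) _; apply: leq_trans (card_bigcup_le _ _) _.
  apply: leq_trans (sum_le_card (m := tau.-1) _) _; last by rewrite leq_mul2r Sk orbT.
  by move=> v _; apply: hC.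
have hm : #|D| * tau <= P.
  rewrite -sum_nat_const; apply: leq_sum => v; rewrite inE => /andP[_ pv].
  by case: (hD v) => // h; move: pv; rewrite /p h.
have [|w [cw wS wD sw]] := chain_span (D := D) conS.
  by move=> v; rewrite inE => /andP[].
have [E [sE aE cE]] := chain_edges cw.
pose W := lset w.
have crossE (C : {set V}) : (exists2 u, u \in W & u \in C) -> (exists2 u, u \in W & u \notin C) ->
    has (fun e => (e.1 \in C) != (e.2 \in C)) E.
  by move=> [u + uC] [v + vC]; rewrite !inE => uW vW; apply: cE; [exists u|exists v].
have szE : size E <= k.-1 + 2 * #|D|.
  rewrite sE; case: (k) k0 Sk => // k' _ Sk' /=.
  move: (size w) #|S| #|D| sw Sk' => a b' c; clear; lia.
have PW : P <= psum p W.
  by apply: psum_le; apply/subsetP => v vD; rewrite inE; apply: wD.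
pose mu := 9 * k.-1; pose cap := 9 * (k * n).
have capP : mu * \sum_v p v <= cap.
  have hs : \sum_v p v <= n.
    apply: leq_trans (_ : \sum_(v in [set: V]) p v <= _).
      by apply: eq_leq; apply: eq_bigl => v; rewrite inE.
    by apply: leq_trans (hA _) _; rewrite -[X in _ <= X]card_ord max_card.
  rewrite /mu /cap -mulnA leq_mul2l /=; apply: leq_mul => //; exact: leq_pred.
have [hL hb hcand] := trialP k0 x00 o tau L.
have := @moat_run _ _ p mu o cap (@adj_sym G) capP W E aE crossE (false, (x0, x0))
  (all_pairs G) (18 * (k * n)).+1 isT (@mem_all_pairs G).
case=> [|[l1 [l2 [now [lE I [x [rx hx]]]]]]|bad].
- by rewrite /cap ltnS; clear; lia.
- set s := foldl _ _ l1 in I rx hx.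
  have hcore : o <= 18 * psum p (core s x).
    apply: (trial_arith hk ho t1 t2 hP hm szE).
    rewrite -/mu; apply: leq_trans (leq_add (leqnn _) hx).
    rewrite -mulnDr leq_mul2l; apply/orP; right; apply: leq_trans PW _.
    apply: leq_trans (psum_setU_le _ _ _); apply: psum_le.
    by apply/subsetP => v vW; rewrite in_setU in_setD vW andbT orbN.
  have hpre := caught_prefix I rx k0 erefl (leq_trans _ hk) hcore.
  apply: leq_trans (hpre isT) _; rewrite leq_mul2l /=.
  apply: leq_trans (hA _) _; rewrite -coverageE.
  (* In the initial state the core is a single vertex, which the starting list [b] already
     matches. *)
  case: (boolP (l1 == [::])) => l10; last exact: (hcand l1 l2 x lE l10).
  have -> : take k (walk s x x) = [:: x].
    by rewrite /s (eqP l10) /= eqxx; case: (k) k0.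
  exact: leq_trans (single x) hb.
(* Potential cannot run out before W is swallowed: the same arithmetic with profit 0 would give o =
   0. *)
- have : o <= 18 * 0; last by rewrite muln0; move: ho; clear; lia.
  apply: (trial_arith hk ho t1 t2 hP hm szE); rewrite muln0 add0n.
  by apply: leq_trans bad; rewrite leq_mul2l PW orbT.
Qed.

Lemma solveP : legal G k (solve M k) /\
  forall S, induces_connected S -> #|S| <= k -> #|cl_nbhd_set S| <= 18 * coverage M (solve M k).
Proof.
have [L0 single] := best_singleP k0 x00.
pose F b (ot : nat * nat) := trial M k ot.1.+1 ot.2.+1 b.
have keep r b : legal G k b -> legal G k (foldl F b r) /\ coverage M b <= coverage M (foldl F b r).
  elim: r b => [|ot r IH] b L //=; have [L1 h1 _] := trialP k0 x00 ot.1.+1 ot.2.+1 L.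
  by have [L2 h2] := IH _ L1; split=> //; apply: leq_trans h1 h2.
have solveE : solve M k = foldl F (best_single M) (grid n) by rewrite /solve size_adj_matrix.
have [Ls hs] := keep (grid n) _ L0; rewrite solveE; split=> // S conS Sk.
have big : coverage M (best_single M) <= coverage M (foldl F (best_single M) (grid n)) by [].
(* For at most 18 vertices the best star covers a sufficient share, by the union bound. *)
case: (leqP k 18) => hk.
  have hx : #|cl_nbhd_set S| <= #|S| * coverage M (best_single M).
    apply: leq_trans (card_bigcup_le _ _) (sum_le_card _) => v _.
    apply: leq_trans (single v); rewrite -[[:: _]]/([seq nat_of_ord i | i <- [:: v]]) coverageE.
    by apply/subset_leq_card/subsetP => u uv; apply/bigcupP; exists v; rewrite // inE mem_head.
  apply: leq_trans hx _; apply: leq_mul big; exact: leq_trans Sk hk.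
(* Here it is enough that the solution covers at least one vertex. *)
case: (leqP #|cl_nbhd_set S| 18) => ho.
  apply: leq_trans ho _; rewrite -[X in X <= _]muln1 leq_mul2l /=.
  have [l e /and3P[l0 _ _]] := Ls; rewrite e coverageE.
  case: l l0 {e} => // v l _; apply/card_gt0P; exists v; apply/bigcupP; exists v.
    by rewrite inE mem_head.
  by rewrite inE eqxx.
pose o := #|cl_nbhd_set S|.
have on : o <= n by rewrite -[n]card_ord max_card.
have [tau [/andP[t0 tn] ht]] := trial_good hk conS Sk ho.
have : (o.-1, tau.-1) \in grid n.
  apply/flattenP; exists [seq (o.-1, v) | v <- iota 0 n].
    by apply/mapP; exists o.-1; rewrite // mem_iota /= add0n (ltn_predK ho) on.
  by apply: map_f; rewrite mem_iota /= add0n prednK.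
case/splitPr=> r1 r2; rewrite foldl_cat /=.
have [L1 h1] := keep r1 _ L0.
have := ht _ L1 (fun x => leq_trans (single x) h1); rewrite -/o => h.
have [L2 _ _] := trialP k0 x00 o tau L1.
have [_ h2] := keep r2 _ L2.
have FE : F (foldl F (best_single M) r1) (o.-1, tau.-1) = trial M k o tau (foldl F (best_single M) r1).
  by rewrite /F /= (ltn_predK ho) (prednK t0).
by rewrite FE; apply: leq_trans h _; rewrite leq_mul2l h2.
Qed.

End Solver.

End Analysis.

Lemma enc_instanceE I : enc_instance I = code (adj_matrix (bgraph I), binary (budget I)).
Proof.
rewrite /enc_instance /enc_graph /enc_bits; congr Node.
by rewrite /adj_matrix /code /codable_pair /= /code /codable_seq -map_comp.
Qed.

Lemma enc_setE (G : graph) (l : seq nat) :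
  enc_set [set v : 'I_(nv G) | (v : nat) \in l] = code [seq v \in l | v <- iota 0 (nv G)].
Proof.
rewrite /enc_set /enc_bits /code /codable_seq; congr enc_seq.
by rewrite iota_vals -!map_comp; apply: eq_map => v; rewrite /= inE.
Qed.

Lemma bcds_solver_correct (I : bcds_instance) :
  exists S : {set 'I_(nv (bgraph I))},
    [/\ enc_set S = code (bcds_solver (adj_matrix (bgraph I), binary (budget I))),
        feasible S & bcds_opt I <= 18 * #|cl_nbhd_set S|].
Proof.
set G := bgraph I; have /andP[/set0Pn[v0 _] _] := bgraph_connected I.
have n0 : 0 < nv G by apply: leq_ltn_trans (ltn_ord v0).
have kE := cappedE (nv G) (budget_gt0 I).
set k := minn (budget I) (nv G) in kE.
have k0 : 0 < k by rewrite leq_min budget_gt0.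
have [[l e /and3P[l0 cl sl]] opt] := @solveP G k (Ordinal n0) k0 erefl.
exists (lset l); split.
- rewrite /bcds_solver /= size_adj_matrix kE -enc_setE e; congr enc_set.
  by apply/setP => v; rewrite !inE mem_map //; apply: val_inj.
- apply/andP; split.
    apply: leq_trans (_ : size l <= _); first by rewrite cardsE card_size.
    by apply: leq_trans sl (geq_minl _ _).
  have [x xl] : exists x, x \in l by case: (l) l0 => // x r _; exists x; rewrite mem_head.
  apply/andP; split; first by apply/set0Pn; exists x; rewrite inE.
  set R := [rel _ _ | _]; have Rsym : connect_sym R.
    by apply: sym_connect_sym => u v; rewrite /= adj_sym andbCA.
  have con u : u \in l -> connect R (head x l) u.
    move=> ul; have sub : {subset l <= lset l} by move=> y; rewrite inE.
    have -> : head x l = head u l by case: (l) ul.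
    exact: chain_connect.
  apply/forall_inP => u; rewrite inE => ul; apply/forall_inP => v; rewrite inE => vl.
  by apply: connect_trans (con v vl); rewrite Rsym con.
(* No set has more than [n] vertices, so capping the budget excludes no competitor. *)
- apply/bigmax_leqP => S /andP[SB conS]; rewrite -coverageE -e; apply: opt => //.
  by rewrite leq_min SB -[X in _ <= X]card_ord max_card.
Qed.

Local Open Scope ring_scope.

(* [e^-c] lies above its tangent at [3/4], and [e^(-3/4) >= (29/32)^8 >= 4/9]. *)
Lemma ratio_le (R : realType) (c : R) : 0 < c -> c <= 1 ->
  (1 - expR (- c)) / ((Num.ceil (8%:R * c))%:~R + 4%:R) <= 18%:R^-1.
Proof.
move=> c0 c1.
have ceil : 8%:R * c <= (Num.ceil (8%:R * c))%:~R by exact: ceil_ge.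
have e34 : 4%:R / 9%:R <= expR (- (3%:R / 4%:R)) :> R.
  have -> : - (3%:R / 4%:R) = 8%:R * (- (3%:R / 32%:R)) :> R by lra.
  rewrite expRM_natl.
  have h : 29%:R / 32%:R <= expR (- (3%:R / 32%:R)) :> R.
    by apply: le_trans (expR_ge1Dx _); lra.
  have h2 : 82%:R / 100%:R <= expR (- (3%:R / 32%:R)) ^+ 2 :> R by nra.
  have h4 : 67%:R / 100%:R <= expR (- (3%:R / 32%:R)) ^+ 2 ^+ 2 :> R by nra.
  rewrite -[X in expR _ ^+ X]/(2 * 2 * 2)%N !exprM; move: (_ ^+ 2 ^+ 2) h4 => y hy.
  by rewrite expr2; nra.
have tangent : (4%:R / 9%:R) * (7%:R / 4%:R - c) <= expR (- c).
  have -> : - c = - (3%:R / 4%:R) + (3%:R / 4%:R - c) by lra.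
  rewrite expRD; apply: ler_pM => //; [lra|lra|].
  by apply: le_trans (expR_ge1Dx _); lra.
(* The tangent turns 18 (1 - e^-c) into at most 18 - 8 (7/4 - c) = 8c + 4, exactly the lower bound
   for the denominator; 3/4 and 4/9 are chosen for this. *)
rewrite ler_pdivrMr; lra.
Qed.

Theorem theorem3 (R : realType) (c : R) (c_gt0 : 0 < c) (c_le1 : c <= 1) :
  exists p : cmd,
    bcds_polynomial_time p /\
    bcds_approximation
      ((1 - expR (- c)) / ((Num.ceil (8%:R * c))%:~R + 4%:R)) p.
Proof.
have [p [N [b [[_ [d hd]] H]]]] := ptime_bcds_solver.
exists p; split.
  (* Codes have size x >= 1, hence (x + 2)^d <= 3^d x^d. *)
  exists (3 ^ d)%N, d => I; set x := (adj_matrix (bgraph I), binary (budget I)).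
  have [t [s' [e1 e2 _ e4 _]]] := H x (update (fun=> Leaf) 0%N (enc_instance I)) (enc_instanceE I).
  exists t, (s' 0%N); split; first by exists s'.
  apply: leq_trans e4 _; apply: leq_trans (hd _) _; rewrite -expnMn.
  case: (d) => // d'; rewrite leq_exp2r // enc_instanceE -[tree_size _]/(csize x).
  have h : (0 < csize x)%N by apply: csize_gt0.
  by move: (csize x) h => m; lia.
move=> I; set x := (adj_matrix (bgraph I), binary (budget I)).
have [t [s' [e1 e2 _ _ _]]] := H x (update (fun=> Leaf) 0%N (enc_instance I)) (enc_instanceE I).
have [S [eS fS oS]] := bcds_solver_correct I.
exists t, S; split=> //; first by rewrite eS; exists s'.
have : (bcds_opt I)%:R <= 18%:R * #|cl_nbhd_set S|%:R :> R by rewrite -natrM ler_nat.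
have := ler_wpM2r (ler0n R (bcds_opt I)) (ratio_le c_gt0 c_le1).
move: (_ / _) => q; lra.
Qed.
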